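(* For each $\sigma,\gamma\in\mathcal C$, $\sigma\ne\gamma$, the scattering coefficients satisfy $$b_\gamma\big(\theta_\gamma(\omega)^{-1}-\theta_\gamma(\omega)\big)s_{\gamma\sigma}(\omega)=b_\sigma\big(\theta_\sigma(\omega)^{-1}-\theta_\sigma(\omega)\big)s_{\sigma\gamma}(\omega),\qquad\omega\in\overline{\mathbb D}\setminus\Omega.$$ In addition, the scattering coefficients $s_{\gamma\sigma}(\omega)$ and $s_{\sigma\gamma}(\omega)$ are continuous up to $\mathbb T\setminus\Omega$.
   Context: **System.** $\mathcal A$ is a countable set (''particles'') and $\mathcal L=(L(\alpha,\beta))_{\alpha,\beta\in\mathcal A}$ is a real symmetric matrix with finitely many non-zero entries in each row, such that $\mathcal L>0$ as an operator in $l^2(\mathcal A)$. Particles $\alpha,\beta$ interact if $L(\alpha,\beta)\ne0$. A channel is a sequence $\sigma=\{\sigma(k)\}_{k\ge0}$ of particles such that for $k>0$ the particle $\sigma(k)$ interacts, apart from possibly itself (external field), only with $\sigma(k-1)$ and $\sigma(k+1)$, while $\sigma(0)$ interacts with $\sigma(1)$ and some other particles not in $\sigma$. The set $\mathcal C$ of all channels is finite, the attachment points $\sigma(0)$ are pairwise distinct, $\mathcal A_0=\bigcup_{\sigma\in\mathcal C}\{\sigma(k):k\ge1\}$, and $\mathcal A_1=\mathcal A\setminus\mathcal A_0$ is finite. Put $\mathfrak b_\sigma(k-1)=-L(\sigma(k-1),\sigma(k))$, $\mathfrak a_\sigma(k)=L(\sigma(k),\sigma(k))$, $k\ge1$; it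 is assumed that $\mathfrak b_\sigma(k)>0$. There are $a_\sigma\in\mathbb R$, $b_\sigma>0$ and $\epsilon>0$ with $\sum_{k\ge1}(1+\epsilon)^k\{|\mathfrak a_\sigma(k)-a_\sigma|+|\mathfrak b_\sigma(k)-b_\sigma|\}<\infty$ for every $\sigma\in\mathcal C$. The set $\bigcup_\sigma(a_\sigma-2b_\sigma,a_\sigma+2b_\sigma)$ is connected, and $a,b$ are such that $\bigcup_\sigma[a_\sigma-2b_\sigma,a_\sigma+2b_\sigma]=[a-2b,a+2b]$. **Spectral variables.** $\mathbb D$ is the unit disk, $\mathbb T$ the unit circle, $W(\omega)=a-b(\omega+\omega^{-1})$, $W_\sigma(\theta)=a_\sigma-b_\sigma(\theta+\theta^{-1})$ on $\mathbb D$, $\lambda(\omega)=W(\omega)$, $\theta_\sigma(\omega)=W_\sigma^{-1}\circ W(\omega)\in\mathbb D$ for $\omega\in\mathbb D$, extended to $\overline{\mathbb D}$. **Jost solutions.** For each $\sigma$, $e_\sigma(k,\theta)$, $k\ge0$, is the solution of $-\mathfrak b_\sigma(k-1)e_\sigma(k-1,\theta)+\mathfrak a_\sigma(k)e_\sigma(k,\theta)-\mathfrak b_\sigma(k)e_\sigma(k+1,\theta)=W_\sigma(\theta)e_\sigma(k,\theta)$, $k\ge1$, with $e_\sigma(k,\theta)=\theta^k(1+o(1))$ as $k\to\infty$, holomorphic in $\theta$ in a neighbourhood of $\overline{\mathbb D}$. **Matrix $U$.** $\mathcal L_1=(L(\alpha,\beta))_{\alpha,\beta\in\mathcal A_1}$,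 $(\mathcal L_1-\lambda I)^{-1}=(r(\alpha,\beta;\lambda))_{\alpha,\beta\in\mathcal A_1}$, $\mathcal R(\lambda)=(r(\sigma(0),\nu(0);\lambda))_{\sigma,\nu\in\mathcal C}$. Put $B=\mathrm{diag}\{b_\sigma\}$, $B(0)=\mathrm{diag}\{\mathfrak b_\sigma(0)\}$, $\mathcal E(k,\omega)=\mathrm{diag}\{e_\sigma(k,\theta_\sigma(\omega))\}$, $D(\omega)=\mathrm{diag}\{\theta_\sigma(\omega)^{-1}-\theta_\sigma(\omega)\}$, $P(k,\omega)=\mathrm{diag}\{p_\sigma(k,\omega)\}$, where $p_\sigma$ solves $-\mathfrak b_\sigma(k-1)p_\sigma(k-1)+\mathfrak a_\sigma(k)p_\sigma(k)-\mathfrak b_\sigma(k)p_\sigma(k+1)=\lambda(\omega)p_\sigma(k)$, $k\ge1$, $p_\sigma(0)=1$, $p_\sigma(1)=0$. Let $T(\omega)=\mathcal E(0,\omega)-\mathcal R(\lambda(\omega))B(0)\mathcal E(1,\omega)$ and $$U(k,\omega)=[-P(k,\omega)+\mathcal E(k,\omega)T(\omega)^{-1}]BB(0)^{-1}D(\omega)\mathcal E(1,\omega)^{-1}=(u_{\nu\sigma}(k,\omega))_{\nu,\sigma\in\mathcal C}.$$ The off-diagonal scattering coefficients are defined by $u_{\gamma\sigma}(k,\omega)=s_{\gamma\sigma}(\omega)e_\gamma(k,\theta_\gamma(\omega))$, $\gamma\ne\sigma$, $k\ge0$. $\Omega\subset\overline{\mathbb D}\setminus\{0\}$ is the finite set of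 non-zero poles of $U(k,\cdot)$, $k\geq 0$, in $\overline{\mathbb D}$. At $\omega=0$ (where $\theta_\sigma(0)=0$) identities are understood by passing to the limit. *)

(* Defs.v *)
(* Mathematical Components and MathComp-Analysis. *)
From HB Require Import structures.
From mathcomp Require Import all_boot all_order all_algebra.
From mathcomp Require Import complex.
From mathcomp Require Import all_classical all_reals all_analysis.
Set Implicit Arguments.
Unset Strict Implicit.
Unset Printing Implicit Defensive.
Import Order.TTheory GRing.Theory Num.Theory numFieldNormedType.Exports.
Local Open Scope classical_set_scope.
Local Open Scope ring_scope.

(* R[i] as a constant of type numClosedFieldType, so that it receives the
   topology and the normed-module structure that the library puts on the
   carrier of every numFieldType. *)
Definition Cplx (R : realType) : numClosedFieldType := (R[i])%C.
Definition toC (R : realType) (x : R) : Cplx R := (x%:C)%C.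

Section LTwo.
Variables (R : realType) (A : countType).

Definition l2 (x : A -> R) : Prop :=
  summable [set: A] (fun al => (x al ^+ 2)%:E).

(* \esum is meant for nonnegative families: positive and negative parts are
   summed separately. *)
Definition signed_sum (f : A -> R) : \bar R :=
  (\esum_(al in [set: A]) ((EFin \o f)^\+ al)
   - \esum_(al in [set: A]) ((EFin \o f)^\- al))%E.

End LTwo.

Section Particles.
Variables (R : realType) (A : countType) (L : A -> A -> R).

Definition interact (al be : A) : bool := L al be != 0.

Definition finite_rows : Prop :=
  forall al, finite_set [set be | interact al be].

Definition apply_op (x : A -> R) (al : A) : R :=
  \sum_(be \in [set be | interact al be]) L al be * x be.

Definition positive_op : Prop :=
  forall x : A -> R, l2 x -> (exists al, x al != 0) ->
    (0 < signed_sum (fun al => (apply_op x al * x al)%R))%E.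

Record is_channel (s : nat -> A) : Prop := IsChannel {
  channel_inj : injective s;
  channel_next : forall k, interact (s k) (s k.+1);
  channel_only : forall k be, interact (s k.+1) be ->
    be = s k \/ be = s k.+1 \/ be = s k.+2;
  channel_other : exists2 be, ~ range s be & interact (s 0%N) be }.

End Particles.

(* m channels; the n particles of A_1 are listed by core, and attach c is the
   position in this list of the attachment point of the channel c. *)
Record system (R : realType) (A : countType) (m n : nat) := System {
  coupling : A -> A -> R;
  channel : 'I_m -> nat -> A;
  core : 'I_n -> A;
  attach : 'I_m -> 'I_n;
  a_ch : 'I_m -> R;
  b_ch : 'I_m -> R;
  a_tot : R;
  b_tot : R }.

Section Scattering.
Variables (R : realType) (A : countType) (m n : nat) (S : system R A m n).
Local Notation C := (Cplx R).

Definition bcoef (c : 'I_m) (k : nat) : R :=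
  - coupling S (channel S c k) (channel S c k.+1).

(* acoef c k is only used for k >= 1. *)
Definition acoef (c : 'I_m) (k : nat) : R :=
  coupling S (channel S c k) (channel S c k).

Definition A0 : set A := [set al | exists c k, al = channel S c k.+1].

Record admissible : Prop := Admissible {
  coupling_sym : forall al be, coupling S al be = coupling S be al;
  coupling_rows : finite_rows (coupling S);
  coupling_pos : positive_op (coupling S);
  channelP : forall c, is_channel (coupling S) (channel S c);
  (* A tail of a channel is again a channel, hence "all channels" is
     understood up to the choice of the starting point. *)
  channel_all : forall t, is_channel (coupling S) t ->
    exists c j k, forall i, t (j + i)%N = channel S c (k + i)%N;
  attach_distinct : injective (fun c => channel S c 0%N);
  core_inj : injective (core S);
  core_range : range (core S) = ~` A0;
  core_attach : forall c, core S (attach S c) = channel S c 0%N;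
  bcoef_gt0 : forall c k, 0 < bcoef c k;
  b_ch_gt0 : forall c, 0 < b_ch S c;
  coef_decay : exists2 eps : R, 0 < eps & forall c,
    cvgn [series (1 + eps) ^+ k.+1
      * (`|acoef c k.+1 - a_ch S c| + `|bcoef c k.+1 - b_ch S c|)]_k;
  bands_connected : connected
    (\bigcup_(c in [set: 'I_m])
       `]a_ch S c - 2 * b_ch S c, a_ch S c + 2 * b_ch S c[%classic);
  bands_union :
    \bigcup_(c in [set: 'I_m])
       `[a_ch S c - 2 * b_ch S c, a_ch S c + 2 * b_ch S c]%classic
    = `[a_tot S - 2 * b_tot S, a_tot S + 2 * b_tot S]%classic }.

Definition closed_disk : set C := [set w | `|w| <= 1].

Definition zhukovsky (a b : R) (z : C) : C := toC a - toC b * (z + z^-1).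
Definition lambda (w : C) : C := zhukovsky (a_tot S) (b_tot S) w.
Definition W_ch (c : 'I_m) (t : C) : C := zhukovsky (a_ch S c) (b_ch S c) t.

(* theta_sigma = W_sigma^-1 \o W on the open disk, extended by continuity to
   the closed one; W and W_sigma take the value infinity at 0. *)
Record spectral_map (theta : 'I_m -> C -> C) : Prop := SpectralMap {
  theta0 : forall c, theta c 0 = 0;
  theta_inv : forall c w, 0 < `|w| < 1 ->
    0 < `|theta c w| < 1 /\ W_ch c (theta c w) = lambda w;
  theta_cont : forall c, {within closed_disk, continuous (theta c)} }.

Definition channel_eq (c : 'I_m) (z : C) (f : nat -> C) : Prop :=
  forall k, - toC (bcoef c k) * f k + toC (acoef c k.+1) * f k.+1
    - toC (bcoef c k.+1) * f k.+2 = z * f k.+1.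

Record jost_solution (e : 'I_m -> nat -> C -> C) : Prop := JostSolution {
  jost_eq : forall c t, 0 < `|t| <= 1 ->
    channel_eq c (W_ch c t) (fun k => e c k t);
  jost_asymp : forall c t, 0 < `|t| <= 1 ->
    e c k t / t ^+ k @[k --> \oo] --> (1 : C);
  jost_holo : forall c, exists V : set C,
    [/\ open V, closed_disk `<=` V &
        forall k t, V t -> derivable (e c k) t 1] }.

Record p_solution (p : 'I_m -> nat -> C -> C) : Prop := PSolution {
  p_eq : forall c w, 0 < `|w| <= 1 ->
    channel_eq c (lambda w) (fun k => p c k w);
  p_init0 : forall c w, 0 < `|w| <= 1 -> p c 0%N w = 1;
  p_init1 : forall c w, 0 < `|w| <= 1 -> p c 1%N w = 0 }.

Section UMatrix.
Variables (theta : 'I_m -> C -> C) (e p : 'I_m -> nat -> C -> C).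

Definition L1mx : 'M[C]_n :=
  \matrix_(i, j) toC (coupling S (core S i) (core S j)).

Definition Rmx (z : C) : 'M[C]_m :=
  \matrix_(c, d) invmx (L1mx - z%:M) (attach S c) (attach S d).

Definition Bmx : 'M[C]_m := diag_mx (\row_c toC (b_ch S c)).
Definition B0mx : 'M[C]_m := diag_mx (\row_c toC (bcoef c 0)).
Definition Emx (k : nat) (w : C) : 'M[C]_m :=
  diag_mx (\row_c e c k (theta c w)).
Definition Dmx (w : C) : 'M[C]_m :=
  diag_mx (\row_c ((theta c w)^-1 - theta c w)).
Definition Pmx (k : nat) (w : C) : 'M[C]_m := diag_mx (\row_c p c k w).

Definition Tmx (w : C) : 'M[C]_m :=
  Emx 0 w - Rmx (lambda w) *m B0mx *m Emx 1 w.

Definition Uformula (k : nat) (w : C) : 'M[C]_m :=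
  (- Pmx k w + Emx k w *m invmx (Tmx w))
    *m Bmx *m invmx B0mx *m Dmx w *m invmx (Emx 1 w).

(* The points at which every inverse in the formula for U exists. *)
Definition regular (w : C) : Prop :=
  [/\ closed_disk w, w != 0, L1mx - (lambda w)%:M \in unitmx,
      Tmx w \in unitmx & Emx 1 w \in unitmx].

Definition near_regular (w : C) : set_system C := within regular (nbhs w).

(* At the finitely many other points of the closed disk, among them 0, the
   value is the limit along regular points; it is meaningless at a pole. *)
Definition U (k : nat) (w : C) (c d : 'I_m) : C :=
  if `[< regular w >] then Uformula k w c d
  else lim (Uformula k z c d @[z --> near_regular w]).

Definition U_pole (k : nat) (w : C) : Prop :=
  exists c d, `|Uformula k z c d| @[z --> near_regular w] --> +oo.

Definition Omega : set C :=
  [set w | [/\ closed_disk w, w != 0 & exists k, U_pole k w]].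

Definition scattering_coef (s : 'I_m -> 'I_m -> C -> C) : Prop :=
  forall c d, c != d -> forall w, (closed_disk `\` Omega) w ->
    forall k, U k w c d = s c d w * e c k (theta c w).

End UMatrix.
End Scattering.

Arguments closed_disk {R}.

(* Main.v *)
Require Import Defs.
From HB Require Import structures.
From mathcomp Require Import all_boot all_order all_algebra.
From mathcomp Require Import complex.
From mathcomp Require Import all_classical all_reals all_analysis.
From mathcomp Require Import ring lra zify.
From mathcomp Require separable cyclic cyclotomic.
Set Implicit Arguments.
Unset Strict Implicit.
Unset Printing Implicit Defensive.
Import Order.TTheory GRing.Theory Num.Theory numFieldNormedType.Exports.
Local Open Scope classical_set_scope.
Local Open Scope ring_scope.

(** At a point where all the inverses in the formula for [U] exist, the
    off-diagonal entry [(c, d)] of [U k] is [e c k] times a number [scat c d],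
    and up to the factor [b_c b_d (1 / theta_c - theta_c)(1 / theta_d - theta_d)],
    symmetric in [c] and [d], the quantity [b_c (1 / theta_c - theta_c) scat c d]
    is an entry of [T^-1 (B(0) E(1))^-1].  Since [T = E(0) - R B(0) E(1)], this
    matrix is the inverse of [B(0) E(1) E(0) - B(0) E(1) R B(0) E(1)], and it is
    symmetric because the resolvent [R] of the symmetric matrix [L1] is
    ([resolvent_sym], [scat_symmetric]).  That is the reciprocity relation at
    regular points.

    The remaining points of the closed disk are reached by limits.  What has to
    be shown is that at a point which is not a pole, that is, where no entry
    of [U] tends to infinity, [scat] has a finite limit along the regular points.
    On the open disk this holds because [scat] is meromorphic, but the
    statement also concerns the circle, where [theta_c] has square-root branch
    points at the band edges.  It is enough that [scat] is a quotient of
    convergent power series in one local parameter [tau] with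
    [tau ^+ 2 = z - w]: such a quotient has a finite or an infinite limit
    ([puiseux_dichotomy]).  Two facts give this.

    First, all the functions [theta_c] are holomorphic in the same [tau]
    ([theta_uniformized]): [z (1 / theta_c - theta_c)] is a continuous square
    root of a polynomial in [z], and on the part of the disk near [w] such a root
    is unique up to sign ([sqrt_sign]).

    Second, the Jost solution is holomorphic across the unit circle in the strong
    sense of being a uniform limit of polynomials: [e c k t = t ^+ k * g k t]
    where [g k] is the limit of the Jost solutions of the truncated
    perturbations, which are polynomials ([rescaled_jost], [jost_unique],
    [jost_expansion]).  This also gives [g k 0 != 0].

    Once [scat] has limits along the regular points everywhere outside the poles,
    the coefficient [s] is equal to them ([scattering_value]), it is continuous as
    an extension by limits ([scattering_continuous]), and the reciprocity relation
    passes to the limit ([reciprocity]).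

    At the origin [lambda] is infinite.  With [mu = 1 / lambda], the off-diagonal
    entries of [R] are [mu ^+ 2] times minus the entries of [L1], up to higher
    order, while [mu / theta_c] tends to [- 1 / b_c].  Hence both sides of the
    relation converge ([flux_scat_near0]) and [s] tends to zero
    ([scat_near0]). *)

(** * Real-valued norm and limits in the complex plane *)

Lemma filter_meet {T} (F : set_system T) (FF : ProperFilter F) (P Q : set T) :
  F P -> F Q -> exists t, P t /\ Q t.
Proof. by move=> hP hQ; have [t [Pt Qt]] := @filter_ex _ _ FF _ (filterI hP hQ); exists t. Qed.

Section RealNorm.
Variable R : realType.
Local Notation C := (Cplx R).
Implicit Types x y z : C.

(** The norm of the field takes values in the field itself; estimates need real
    numbers, where the order is total. *)
Definition nrm z : R := complex.Re `|z|.

Lemma normE z : `|z| = toC (nrm z).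
Proof. by rewrite /toC /nrm RRe_real// normr_real. Qed.

Lemma toC0 : toC 0 = 0 :> C. Proof. by []. Qed.
Lemma toC1 : toC 1 = 1 :> C. Proof. by []. Qed.
Lemma toCD (a b : R) : toC (a + b) = toC a + toC b.
Proof. exact: (rmorphD (real_complex R)). Qed.
Lemma toCN (a : R) : toC (- a) = - toC a.
Proof. exact: (rmorphN (real_complex R)). Qed.
Lemma toCB (a b : R) : toC (a - b) = toC a - toC b.
Proof. exact: (rmorphB (real_complex R)). Qed.
Lemma toCM (a b : R) : toC (a * b) = toC a * toC b.
Proof. exact: (rmorphM (real_complex R)). Qed.
Lemma toCV (a : R) : toC a^-1 = (toC a)^-1.
Proof. exact: (fmorphV (real_complex R)). Qed.
Lemma toCX (a : R) n : toC (a ^+ n) = toC a ^+ n.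
Proof. exact: (rmorphXn (real_complex R)). Qed.
Lemma toC_nat n : toC n%:R = n%:R :> C.
Proof. exact: (rmorph_nat (real_complex R)). Qed.
Lemma toC_inj : injective (@toC R).
Proof. exact: complexI. Qed.
Lemma toC_eq0 (a : R) : (toC a == 0) = (a == 0).
Proof. exact: (fmorph_eq0 (real_complex R)). Qed.
Lemma toC_le (a b : R) : (toC a <= toC b) = (a <= b).
Proof. exact: lecR. Qed.
Lemma toC_lt (a b : R) : (toC a < toC b) = (a < b).
Proof. exact: ltcR. Qed.

Lemma nrm_ge0 z : 0 <= nrm z.
Proof. by rewrite -toC_le -normE normr_ge0. Qed.
Lemma nrm_eq0 z : (nrm z == 0) = (z == 0).
Proof. by rewrite -toC_eq0 -normE normr_eq0. Qed.
Lemma nrm_gt0 z : (0 < nrm z) = (z != 0).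
Proof. by rewrite lt_def nrm_eq0 nrm_ge0 andbT. Qed.
Lemma nrm0 : nrm 0 = 0. Proof. by apply/eqP; rewrite nrm_eq0. Qed.
Lemma nrmM x y : nrm (x * y) = nrm x * nrm y.
Proof. by apply: toC_inj; rewrite toCM -!normE normrM. Qed.
Lemma nrm1 : nrm 1 = 1.
Proof. by apply: toC_inj; rewrite -normE normr1. Qed.
Lemma nrmN x : nrm (- x) = nrm x.
Proof. by rewrite /nrm normrN. Qed.
Lemma nrmD x y : nrm (x + y) <= nrm x + nrm y.
Proof. by rewrite -toC_le toCD -!normE ler_normD. Qed.
Lemma nrmBC x y : nrm (x - y) = nrm (y - x).
Proof. by rewrite /nrm distrC. Qed.
Lemma nrmB x y : nrm (x - y) <= nrm x + nrm y.
Proof. by rewrite -(nrmN y) nrmD. Qed.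
Lemma nrm_triB x y z : nrm (x - z) <= nrm (x - y) + nrm (y - z).
Proof. by rewrite (_ : x - z = (x - y) + (y - z)) ?nrmD//; ring. Qed.
Lemma nrm_le_dist x y : nrm x <= nrm y + nrm (x - y).
Proof. by rewrite -{1}(subrK y x) addrC; rewrite nrmD. Qed.
Lemma nrmV x : nrm x^-1 = (nrm x)^-1.
Proof. by apply: toC_inj; rewrite toCV -!normE normfV. Qed.
Lemma nrmX x n : nrm (x ^+ n) = nrm x ^+ n.
Proof. by apply: toC_inj; rewrite toCX -!normE normrX. Qed.
Lemma nrm_toC (a : R) : nrm (toC a) = `|a|.
Proof.
apply: toC_inj; rewrite -normE; case: (leP 0 a) => a0.
  by rewrite (ger0_norm a0) ger0_norm// -toC0 toC_le.
by rewrite (ltr0_norm a0) toCN ltr0_norm// -toC0 toC_lt.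
Qed.
Lemma nrm_nat n : nrm n%:R = n%:R.
Proof. by rewrite -toC_nat nrm_toC ger0_norm. Qed.
Lemma nrm_sum (I : Type) (r : seq I) (P : pred I) (F : I -> C) :
  nrm (\sum_(i <- r | P i) F i) <= \sum_(i <- r | P i) nrm (F i).
Proof.
elim/big_ind2: _ => [|a b c d h1 h2|//]; first by rewrite nrm0.
by rewrite (le_trans (nrmD _ _))// lerD.
Qed.
Lemma norm_le (z : C) (a : R) : (`|z| <= toC a) = (nrm z <= a).
Proof. by rewrite normE toC_le. Qed.
Lemma norm_lt (z : C) (a : R) : (`|z| < toC a) = (nrm z < a).
Proof. by rewrite normE toC_lt. Qed.
Lemma norm_le1 z : (`|z| <= 1) = (nrm z <= 1).
Proof. by rewrite -toC1 norm_le. Qed.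
Lemma norm_lt1 z : (`|z| < 1) = (nrm z < 1).
Proof. by rewrite -toC1 norm_lt. Qed.

Lemma nrm_Re (z : C) : `|complex.Re z| <= nrm z.
Proof. by rewrite -toC_le -normE; exact: normc_ge_Re. Qed.

Lemma nrm_Im (z : C) : `|complex.Im z| <= nrm z.
Proof.
have := nrm_Re (- (z * ('i)%C)); rewrite nrmN nrmM.
have -> : complex.Re (- (z * ('i)%C)) = complex.Im z :> R.
  by case: z => a b /=; ring.
have -> : nrm ('i)%C = 1.
  apply/eqP; rewrite -(@eqrXn2 _ 2) ?nrm_ge0// expr1n -nrmX.
  by rewrite [X in nrm X]sqr_i nrmN nrm1.
by rewrite mulr1.
Qed.

Lemma nrm_ReIm (z : C) : nrm z <= `|complex.Re z| + `|complex.Im z|.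
Proof.
have E : z = toC (complex.Re z) + ('i)%C * toC (complex.Im z) by exact: complexE.
rewrite {1}E; apply: le_trans (nrmD _ _) _; rewrite nrmM !nrm_toC.
have -> : nrm ('i)%C = 1.
  apply/eqP; rewrite -(@eqrXn2 _ 2) ?nrm_ge0// expr1n -nrmX.
  by rewrite [X in nrm X]sqr_i nrmN nrm1.
by rewrite mul1r.
Qed.

Lemma cvgCP {T} {F : set_system T} {FF : Filter F} (f : T -> C) (l : C) :
  f @ F --> l <-> forall e : R, 0 < e -> \forall t \near F, nrm (f t - l) < e.
Proof.
split=> [/cvgrPdist_lt h e e0|h].
  have := h (toC e); rewrite -toC0 toC_lt => /(_ e0).
  by apply: filterS => t; rewrite norm_lt nrmBC.
apply/cvgrPdist_lt => e e0.
have eE : e = toC (complex.Re e).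
  by have [k ->] := complex_realP _ (gtr0_real e0).
have := h (complex.Re e).
rewrite -toC_lt -eE => /(_ e0); apply: filterS => t.
by rewrite eE norm_lt nrmBC.
Qed.

(** Stated on the filter itself, because limits at one point along several
    filters (the closed disk, its regular points, punctured neighbourhoods) are
    compared below. *)
Definition clim {T} (F : set_system T) (f : T -> C) (l : C) : Prop :=
  forall e : R, 0 < e -> F (fun t => nrm (f t - l) < e).

Lemma climP {T} (F : set_system T) {FF : Filter F} (f : T -> C) (l : C) :
  (f @ F --> l) <-> clim F f l.
Proof. exact: cvgCP. Qed.

Section ClimTheory.
Variables (T : Type) (F : set_system T) (FF : Filter F).
Implicit Types (f g : T -> C) (a b : C).

Lemma clim_cst a : clim F (fun=> a) a.
Proof. by apply/climP; exact: cvg_cst. Qed.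

Lemma climD f g a b : clim F f a -> clim F g b ->
  clim F (fun t => f t + g t) (a + b).
Proof. by move=> /climP hf /climP hg; exact/climP/(cvgD hf hg). Qed.

Lemma climN f a : clim F f a -> clim F (fun t => - f t) (- a).
Proof. by move=> /climP hf; exact/climP/(cvgN hf). Qed.

Lemma climB f g a b : clim F f a -> clim F g b ->
  clim F (fun t => f t - g t) (a - b).
Proof. by move=> hf hg; apply: climD => //; exact: climN. Qed.

Lemma climM f g a b : clim F f a -> clim F g b ->
  clim F (fun t => f t * g t) (a * b).
Proof. by move=> /climP hf /climP hg; exact/climP/(cvgM hf hg). Qed.

Lemma climV f a : a != 0 -> clim F f a -> clim F (fun t => (f t)^-1) a^-1.
Proof. by move=> a0 /climP hf; exact/climP/(cvgV a0 hf). Qed.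

Lemma climX f a n : clim F f a -> clim F (fun t => f t ^+ n) (a ^+ n).
Proof.
move=> hf; elim: n => [|n IH]; first exact: clim_cst.
rewrite exprS (_ : (fun t => _) = fun t => f t * f t ^+ n); first exact: climM.
by apply/funext => t; rewrite exprS.
Qed.

Lemma clim_sum (I : Type) (r : seq I) (P : pred I) (f : I -> T -> C) (a : I -> C) :
  (forall i, P i -> clim F (f i) (a i)) ->
  clim F (fun t => \sum_(i <- r | P i) f i t) (\sum_(i <- r | P i) a i).
Proof.
move=> h; elim: r => [|i r IH].
  rewrite big_nil (_ : (fun t => _) = fun=> 0); first exact: clim_cst.
  by apply/funext => t; rewrite big_nil.
rewrite big_cons (_ : (fun t => _) = fun t => if P i then
    f i t + \sum_(i <- r | P i) f i t else \sum_(i <- r | P i) f i t); last first.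
  by apply/funext => t; rewrite big_cons.
by case: ifPn => [/h hi|_]; [exact: climD|exact: IH].
Qed.

Lemma clim_prod (I : Type) (r : seq I) (P : pred I) (f : I -> T -> C) (a : I -> C) :
  (forall i, P i -> clim F (f i) (a i)) ->
  clim F (fun t => \prod_(i <- r | P i) f i t) (\prod_(i <- r | P i) a i).
Proof.
move=> h; elim: r => [|i r IH].
  rewrite big_nil (_ : (fun t => _) = fun=> 1); first exact: clim_cst.
  by apply/funext => t; rewrite big_nil.
rewrite big_cons (_ : (fun t => _) = fun t => if P i then
    f i t * \prod_(i <- r | P i) f i t else \prod_(i <- r | P i) f i t); last first.
  by apply/funext => t; rewrite big_cons.
by case: ifPn => [/h hi|_]; [exact: climM|exact: IH].
Qed.

Lemma clim_near f g a : F (fun t => f t = g t) -> clim F f a -> clim F g a.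
Proof.
move=> fg h e e0; have h1 := h e e0.
by apply: filterS2 fg h1 => t <-.
Qed.

End ClimTheory.

Lemma clim_unique {T} (F : set_system T) {FF : ProperFilter F} (f : T -> C) a b :
  clim F f a -> clim F f b -> a = b.
Proof.
move=> fa fb; apply/eqP; rewrite -subr_eq0 -nrm_eq0 eq_le nrm_ge0 andbT leNgt.
apply/negP => ab; have e0 : 0 < nrm (a - b) / 2 by rewrite divr_gt0.
have [t [ta tb]] := filter_meet FF (fa _ e0) (fb _ e0).
move: ta tb => /= ta tb; have := nrm_triB a (f t) b; rewrite (nrmBC a (f t)); lra.
Qed.

Lemma nbhsCP (w : C) (A : set C) :
  nbhs w A <-> exists2 d : R, 0 < d & forall z, nrm (z - w) < d -> A z.
Proof.
split.
  move/nbhs_ballP => [e /= e0 he].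
  have eE : e = toC (complex.Re e).
    by have [k ->] := complex_realP _ (gtr0_real e0).
  exists (complex.Re e); first by rewrite -toC_lt -eE.
  move=> z hz; apply: he; rewrite -ball_normE /ball_ /= eE norm_lt.
  by rewrite nrmBC.
move=> [d d0 hd]; apply/nbhs_ballP; exists (toC d) => /=.
  by rewrite -toC0 toC_lt.
move=> z; rewrite -ball_normE /ball_ /= norm_lt nrmBC; exact: hd.
Qed.

Let real_cauchy (v eps : nat -> R) :
  (forall m n, (m <= n)%N -> `|v n - v m| <= eps m) ->
  exists l : R, forall m, `|l - v m| <= eps m.
Proof.
move=> hv; have eps_ge0 m : 0 <= eps m by apply: le_trans (hv m m (leqnn m)).
have cross m n : v m - eps m <= v n + eps n.
  have [mn|/ltnW nm] := leqP m n.
    by have := hv _ _ mn; have := eps_ge0 n; rewrite ler_distl; lra.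
  by have := hv _ _ nm; have := eps_ge0 m; rewrite ler_distl; lra.
pose E := range (fun m => v m - eps m).
have bE n : ubound E (v n + eps n) by move=> _ [m _ <-].
exists (sup E) => m; rewrite ler_distl; apply/andP; split.
  apply: ub_le_sup; first by exists (v 0%N + eps 0%N).
  by exists m.
by apply: ge_sup => //; exists (v m - eps m); exists m.
Qed.

(** Completeness of the complex plane in quantitative form: the limit is
    approached at the rate of the Cauchy condition. *)
Lemma complex_cauchy (u : nat -> C) (eps : nat -> R) :
  (forall e : R, 0 < e -> exists n, forall m, (n <= m)%N -> eps m < e) ->
  (forall m n, (m <= n)%N -> nrm (u n - u m) <= eps m) ->
  exists l : C, forall m, nrm (l - u m) <= eps m.
Proof.
move=> eps0 hu.
have [|a ha] := @real_cauchy (fun n => complex.Re (u n)) eps.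
  move=> m n mn; apply: le_trans (hu m n mn); apply: le_trans (nrm_Re _).
  by case: (u n) => ? ?; case: (u m).
have [|b hb] := @real_cauchy (fun n => complex.Im (u n)) eps.
  move=> m n mn; apply: le_trans (hu m n mn); apply: le_trans (nrm_Im _).
  by case: (u n) => ? ?; case: (u m).
pose l : C := Complex a b.
have hl m : nrm (l - u m) <= 2 * eps m.
  apply: le_trans (nrm_ReIm _) _; have := ha m; have := hb m.
  by case: (u m) => x y /=; lra.
exists l => m; rewrite leNgt; apply/negP => lt_m.
have e0 : 0 < (nrm (l - u m) - eps m) / 2 by rewrite divr_gt0 ?subr_gt0.
have [n0 hn] := eps0 _ e0; pose n := maxn n0 m.
have := hn n (leq_maxl _ _); have := hl n; have := hu m n (leq_maxr _ _).
have := nrm_triB l (u n) (u m); lra.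
Qed.
End RealNorm.

(** * Uniform limits of polynomials *)

Section PolynomialLimits.
Variable R : realType.
Local Notation C := (Cplx R).
Implicit Types (f g : C -> C) (p : {poly C}) (r : R).

Let primitive_root n : (0 < n)%N -> exists z : C, n.-primitive_root z.
Proof.
move=> n_gt0; pose q : {poly C} := 'X^n - 1.
have [rs Dq] := closed_field_poly_normal q.
rewrite (monicP _) ?monicXnsubC // scale1r in Dq.
have rs1 : all n.-unity_root rs.
  by apply/allP=> z; rewrite -root_prod_XsubC -Dq.
have sz_rs : (n < (size rs).+1)%N.
  by rewrite -(size_prod_XsubC rs id) -Dq size_XnsubC.
have [|z _ zP] := hasP (cyclic.has_prim_root n_gt0 rs1 _ sz_rs).
  rewrite -separable.separable_prod_XsubC -Dq.
  by apply: cyclotomic.separable_Xn_sub_1; rewrite pnatr_eq0 -lt0n.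
by exists z.
Qed.

(** Cauchy's estimate.  For a polynomial the contour integral is an average
    over sufficiently many roots of unity, so the bound is pure algebra. *)
Lemma cauchy_estimate p r (M : R) k : 0 <= r ->
  (forall t, nrm t = r -> nrm p.[t] <= M) -> nrm p`_k * r ^+ k <= M.
Proof.
(* With [n] exceeding both the degree and [k], the average of
   [p.[r z ^+ j] z ^- (j k)] over the [n]-th roots of unity [z ^+ j] retains
   the coefficient of index [k] alone. *)
move=> r0 hM; pose n := (maxn (size p) k).+1.
have n0 : (0 < n)%N by [].
have [z zP] := primitive_root n0.
have kn : (k < n)%N by rewrite ltnS leq_maxr.
have nz : nrm z = 1.
  apply/eqP; rewrite -(@pexpr_eq1 _ (nrm z) n) ?nrm_ge0//.
  by rewrite -nrmX (prim_expr_order zP) nrm1.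
have avg : n%:R * (p`_k * toC r ^+ k)
    = \sum_(j < n) p.[toC r * z ^+ j] * z ^+ (j * (n - k)).
  transitivity (\sum_(j < n) \sum_(i < n)
      p`_i * toC r ^+ i * z ^+ (i + (n - k)) ^+ j).
    rewrite exchange_big /= (bigD1 (Ordinal kn)) //= [X in _ + X]big1 ?addr0.
      rewrite -mulr_sumr subnKC; last exact: ltnW.
      under eq_bigr do rewrite (prim_expr_order zP) expr1n.
      by rewrite sumr_const card_ord mulrC.
    move=> i ik; rewrite -mulr_sumr; set y := z ^+ _.
    have y1 : y - 1 != 0.
      rewrite subr_eq0 -(prim_order_dvd zP); apply: contra ik.
      rewrite -val_eqE /=; have := ltn_ord i.
      move=> ? /dvdnP[q]; case: q => [|[|q]]; nia.
    suff -> : \sum_(j < n) y ^+ j = 0 by rewrite mulr0.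
    apply: (mulfI y1); rewrite -subrX1 mulr0 -exprM mulnC exprM.
    by rewrite (prim_expr_order zP) expr1n subrr.
  apply: eq_bigr => j _; rewrite (@horner_coef_wide _ n) ?leqW ?leq_maxl//.
  rewrite mulr_suml; apply: eq_bigr => i _.
  by rewrite exprMn -!exprM -!mulrA -exprD; congr (_ * (_ * z ^+ _)); nia.
have n0R : 0 < n%:R :> R by rewrite ltr0n.
rewrite -(ler_pM2l n0R).
have -> : n%:R * (nrm p`_k * r ^+ k) = nrm (n%:R * (p`_k * toC r ^+ k)).
  by rewrite !nrmM nrm_nat nrmX nrm_toC ger0_norm.
rewrite avg; apply: le_trans (nrm_sum _ _ _) _.
rewrite mulr_natl -[X in _ *+ X]card_ord -sumr_const; apply: ler_sum => j _.
rewrite nrmM !nrmX nz expr1n mulr1; apply: hM.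
by rewrite nrmM nrmX nz expr1n mulr1 nrm_toC ger0_norm.
Qed.

Lemma horner_bound p r : 0 <= r ->
  exists2 M : R, 0 <= M & forall t, nrm t <= r -> nrm p.[t] <= M.
Proof.
move=> r0; exists (\sum_(i < size p) nrm p`_i * r ^+ i).
  by apply: sumr_ge0 => i _; rewrite mulr_ge0 ?nrm_ge0 ?exprn_ge0.
move=> t tr; rewrite horner_coef; apply: le_trans (nrm_sum _ _ _) _.
by apply: ler_sum => i _; rewrite nrmM nrmX ler_wpM2l ?nrm_ge0// lerXn2r// nnegrE ?nrm_ge0.
Qed.

(** These are the functions continuous on the closed disk of radius [r] and
    holomorphic inside.  Holomorphic functions are handled in this form because
    stability under ring operations, uniform limits and composition is
    immediate. *)
Definition poly_limit r f : Prop := forall eps : R, 0 < eps ->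
  exists p, forall t, nrm t <= r -> nrm (f t - p.[t]) <= eps.

Lemma pl_horner r p : poly_limit r (horner p).
Proof. by move=> e e0; exists p => t _; rewrite subrr nrm0 ltW. Qed.

Lemma pl_ulim r f :
  (forall eps : R, 0 < eps -> exists2 g, poly_limit r g &
     forall t, nrm t <= r -> nrm (f t - g t) <= eps) -> poly_limit r f.
Proof.
move=> h e e0; have e2 : 0 < e / 2 by rewrite divr_gt0.
have [g gP hg] := h _ e2; have [p hp] := gP _ e2; exists p => t tr.
have := hg t tr; have := hp t tr; have := nrm_triB (f t) (g t) p.[t]; lra.
Qed.

Lemma pl_ext r f g : (forall t, nrm t <= r -> f t = g t) ->
  poly_limit r f -> poly_limit r g.
Proof.
by move=> fg h e e0; have [p hp] := h e e0; exists p => t tr; rewrite -fg ?hp.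
Qed.

Lemma pl_le r r' f : r' <= r -> poly_limit r f -> poly_limit r' f.
Proof.
move=> rr h e e0; have [p hp] := h e e0; exists p => t tr.
by apply: hp; apply: le_trans rr.
Qed.

Lemma pl_cst r c : poly_limit r (fun=> c).
Proof. by apply: pl_ext (@pl_horner r c%:P) => t _; rewrite hornerC. Qed.

Lemma pl_id r : poly_limit r id.
Proof. by apply: pl_ext (@pl_horner r 'X) => t _; rewrite hornerX. Qed.

Lemma plD r f g : poly_limit r f -> poly_limit r g ->
  poly_limit r (fun t => f t + g t).
Proof.
move=> hf hg e e0; have e2 : 0 < e / 2 by rewrite divr_gt0.
have [p hp] := hf _ e2; have [q hq] := hg _ e2; exists (p + q) => t tr.
rewrite hornerD (_ : f t + g t - (p.[t] + q.[t]) = (f t - p.[t]) + (g t - q.[t])); last ring.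
have := hp t tr; have := hq t tr; have := nrmD (f t - p.[t]) (g t - q.[t]); lra.
Qed.

Lemma pl_bounded r f : 0 <= r -> poly_limit r f ->
  exists2 M : R, 0 < M & forall t, nrm t <= r -> nrm (f t) <= M.
Proof.
move=> r0 /(_ 1 ltr01)[p hp]; have [M M0 hM] := horner_bound p r0.
exists (M + 1); first lra.
move=> t tr; have := hp t tr; have := hM t tr; have := nrm_le_dist (f t) p.[t]; lra.
Qed.

Lemma plM r f g : 0 <= r -> poly_limit r f -> poly_limit r g ->
  poly_limit r (fun t => f t * g t).
Proof.
move=> r0 hf hg; have [M M0 hM] := pl_bounded r0 hf.
have [N N0 hN] := pl_bounded r0 hg.
move=> e e0; pose d := Order.min 1 (e / (M + N + 1)).
have MN : 0 < M + N + 1 by lra.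
have d0 : 0 < d by rewrite lt_min ltr01 divr_gt0.
have d1 : d <= 1 by rewrite ge_min lexx.
have de : d * (M + N + 1) <= e.
  by rewrite -ler_pdivlMr// ge_min lexx orbT.
have [p hp] := hf _ d0; have [q hq] := hg _ d0; exists (p * q) => t tr.
rewrite hornerM.
have -> : f t * g t - p.[t] * q.[t]
    = (f t - p.[t]) * g t + f t * (g t - q.[t]) - (f t - p.[t]) * (g t - q.[t]).
  by ring.
have := hp t tr; have := hq t tr; have := hM t tr; have := hN t tr.
set a := f t - _; set b := g t - _ => h1 h2 h3 h4.
have := nrmB (a * g t + f t * b) (a * b); have := nrmD (a * g t) (f t * b).
rewrite !nrmM; have := nrm_ge0 a; have := nrm_ge0 b.
have := nrm_ge0 (f t); have := nrm_ge0 (g t).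
move=> f0 g0 b0 a0 hab hfin.
have t1 : nrm a * nrm (g t) <= d * N by apply: ler_pM.
have t2 : nrm (f t) * nrm b <= M * d by apply: ler_pM.
have t3 : nrm a * nrm b <= d * 1 by apply: ler_pM => //; apply: le_trans d1.
lra.
Qed.

Lemma plN r f : 0 <= r -> poly_limit r f -> poly_limit r (fun t => - f t).
Proof.
move=> r0 hf; apply: pl_ext (plM r0 (pl_cst r (-1)) hf) => t _.
by rewrite mulN1r.
Qed.

Lemma plB r f g : 0 <= r -> poly_limit r f -> poly_limit r g ->
  poly_limit r (fun t => f t - g t).
Proof. by move=> r0 hf hg; apply: plD hf (plN r0 hg). Qed.

Lemma pl_comp r s f g : 0 <= r -> poly_limit s f -> poly_limit r g ->
  (forall t, nrm t <= r -> nrm (g t) <= s) -> poly_limit r (f \o g).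
Proof.
move=> r0 hf hg gs; apply: pl_ulim => e e0; have [p hp] := hf e e0.
exists (fun t => p.[g t]); last by move=> t tr; apply: hp; exact: gs.
elim/poly_ind: p {hp} => [|p c IH].
  by apply: pl_ext (pl_cst r 0) => t _; rewrite horner0.
apply: pl_ext (plD (plM r0 IH hg) (pl_cst r c)) => t _.
by rewrite hornerMXaddC.
Qed.

Lemma horner_continuousC p (t : C) (e : R) : 0 < e ->
  exists2 d : R, 0 < d & forall u, nrm (u - t) < d -> nrm (p.[u] - p.[t]) < e.
Proof.
move=> e0; suff /(_ e e0)/nbhsCP : clim (nbhs t) (horner p) p.[t] by [].
have idc : clim (nbhs t) id t by apply/climP; exact: cvg_id.
elim/poly_ind: p => [|p c IH].
  rewrite horner0 (_ : horner 0 = fun=> 0); first exact: clim_cst.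
  by apply/funext => u; rewrite horner0.
rewrite hornerMXaddC (_ : horner _ = fun u => p.[u] * u + c).
  by apply: climD; [exact: climM|exact: clim_cst].
by apply/funext => u; rewrite hornerMXaddC.
Qed.

Lemma pl_continuous r f t : nrm t < r -> poly_limit r f -> clim (nbhs t) f (f t).
Proof.
move=> tr hf e e0; have e4 : 0 < e / 4 by rewrite divr_gt0.
have [p hp] := hf _ e4; have [d d0 hd] := horner_continuousC p t e4.
apply/nbhsCP; exists (Order.min d (r - nrm t)).
  by rewrite lt_min d0 subr_gt0.
move=> u; rewrite lt_min => /andP[ud ur].
have ur' : nrm u <= r by have := nrm_le_dist u t; lra.
have := hp u ur'; have := hp t (ltW tr); have := hd u ud.
have := nrm_triB (f u) p.[u] (f t); have := nrm_triB p.[u] p.[t] (f t).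
rewrite (nrmBC p.[t] (f t)); lra.
Qed.

Let geometric_le2 (q : R) n : 0 <= q <= 2^-1 -> \sum_(i < n) q ^+ i <= 2.
Proof.
move=> /andP[q0 q2]; have := subrX1 q n; have := exprn_ge0 n q0.
have : 0 <= \sum_(i < n) q ^+ i by apply: sumr_ge0 => i _; exact: exprn_ge0.
nra.
Qed.

Let horner_tail p r (B : R) n t : 0 < r ->
  (forall t, nrm t <= r -> nrm p.[t] <= B) -> nrm t <= r / 2 ->
  nrm (p.[t] - \sum_(k < n) p`_k * t ^+ k) <= 2 * B * (nrm t / r) ^+ n.
Proof.
move=> r0 hB tr; have B0 : 0 <= B.
  by apply: le_trans (hB 0 _); rewrite ?nrm_ge0// nrm0 ltW.
have q0 : 0 <= nrm t / r by rewrite divr_ge0 ?nrm_ge0// ltW.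
have q2 : nrm t / r <= 2^-1 by rewrite ler_pdivrMr// mulrC.
rewrite (@horner_coef_wide _ (n + size p)) ?leq_addl// big_split_ord /=.
rewrite addrAC subrr add0r; apply: le_trans (nrm_sum _ _ _) _.
apply: (@le_trans _ _ (\sum_(i < size p) B * (nrm t / r) ^+ n * (nrm t / r) ^+ i)).
  apply: ler_sum => i _; rewrite nrmM nrmX -mulrA -exprD expr_div_n mulrA.
  rewrite ler_pdivlMr ?exprn_gt0// mulrAC ler_wpM2r ?exprn_ge0 ?nrm_ge0//.
  by apply: cauchy_estimate => [|u hu]; [exact: ltW|apply: hB; rewrite hu].
rewrite -mulr_sumr mulrC mulrA ler_wpM2r ?exprn_ge0//.
by rewrite ler_wpM2r// geometric_le2 ?q0.
Qed.

Let null_sequence : exists d : nat -> R, [/\ forall n, 0 < d n,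
  forall m n, (m <= n)%N -> d n <= d m,
  forall e, 0 < e -> exists n, d n < e & forall n, d n <= 1].
Proof.
exists (fun n => n.+1%:R^-1); split=> [n|m n mn|e e0|n].
- by rewrite invr_gt0 ltr0n.
- by rewrite lef_pV2 ?posrE ?ltr0n// ler_nat ltnS.
- by have [n] := ltr_add_invr e0; rewrite add0r; exists n.
- by rewrite invf_le1 ?ltr0n// ler1n.
Qed.

(** A uniform limit of polynomials has a Taylor expansion at the centre: by
    Cauchy's estimate the coefficients of the approximating polynomials
    converge, and the tails are uniformly geometric. *)
Lemma pl_taylor r f : 0 < r -> poly_limit r f ->
  exists (a : nat -> C) (M : R), 0 <= M /\ forall n t, nrm t <= r / 2 ->
    nrm (f t - \sum_(k < n) a k * t ^+ k) <= M * (nrm t / r) ^+ n.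
Proof.
move=> r0 hf; have r0' := ltW r0.
have [inv [inv0 inv_le inv_lt inv1]] := null_sequence.
have [p hp] : exists p : nat -> {poly C}, forall n t, nrm t <= r ->
    nrm (f t - (p n).[t]) <= inv n.
  suff /choice : forall n, exists p : {poly C}, forall t, nrm t <= r ->
    nrm (f t - p.[t]) <= inv n.
    by case=> p hp; exists p => n; exact: hp.
  by move=> n; exact: hf.
have pmn m n t : (m <= n)%N -> nrm t <= r ->
    nrm ((p n - p m).[t]) <= 2 * inv m.
  move=> mn tr.
  have -> : (p n - p m).[t] = (p n).[t] - (p m).[t] by rewrite hornerD hornerN.
  have := hp n t tr; have := hp m t tr; have := inv_le _ _ mn.
  have := nrm_triB (p n).[t] (f t) (p m).[t]; rewrite (nrmBC (p n).[t] (f t)).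
  lra.
have [a ha] : exists a : nat -> C, forall k m,
    nrm (a k - (p m)`_k) <= 2 * inv m / r ^+ k.
  suff /choice : forall k, exists l : C, forall m,
    nrm (l - (p m)`_k) <= 2 * inv m / r ^+ k.
    by case=> a ha; exists a => k; exact: ha.
  move=> k; apply: complex_cauchy => [e e0|m n mn].
    have e1 : 0 < e * r ^+ k / 2 by rewrite !mulr_gt0 ?exprn_gt0 ?invr_gt0.
    have [n hn] := inv_lt _ e1.
    exists n => m nm; rewrite ltr_pdivrMr ?exprn_gt0//.
    have := inv_le _ _ nm; lra.
  rewrite ler_pdivlMr ?exprn_gt0// -coefB.
  by apply: cauchy_estimate => // t tr; apply: pmn; rewrite ?tr.
have [B B0 hB] := pl_bounded r0' hf.
exists a, (2 * (B + 1)); split=> [|n t tr]; first lra.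
have q0 : 0 <= nrm t / r by rewrite divr_ge0 ?nrm_ge0.
have q2 : nrm t / r <= 2^-1 by rewrite ler_pdivrMr// mulrC.
have tr' : nrm t <= r by have := nrm_ge0 t; lra.
have step m : nrm (f t - \sum_(k < n) a k * t ^+ k)
    <= 2 * (B + 1) * (nrm t / r) ^+ n + 5 * inv m.
  have bp u : nrm u <= r -> nrm (p m).[u] <= B + 1.
    move=> ur; have := hp m u ur; have := hB u ur.
    have := nrm_le_dist (p m).[u] (f u); rewrite (nrmBC (p m).[u]).
    have := inv1 m; lra.
  have h2 := horner_tail n r0 bp tr.
  have h3 : nrm (\sum_(k < n) (p m)`_k * t ^+ k - \sum_(k < n) a k * t ^+ k)
      <= 4 * inv m.
    rewrite -sumrB; apply: le_trans (nrm_sum _ _ _) _.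
    apply: (@le_trans _ _ (\sum_(i < n) 2 * inv m * (nrm t / r) ^+ i)).
      apply: ler_sum => i _; rewrite -mulrBl nrmM nrmX nrmBC expr_div_n mulrCA.
      by rewrite mulrC ler_wpM2l ?exprn_ge0 ?nrm_ge0.
    rewrite -mulr_sumr; have := geometric_le2 n; move=> /(_ (nrm t / r)).
    by rewrite q0 q2 => /(_ isT); have := inv0 m; nra.
  have := hp m t tr'.
  set x := \sum_(k < n) a k * _ in h3 *; set y := \sum_(k < n) _ in h2 h3.
  have := nrm_triB (f t) (p m).[t] x; have := nrm_triB (p m).[t] y x; lra.
rewrite leNgt; apply/negP => lt; set A := 2 * _ * _ in lt step.
have x0 : 0 < (nrm (f t - \sum_(k < n) a k * t ^+ k) - A) / 5.
  by rewrite divr_gt0 ?subr_gt0.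
by have [m hm] := inv_lt _ x0; have := step m; lra.
Qed.

(** The identity principle with a rate: either all Taylor coefficients vanish,
    or the first nonzero one dominates the others near the centre. *)
Lemma pl_leading_term r f : 0 < r -> poly_limit r f ->
  (forall t, nrm t <= r / 2 -> f t = 0) \/
  exists K (a : C) (M : R), a != 0 /\ forall t, nrm t <= r / 2 ->
    nrm (f t - a * t ^+ K) <= M * nrm t ^+ K.+1.
Proof.
move=> r0 hf; have [a [M [M0 ha]]] := pl_taylor r0 hf.
have [a0|/existsNP ex] := pselect (forall k, a k = 0).
  left=> t tr; apply/eqP; rewrite -nrm_eq0 eq_le nrm_ge0 andbT leNgt.
  apply/negP => ft0; have q0 : 0 <= nrm t / r by rewrite divr_ge0 ?nrm_ge0// ltW.
  have q2 : nrm t / r <= 2^-1 by rewrite ler_pdivrMr// mulrC.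
  have h n : nrm (f t) <= M * 2^-1 ^+ n.
    have := ha n t tr; rewrite big1 ?subr0; last by move=> i _; rewrite a0 mul0r.
    move=> /le_trans; apply; rewrite ler_wpM2l// lerXn2r// nnegrE//.
  have M1 : 0 < nrm (f t) / (M + 1) by rewrite divr_gt0//; lra.
  have [k] := ltr_add_invr M1; rewrite add0r => hk.
  have := h k; have : 2^-1 ^+ k <= k.+1%:R^-1 :> R.
    rewrite exprVn lef_pV2 ?posrE ?exprn_gt0 ?ltr0n// -natrX ler_nat.
    exact: ltn_expl.
  move: hk; rewrite ltr_pdivlMr; last lra.
  have : 0 < k.+1%:R^-1 :> R by rewrite invr_gt0 ltr0n.
  move: (k.+1%:R^-1) (2^-1 ^+ k) => u v u0 huM vu hvM.
  have := ler_wpM2l M0 vu; lra.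
right; have {}ex : exists k, a k != 0 by case: ex => k /eqP; exists k.
pose K := ex_minn ex; exists K, (a K), (M / r ^+ K.+1).
have [aK mK] : a K != 0 /\ forall k, (k < K)%N -> a k = 0.
  rewrite /K; case: ex_minnP => k ak hk; split=> // j jk.
  by apply/eqP; apply: contraTT jk => /hk; rewrite -leqNgt.
split=> // t tr; have := ha K.+1 t tr; rewrite big_ord_recr /= big1 ?add0r.
  by rewrite expr_div_n mulrCA [_ * (M / _)]mulrC.
by move=> i _; rewrite mK ?mul0r.
Qed.

End PolynomialLimits.

(** * Germs of holomorphic functions *)

Section AnalyticGerms.
Variable R : realType.
Local Notation C := (Cplx R).
Implicit Types (f g : C -> C) (r : R).

Lemma pl_cauchy r (g : nat -> C -> C) (eps : nat -> R) :
  (forall e : R, 0 < e -> exists n, forall m, (n <= m)%N -> eps m < e) ->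
  (forall n, poly_limit r (g n)) ->
  (forall m n t, (m <= n)%N -> nrm t <= r -> nrm (g n t - g m t) <= eps m) ->
  exists2 f, poly_limit r f &
    forall m t, nrm t <= r -> nrm (f t - g m t) <= eps m.
Proof.
move=> eps0 gP hg.
have [f hf] : exists f, forall t, nrm t <= r ->
    forall m, nrm (f t - g m t) <= eps m.
  suff /choice[f hf] : forall t, exists l : C, nrm t <= r ->
    forall m, nrm (l - g m t) <= eps m by exists f.
  move=> t; have [tr|tr] := leP (nrm t) r; last by exists 0.
  have [//|m n mn|l hl] := @complex_cauchy R (fun n => g n t) eps.
    exact: hg.
  by exists l.
exists f => [|m t tr]; last exact: hf.
apply: pl_ulim => e e0; have [n hn] := eps0 e e0.
by exists (g n) => // t tr; apply: le_trans (hf t tr n) _; rewrite ltW ?hn.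
Qed.

(** Banach's fixed point theorem with an analytic parameter [t]: the Picard
    iterates started at zero are again limits of polynomials and converge
    uniformly.  It provides square roots and inverses near the value one. *)
Lemma pl_fixpoint r (rho : R) (Phi : C -> C -> C) : 0 < rho ->
  (forall f, poly_limit r f -> poly_limit r (fun t => Phi t (f t))) ->
  (forall t y, nrm t <= r -> nrm y <= rho -> nrm (Phi t y) <= rho) ->
  (forall t x y, nrm t <= r -> nrm x <= rho -> nrm y <= rho ->
    nrm (Phi t x - Phi t y) <= nrm (x - y) / 2) ->
  exists2 f, poly_limit r f & forall t, nrm t <= r -> f t = Phi t (f t).
Proof.
move=> rho0 hP hb hL; pose y n := iter n (fun f t => Phi t (f t)) (fun=> 0).
have yP n : poly_limit r (y n).
  by elim: n => [|n IH]; [exact: pl_cst|exact: hP].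
have yb n t : nrm t <= r -> nrm (y n t) <= rho.
  by move=> tr; elim: n => [|n IH]; [rewrite nrm0 ltW|exact: hb].
have ystep n t : nrm t <= r -> nrm (y n.+1 t - y n t) <= rho / 2 ^+ n.
  move=> tr; elim: n => [|n IH].
    by rewrite /= subr0 expr0 divr1; apply: hb => //; rewrite nrm0 ltW.
  apply: le_trans (hL t (y n.+1 t) (y n t) tr (yb _ _ tr) (yb _ _ tr)) _.
  by rewrite exprS invfM [2^-1 * _]mulrC mulrA ler_pM2r.
pose eps n := 2 * rho / 2 ^+ n.
have ycauchy m n t : (m <= n)%N -> nrm t <= r ->
    nrm (y n t - y m t) <= eps m - eps n.
  move=> mn tr; rewrite -(subnKC mn); elim: (n - m)%N => [|k IH].
    by rewrite addn0 !subrr nrm0.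
  rewrite addnS; have := ystep (m + k)%N t tr.
  have := nrm_triB (y (m + k).+1 t) (y (m + k)%N t) (y m t).
  have -> : eps (m + k).+1 = rho / 2 ^+ (m + k).
    by rewrite /eps exprS; field; rewrite expf_neq0.
  have -> : rho / 2 ^+ (m + k) = eps (m + k)%N / 2 by rewrite /eps; field; rewrite expf_neq0.
  lra.
have eps_ge0 n : 0 <= eps n by rewrite /eps divr_ge0 ?exprn_ge0// mulr_ge0// ltW.
have eps0 (e : R) : 0 < e -> exists n, forall m, (n <= m)%N -> eps m < e.
  move=> e0; have e1 : 0 < e / (2 * rho) by rewrite divr_gt0// mulr_gt0.
  have [n hn] := ltr_add_invr e1; rewrite add0r in hn; exists n => m nm.
  rewrite /eps mulrC -ltr_pdivlMr ?mulr_gt0//; apply: le_lt_trans hn.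
  rewrite lef_pV2 ?posrE ?exprn_gt0 ?ltr0n// -natrX ler_nat.
  by apply: leq_trans (ltn_expl m _); rewrite ?ltnS.
have [//|//|m n t mn tr|f fP hf] := @pl_cauchy r y eps.
  by apply: le_trans (ycauchy m n t mn tr) _; rewrite gerBl.
exists f => // t tr; have fb : nrm (f t) <= rho.
  rewrite leNgt; apply/negP => lt.
  have [|n /(_ n (leqnn n)) hn] := eps0 (nrm (f t) - rho); first by rewrite subr_gt0.
  have := hf n t tr; have := yb n t tr; have := nrm_le_dist (f t) (y n t); lra.
apply/eqP; rewrite -subr_eq0 -nrm_eq0 eq_le nrm_ge0 andbT leNgt; apply/negP => lt.
have [|n hn] := eps0 (nrm (f t - Phi t (f t)) / 2); first by rewrite divr_gt0.
have h1 := hf n t tr; have h2 := hf n.+1 t tr.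
have h3 := hL t (f t) (y n t) tr fb (yb n t tr).
have := hn n (leqnn n); have := hn n.+1 (leqnSn n).
have := nrm_triB (f t) (y n.+1 t) (Phi t (f t)).
rewrite (nrmBC (y n.+1 t)) -[y n.+1 t]/(Phi t (y n t)).
rewrite -[y n.+1 t]/(Phi t (y n t)) in h2; lra.
Qed.

Let sqrt1D : exists2 f, poly_limit 4^-1 f &
  forall t : C, nrm t <= 4^-1 -> f t ^+ 2 = 1 + t.
Proof.
(* [y = Phi t y] says that [(1 + y) ^+ 2 = 1 + t]. *)
pose Phi (t y : C) : C := (t - y ^+ 2) / 2.
have n2 : nrm (2 : C) = 2 by exact: nrm_nat.
have [||t y tr yr|t x y tr xr yr|f fP hf] := @pl_fixpoint 4^-1 2^-1 Phi.
- by rewrite invr_gt0.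
- move=> f fP; apply: plM; [by rewrite invr_ge0| |exact: pl_cst].
  apply: plB; [by rewrite invr_ge0|exact: pl_id|].
  by apply: plM; rewrite ?invr_ge0.
- rewrite /Phi nrmM nrmV n2; have := nrmB t (y ^+ 2); rewrite nrmX.
  have := nrm_ge0 y; nra.
- rewrite /Phi (_ : _ - _ = (y + x) * (y - x) / 2); last by field.
  rewrite !nrmM nrmV n2 (nrmBC y x); have := nrmD y x; have := nrm_ge0 (x - y); nra.
exists (fun t => 1 + f t) => [|t tr]; first exact: plD (pl_cst _ _) fP.
have := hf t tr; rewrite /Phi => {}hf; rewrite sqrrD expr1n mul1r.
suff e : f t *+ 2 + f t ^+ 2 = t by rewrite -addrA e.
by rewrite {1}hf mulr2n; field.
Qed.

Let inv1D : exists2 f, poly_limit 2^-1 f &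
  forall t : C, nrm t <= 2^-1 -> f t = (1 + t)^-1.
Proof.
(* [y = Phi t y] says that [(1 + t) * (1 + y) = 1]. *)
pose Phi (t y : C) : C := - t * (1 + y).
have [||t y tr yr|t x y tr xr yr|f fP hf] := @pl_fixpoint 2^-1 1 Phi.
- exact: ltr01.
- move=> f fP; apply: plM; [by rewrite invr_ge0| |exact: plD (pl_cst _ _) fP].
  by apply: plN; [rewrite invr_ge0|exact: pl_id].
- rewrite /Phi nrmM nrmN; have := nrmD 1 y; rewrite nrm1.
  have := nrm_ge0 t; nra.
- rewrite /Phi -mulrBr nrmM nrmN opprD addrACA subrr add0r.
  have := nrm_ge0 (x - y); nra.
exists (fun t => 1 + f t) => [|t tr]; first exact: plD (pl_cst _ _) fP.
have t1 : 1 + t != 0.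
  apply/eqP => /eqP; rewrite addr_eq0 => /eqP t1; move: tr.
  by rewrite -(nrmN t) -t1 nrm1; lra.
apply: (mulfI t1); rewrite mulfV//; move: (hf t tr); rewrite /Phi => {}hf.
have -> : (1 + t) * (1 + f t) = 1 + f t - (- t * (1 + f t)) by ring.
by rewrite -hf; ring.
Qed.

(** Germs at the origin of holomorphic functions. *)
Definition analytic f : Prop := exists2 r : R, 0 < r & poly_limit r f.

Lemma ana_le f r : analytic f -> 0 < r ->
  exists2 s : R, 0 < s <= r & poly_limit s f.
Proof.
move=> [s s0 fP] r0; exists (Order.min s r); last by apply: pl_le fP; rewrite ge_min lexx.
by rewrite lt_min s0 r0 ge_min lexx orbT.
Qed.

Lemma ana_ext f g r : 0 < r -> (forall t, nrm t <= r -> f t = g t) ->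
  analytic f -> analytic g.
Proof.
move=> r0 fg hf; have [s /andP[s0 sr] fP] := ana_le hf r0; exists s => //.
by apply: pl_ext fP => t ts; apply: fg; exact: le_trans sr.
Qed.

Lemma ana_pair f g : analytic f -> analytic g ->
  exists2 r : R, 0 < r & poly_limit r f /\ poly_limit r g.
Proof.
move=> hf [r r0 gP]; have [s /andP[s0 sr] fP] := ana_le hf r0.
by exists s => //; split=> //; exact: pl_le gP.
Qed.

Lemma ana_cst a : analytic (fun=> a).
Proof. by exists 1 => //; exact: pl_cst. Qed.

Lemma ana_id : analytic id.
Proof. by exists 1 => //; exact: pl_id. Qed.

Lemma anaD f g : analytic f -> analytic g -> analytic (fun t => f t + g t).
Proof.
by move=> hf hg; have [r r0 [fP gP]] := ana_pair hf hg; exists r => //; exact: plD.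
Qed.

Lemma anaM f g : analytic f -> analytic g -> analytic (fun t => f t * g t).
Proof.
move=> hf hg; have [r r0 [fP gP]] := ana_pair hf hg; exists r => //.
by apply: plM => //; exact: ltW.
Qed.

Lemma anaN f : analytic f -> analytic (fun t => - f t).
Proof. by move=> [r r0 fP]; exists r => //; apply: plN => //; exact: ltW. Qed.

Lemma anaB f g : analytic f -> analytic g -> analytic (fun t => f t - g t).
Proof. by move=> hf hg; apply: anaD => //; exact: anaN. Qed.

Lemma anaX f n : analytic f -> analytic (fun t => f t ^+ n).
Proof.
move=> hf; elim: n => [|n IH]; first exact: ana_cst.
by apply: ana_ext ltr01 _ (anaM hf IH) => t _; rewrite exprS.
Qed.

Lemma ana_horner (p : {poly C}) f : analytic f -> analytic (fun t => p.[f t]).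
Proof.
move=> hf; elim/poly_ind: p => [|p c IH].
  by apply: ana_ext ltr01 _ (ana_cst 0) => t _; rewrite horner0.
apply: ana_ext ltr01 _ (anaD (anaM IH hf) (ana_cst c)) => t _.
by rewrite hornerMXaddC.
Qed.

Lemma ana_continuous f : analytic f ->
  exists2 r : R, 0 < r & forall t, nrm t < r -> clim (nbhs t) f (f t).
Proof. by move=> [r r0 fP]; exists r => // t tr; exact: pl_continuous fP. Qed.

Lemma ana_close f (e : R) : analytic f -> 0 < e ->
  exists2 r : R, 0 < r & forall t, nrm t <= r -> nrm (f t - f 0) < e.
Proof.
move=> /ana_continuous[r r0 /(_ 0)]; rewrite nrm0 => /(_ r0) h e0.
have /nbhsCP[d d0 hd] := h e e0; exists (d / 2); first by rewrite divr_gt0.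
by move=> t td; apply: hd; rewrite subr0; lra.
Qed.

Lemma ana_comp f g (s : R) : poly_limit s f -> analytic g -> nrm (g 0) < s ->
  analytic (f \o g).
Proof.
move=> fP hg gs; have e0 : 0 < s - nrm (g 0) by rewrite subr_gt0.
have [r r0 hr] := ana_close hg e0.
have [r' /andP[r'0 rr] gP] := ana_le hg r0; exists r' => //.
apply: pl_comp fP gP _ => [|t tr]; first exact: ltW.
have := hr t (le_trans tr rr); have := nrm_le_dist (g t) (g 0); lra.
Qed.

Let ana_near1 f : analytic f -> f 0 != 0 ->
  exists g, [/\ analytic g, g 0 = 0 & forall t, f t = f 0 * (1 + g t)].
Proof.
move=> hf f0; exists (fun t => f t / f 0 - 1); split=> [||t].
- by apply: anaB (ana_cst _); apply: anaM (ana_cst _).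
- by rewrite mulfV// subrr.
- by rewrite addrC subrK mulrC divfK.
Qed.

Lemma ana_inv f : analytic f -> f 0 != 0 -> analytic (fun t => (f t)^-1).
Proof.
move=> hf f0; have [g [hg g0 fE]] := ana_near1 hf f0.
have [h hP hh] := inv1D; have h2 : 0 < 2^-1 :> R by rewrite invr_gt0.
have [r r0 hr] := ana_close hg h2; rewrite g0 in hr.
apply: ana_ext r0 _ (anaM (ana_cst (f 0)^-1) (ana_comp hP hg _)).
  by move=> t /hr; rewrite subr0 => /ltW gt /=; rewrite hh// -invfM -fE.
by rewrite g0 nrm0.
Qed.

Lemma ana_sqrt f : analytic f -> f 0 != 0 ->
  exists2 g, analytic g &
    exists2 r : R, 0 < r & forall t, nrm t <= r -> g t ^+ 2 = f t.
Proof.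
move=> hf f0; have [g [hg g0 fE]] := ana_near1 hf f0.
have [h hP hh] := sqrt1D; have h2 : 0 < 4^-1 :> R by rewrite invr_gt0.
have [r r0 hr] := ana_close hg h2; rewrite g0 in hr.
exists (fun t => sqrtC (f 0) * h (g t)).
  by apply: anaM (ana_cst _) (ana_comp hP hg _); rewrite g0 nrm0.
exists r => // t /hr; rewrite subr0 => /ltW gt.
by rewrite exprMn sqrtCK hh// -fE.
Qed.

Lemma ana_leading_term f : analytic f ->
  exists2 r : R, 0 < r & (forall t, nrm t <= r -> f t = 0) \/
    exists K (a : C) (M : R), a != 0 /\ forall t, nrm t <= r ->
      nrm (f t - a * t ^+ K) <= M * nrm t ^+ K.+1.
Proof.
move=> [r r0 fP]; exists (r / 2); first by rewrite divr_gt0.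
exact: pl_leading_term.
Qed.

End AnalyticGerms.

(** * The Jost solution as a power series *)

Section JostConstruction.
Variable R : realType.
Local Notation C := (Cplx R).
Variables (al be : nat -> R) (a b eps : R).
Hypothesis be_gt0 : forall k, 0 < be k.
Hypothesis b_gt0 : 0 < b.
Hypothesis eps_gt0 : 0 < eps.
Hypothesis decay : cvgn [series (1 + eps) ^+ k.+1
  * (`|al k.+1 - a| + `|be k.+1 - b|)]_k.

(** With [e k = t ^+ k * g k] the channel equation at the energy
    [a - b (t + t^-1)] becomes [g k = step t k (g k.+1) (g k.+2)], in which the
    singularity at [t = 0] has disappeared. *)
Definition step (t : C) (k : nat) (x y : C) : C :=
  ((toC (al k.+1 - a) * t + toC b * (t ^+ 2 + 1)) * x
   - toC (be k.+1) * t ^+ 2 * y) / toC (be k).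

Fixpoint backward (d k : nat) (t : C) : C * C :=
  if d is d'.+1 then
    let: (x, y) := backward d' k.+1 t in (step t k x y, x)
  else (1, 1).

(** The solution equal to [1] from [N] on, that is, the Jost solution of the
    channel whose coefficients are unperturbed beyond [N]: a polynomial in
    [t]. *)
Definition truncated (N k : nat) (t : C) : C := (backward (N - k) k t).1.

Let r : R := 1 + eps.
Let r_gt1 : 1 < r. Proof. by rewrite /r ltrDl. Qed.
Let r_gt0 : 0 < r. Proof. exact: lt_trans ltr01 r_gt1. Qed.

Let dev (k : nat) : R := r ^+ k * (`|al k - a| + `|be k - b|).
Let pert (k : nat) : R := dev k + dev k.+1.

Let dev_ge0 k : 0 <= dev k.
Proof. by rewrite mulr_ge0 ?exprn_ge0 ?addr_ge0// ltW. Qed.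
Let pert_ge0 k : 0 <= pert k. Proof. by rewrite addr_ge0. Qed.

Lemma truncated1 N k t : (N <= k)%N -> truncated N k t = 1.
Proof. by rewrite /truncated -subn_eq0 => /eqP ->. Qed.

Lemma truncated_step N k t : (k < N)%N ->
  truncated N k t = step t k (truncated N k.+1 t) (truncated N k.+2 t).
Proof.
move=> kN; have E m : (backward (N - m) m t).2 = truncated N m.+1 t.
  by rewrite /truncated subnS; case: (N - m)%N => [|d] //=; case: backward.
rewrite -(E k.+1) /truncated -[in LHS](prednK (n := (N - k)%N)) ?subn_gt0// -subnS /=.
by case: backward.
Qed.

Lemma step_pl (rho : R) k f g : 0 <= rho ->
  poly_limit rho f -> poly_limit rho g ->
  poly_limit rho (fun t => step t k (f t) (g t)).
Proof.
move=> rho0 fP gP; have idP := @pl_id R rho; have cP := @pl_cst R rho.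
have sqP : poly_limit rho (fun t => t ^+ 2) by exact: plM.
apply: plM => //; apply: plB => //; apply: plM => //; last exact: plM.
by apply: plD; [exact: plM|apply: plM => //; exact: plD].
Qed.

Lemma truncated_pl (rho : R) N k : 0 <= rho -> poly_limit rho (truncated N k).
Proof.
move=> rho0; have [d] := ubnP (N - k)%N; elim: d k => // d IH k hd.
have [kN|Nk] := ltnP k N; last first.
  by apply: pl_ext (pl_cst rho 1) => t _; rewrite truncated1.
apply: (@pl_ext _ _ (fun t => step t k (truncated N k.+1 t) (truncated N k.+2 t))).
  by move=> t _; rewrite [RHS]truncated_step.
by apply: step_pl => //; apply: IH; lia.
Qed.

Lemma sub_step t k x y x' y' :
  step t k x y - step t k x' y' = step t k (x - x') (y - y').
Proof. by rewrite /step; field; rewrite toC_eq0 gt_eqF. Qed.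

(** The defect of the constant sequence in the perturbed recurrence. *)
Let q (t : C) (k : nat) : C :=
  toC (al k.+1 - a) * t + toC (b - be k.+1) * t ^+ 2 + toC (b - be k).

Let step_diff t k x y : toC (be k) * (step t k x y - x)
  = q t k * x + t ^+ 2 * (toC (be k.+1) * (x - y)).
Proof. by rewrite /step /q !toCB; field; rewrite toC_eq0 gt_eqF. Qed.

Let q_bound t k : nrm t ^+ 2 <= r -> r ^+ k * nrm (q t k) <= pert k.
Proof.
move=> t2; have t1 : nrm t <= r.
  have [|] := leP (nrm t) 1; first by move=> /le_trans; apply; exact: ltW.
  by move=> t1; apply: le_trans t2; rewrite expr2 ler_peMl ?nrm_ge0// ltW.
rewrite /pert /dev exprSr -mulrA -mulrDr ler_wpM2l ?exprn_ge0//; first exact: ltW.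
rewrite /q; set x := toC _ * t; set y := toC _ * _; set z := toC _.
have := nrmD (x + y) z; have := nrmD x y; rewrite /x /y /z !nrmM !nrm_toC -expr2.
have := normr_ge0 (al k.+1 - a); have := normr_ge0 (be k.+1 - b).
have := normr_ge0 (al k - a); rewrite (distrC b) (distrC b (be k)).
have := nrm_ge0 t; set u := `|al k.+1 - a|; set v := `|be k.+1 - b|.
move=> n0 w0 v0 u0; have h1 := ler_wpM2l u0 t1; have h2 := ler_wpM2l v0 t2; lra.
Qed.

Let be_lower : exists2 be0 : R, 0 < be0 & forall k, be0 <= be k.
Proof.
have b2 : 0 < b / 2 by rewrite divr_gt0.
have [N hN] : exists N, forall k, (N <= k)%N -> b / 2 <= be k.
  have := cvg_series_cvg_0 decay => /cvgrPdist_lt /(_ _ b2) [N _ hN].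
  exists N.+1 => -[//|k] /= Nk; have := hN k Nk; rewrite /= sub0r normrN.
  rewrite ger0_norm ?mulr_ge0 ?exprn_ge0 ?addr_ge0//; last exact: ltW.
  set x := `|al _ - a|; set y := `|be _ - b|.
  have x0 : 0 <= x by exact: normr_ge0.
  have y0 : 0 <= y by exact: normr_ge0.
  have rk : 1 <= (1 + eps) ^+ k.+1 by rewrite exprn_ege1// ltW.
  have h : y <= b / 2 -> b / 2 <= be k.+1 by rewrite ler_distl; lra.
  move=> hxy; apply: h; have := ler_pM ler01 (addr_ge0 x0 y0) rk (lexx (x + y)).
  lra.
suff {hN} : forall N, exists2 be0 : R, 0 < be0 & forall k, (k < N)%N -> be0 <= be k.
  move=> /(_ N)[be1 be1_0 h]; exists (Order.min be1 (b / 2)).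
    by rewrite lt_min be1_0.
  by move=> k; rewrite ge_min; have [/h ->//|/hN ->] := ltnP k N; rewrite orbT.
elim=> [|n [be0 h0 h]]; first by exists 1.
exists (Order.min be0 (be n)); first by rewrite lt_min h0 be_gt0.
move=> k; rewrite ltnS leq_eqVlt ge_min => /orP[/eqP ->|/h ->//].
by rewrite lexx orbT.
Qed.

Let pert_summable : exists S : R, 0 <= S /\ (forall n, \sum_(i < n) pert i <= S) /\
  forall e, 0 < e -> exists n, forall m, (n <= m)%N -> S - \sum_(i < m) pert i < e.
Proof.
pose u n := \sum_(i < n) pert i.
have uE n : u n.+1 = 2 * [series dev k.+1]_k n + dev 0%N + dev n.+1 .
  have -> : [series dev k.+1]_k n = \sum_(i < n) dev i.+1 by rewrite seriesEord.
  rewrite /u; elim: n => [|n IH].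
    by rewrite big_ord_recr !big_ord0 /= /pert; ring.
  by rewrite big_ord_recr /= IH [in RHS]big_ord_recr /= /pert; ring.
have cvu : cvgn u.
  have h : (fun n => 2 * [series dev k.+1]_k n + dev 0%N + dev n.+1) @ \oo -->
      (2 * limn [series dev k.+1]_k + dev 0%N + 0 : R).
    apply: cvgD; last exact: cvg_series_cvg_0.
    by apply: cvgD; [apply: cvgM; [exact: cvg_cst|exact: decay]|exact: cvg_cst].
  have hu : u n.+1 @[n --> \oo] --> (2 * limn [series dev k.+1]_k + dev 0%N + 0 : R).
    by under eq_fun do rewrite uE.
  by rewrite cvg_shiftS in hu; exact: cvgP hu.
have und : {homo u : n m / (n <= m)%N >-> n <= m}.
  by apply/nondecreasing_seqP => n; rewrite /u big_ord_recr lerDl.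
have ub n : u n <= limn u by exact: nondecreasing_cvgn_le.
exists (limn u); split; first by apply: le_trans (ub 0%N); rewrite /u big_ord0.
split=> // e e0; have /cvgrPdist_lt/(_ e e0)[n _ hn] := cvu.
exists n => m nm; have := hn m nm; rewrite /= ger0_norm ?subr_ge0//.
Qed.

(** Stability of the backward recursion, uniformly in the starting level [N]:
    the weight [r ^+ k] absorbs the growth of the second solution [t ^- k],
    because [|t| ^+ 2 <= r] and the perturbation is summable with the
    weight. *)
Lemma backward_stable : exists2 K : R, 0 < K &
  forall (t : C) (N : nat) (h : nat -> C), nrm t ^+ 2 <= r ->
    (forall k, (k < N)%N -> h k = step t k (h k.+1) (h k.+2)) ->
    forall k, (k <= N)%N -> nrm (h k)
      <= K * (nrm (h N) + r ^+ N * (be N * nrm (h N - h N.+1))).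
Proof.
have [be0 be0_gt0 hbe] := be_lower; have [S [S0 [hS _]]] := pert_summable.
pose u k := r^-1 ^+ k / be0.
have u_ge0 k : 0 <= u k by rewrite divr_ge0 ?exprn_ge0 ?invr_ge0// ltW.
have [A hA] : exists A : R, forall n, \sum_(i < n) (u i + pert i) <= A.
  exists ((1 - r^-1)^-1 / be0 + S) => n; rewrite big_split; apply: lerD; last exact: hS.
  rewrite /u -mulr_suml ler_pM2r ?invr_gt0//.
  have ri : 0 < 1 - r^-1 by rewrite subr_gt0 invf_lt1.
  rewrite -(ler_pM2l ri) mulfV ?gt_eqF//; have := subrX1 r^-1 n.
  have : 0 <= r^-1 ^+ n by rewrite exprn_ge0// invr_ge0 ltW.
  move: (\sum_(i < n) _) => s; lra.
exists (expR A); first exact: expR_gt0.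
move=> t N h t2 hh k kN.
pose X k := nrm (h k) + r ^+ k * (be k * nrm (h k - h k.+1)).
have X_ge0 j : 0 <= X j.
  by rewrite addr_ge0 ?mulr_ge0 ?nrm_ge0 ?exprn_ge0// ltW.
have Xstep j : (j < N)%N -> X j <= (1 + u j) * (1 + pert j) * X j.+1.
  move=> jN; have E : toC (be j) * (h j - h j.+1)
      = q t j * h j.+1 + t ^+ 2 * (toC (be j.+1) * (h j.+1 - h j.+2)).
    by rewrite (hh j jN) step_diff.
  pose D i := r ^+ i * (be i * nrm (h i - h i.+1)).
  have nbe i z : nrm (toC (be i) * z) = be i * nrm z.
    by rewrite nrmM nrm_toC ger0_norm// ltW.
  have rj : 0 < r ^+ j by rewrite exprn_gt0.
  have DS : D j <= pert j * nrm (h j.+1) + D j.+1.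
    rewrite /D -nbe E; apply: le_trans (ler_wpM2l (ltW rj) (nrmD _ _)) _.
    rewrite mulrDr; apply: lerD; first by rewrite nrmM mulrA ler_wpM2r ?nrm_ge0// q_bound.
    rewrite nrmM nbe nrmX (exprSr r) -mulrA; apply: ler_wpM2l; first exact: ltW.
    by rewrite ler_wpM2r// mulr_ge0 ?nrm_ge0// ltW.
  have D_ge0 i : 0 <= D i by rewrite !mulr_ge0 ?nrm_ge0 ?exprn_ge0// ltW.
  have hj : nrm (h j) <= nrm (h j.+1) + u j * D j.
    apply: le_trans (nrm_le_dist _ (h j.+1)) _; rewrite lerD2l.
    have -> : u j * D j = be j / be0 * nrm (h j - h j.+1).
      by rewrite /u /D exprVn; field; rewrite !gt_eqF.
    by rewrite ler_peMl ?nrm_ge0// ler_pdivlMr// mul1r.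
  have -> : X j.+1 = nrm (h j.+1) + D j.+1 by [].
  have -> : X j = nrm (h j) + D j by [].
  have := u_ge0 j; have := pert_ge0 j; have := nrm_ge0 (h j.+1).
  have := D_ge0 j.+1; have := D_ge0 j; move: DS hj.
  move: (D j) (D j.+1) (u j) (pert j) (nrm (h j)) (nrm (h j.+1)).
  move=> D0 D1 u0 p0 x0 x1 hD hx D00 D10 x10 p00 u00.
  have t1 : u0 * D0 <= u0 * (p0 * x1 + D1) by rewrite ler_wpM2l.
  have t2' : 0 <= p0 * D1 by rewrite mulr_ge0.
  have t3 : 0 <= u0 * (p0 * D1) by rewrite mulr_ge0.
  have t4 : 0 <= u0 * x1 by rewrite mulr_ge0.
  lra.
have Xsum d : (d <= N)%N ->
    X (N - d)%N <= expR (\sum_(N - d <= i < N) (u i + pert i)) * X N.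
  elim: d => [|d IH] dN; first by rewrite subn0 big_geq// expR0 mul1r.
  have e : (N - d)%N = (N - d.+1).+1 by lia.
  have dN' : (N - d.+1 < N)%N by lia.
  apply: le_trans (Xstep _ dN') _; rewrite -e big_ltn// -e expRD.
  have h1 : (1 + u (N - d.+1)%N) * (1 + pert (N - d.+1)%N)
      <= expR (u (N - d.+1)%N + pert (N - d.+1)%N).
    by rewrite expRD ler_pM ?addr_ge0 ?expR_ge1Dx.
  rewrite -[leRHS]mulrA; apply: ler_pM => //; last by apply: IH; exact: ltnW.
  by rewrite mulr_ge0 ?addr_ge0.
apply: (@le_trans _ _ (X k)).
  by rewrite lerDl !mulr_ge0 ?nrm_ge0 ?exprn_ge0// ltW.
have := Xsum (N - k)%N (leq_subr _ _); rewrite subKn// => /le_trans; apply.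
rewrite ler_wpM2r// ler_expR; apply: le_trans (hA N).
have -> : \sum_(i < N) (u i + pert i) = \sum_(0 <= i < k) (u i + pert i)
    + \sum_(k <= i < N) (u i + pert i).
  by rewrite -(big_mkord xpredT (fun i => u i + pert i)) -big_cat_nat.
by rewrite ler_wpDl// sumr_ge0// => i _; rewrite addr_ge0.
Qed.

Let rho : R := Num.sqrt r.
Let rho_gt1 : 1 < rho.
Proof. by rewrite -sqrtr1 ltr_sqrt. Qed.
Let rho2 (t : C) : nrm t <= rho -> nrm t ^+ 2 <= r.
Proof.
move=> tr; rewrite -[r]sqr_sqrtr; last exact: ltW.
by rewrite lerXn2r// nnegrE ?nrm_ge0// sqrtr_ge0.
Qed.

(** The truncated solutions form a uniform Cauchy sequence on the disk of
    radius [Num.sqrt (1 + eps)], which reaches beyond the unit circle: by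
    stability, moving the truncation level from [N] to [N.+1] costs one term of
    a convergent series.  At [t = 0] the recurrence has one term only, so a
    zero there would propagate to infinity, against the limit [1]. *)
Lemma rescaled_jost : exists (rad : R) (g : nat -> C -> C), [/\ 1 < rad,
  forall k, poly_limit rad (g k),
  forall t k, nrm t <= rad -> g k t = step t k (g k.+1 t) (g k.+2 t),
  forall t, nrm t <= rad -> clim \oo (fun k => g k t) 1
  & forall k, g k 0 != 0].
Proof.
have [K K0 hK] := backward_stable; have [be0 be0_gt0 hbe] := be_lower.
have [S [S0 [hS limS]]] := pert_summable.
pose c := K * (be0^-1 + 1); have c0 : 0 < c by rewrite mulr_gt0 ?addr_gt0 ?invr_gt0.
have rho0 : 0 <= rho by rewrite ltW// (lt_trans ltr01).
have next N k t : nrm t <= rho -> (k <= N)%N ->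
    nrm (truncated N.+1 k t - truncated N k t) <= c * pert N.
  move=> /rho2 t2 kN; pose h j := truncated N.+1 j t - truncated N j t.
  have hh j : (j < N)%N -> h j = step t j (h j.+1) (h j.+2).
    by move=> jN; rewrite /h -sub_step -!truncated_step// ltnS ltnW.
  apply: le_trans (hK t N h t2 hh k kN) _.
  have -> : h N.+1 = 0 by rewrite /h !truncated1// subrr.
  have hN : toC (be N) * h N = q t N.
    rewrite /h truncated_step// !truncated1// step_diff subrr !mulr0 addr0.
    by rewrite mulr1.
  have hN1 : be N * nrm (h N) = nrm (q t N).
    by rewrite -hN nrmM nrm_toC ger0_norm// ltW.
  rewrite subr0 hN1 /c -mulrA ler_wpM2l//; first exact: ltW.
  have hq := q_bound N t2; rewrite mulrDl mul1r lerD//.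
  rewrite mulrC ler_pdivlMr//; apply: le_trans hq.
  rewrite -hN1 mulrA mulrC ler_wpM2r ?nrm_ge0//.
  apply: le_trans (hbe N) _; rewrite ler_peMl//; first exact: ltW.
  by rewrite exprn_ege1// ltW.
pose tail N := c * (S - \sum_(i < N) pert i).
have cauchy k m n t : (m <= n)%N -> nrm t <= rho ->
    nrm (truncated (k + n) k t - truncated (k + m) k t) <= tail (k + m)%N.
  move=> mn tr; suff : nrm (truncated (k + n) k t - truncated (k + m) k t)
      <= c * (\sum_(i < k + n) pert i - \sum_(i < k + m) pert i).
    move=> /le_trans; apply; rewrite /tail ler_wpM2l//; first exact: ltW.
    by rewrite lerB.
  rewrite -(subnKC mn); elim: (n - m)%N => [|d IH].
    by rewrite addn0 !subrr nrm0 mulr0.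
  rewrite !addnS big_ord_recr /=.
  have := next (k + (m + d))%N k t tr (leq_addr _ _).
  have := nrm_triB (truncated (k + (m + d)).+1 k t)
    (truncated (k + (m + d)) k t) (truncated (k + m) k t); lra.
have tail0 k e : 0 < e -> exists n, forall m, (n <= m)%N -> tail (k + m)%N < e.
  move=> e0; have [|n hn] := limS (e / c); first by rewrite divr_gt0.
  exists n => m nm; rewrite /tail mulrC -ltr_pdivlMr//; apply: hn.
  exact: leq_trans (leq_addl _ _).
have [g hg] : exists g : nat -> C -> C, forall k, poly_limit rho (g k) /\
    forall m t, nrm t <= rho -> nrm (g k t - truncated (k + m) k t) <= tail (k + m)%N.
  suff /choice[g hg] : forall k, exists f : C -> C, poly_limit rho f /\
    forall m t, nrm t <= rho -> nrm (f t - truncated (k + m) k t) <= tail (k + m)%N.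
    by exists g.
  move=> k; have [||m n t|f fP hf] := @pl_cauchy R rho
    (fun m t => truncated (k + m) k t) (fun m => tail (k + m)%N).
  - exact: tail0.
  - by move=> n; exact: truncated_pl.
  - exact: cauchy.
  - by exists f.
have glim k t : nrm t <= rho -> clim \oo (fun N => truncated N k t) (g k t).
  move=> tr e e0; have [n hn] := tail0 0%N e e0; exists (maxn n k) => // N /=.
  rewrite geq_max => /andP[nN kN]; have [_ h] := hg k.
  have := h (N - k)%N t tr; rewrite subnKC// nrmBC => /le_lt_trans; apply.
  exact: hn.
have g1 t : nrm t <= rho -> clim \oo (fun k => g k t) 1.
  move=> tr e e0; have [n hn] := tail0 0%N e e0; exists n => // k /= nk.
  have [_ /(_ 0%N t tr)] := hg k; rewrite addn0 truncated1// => /le_lt_trans; apply.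
  exact: hn.
have gstep t k : nrm t <= rho -> g k t = step t k (g k.+1 t) (g k.+2 t).
  move=> tr; apply: (@clim_unique _ _ \oo _ (fun N => truncated N k t)).
    exact: glim.
  apply: (@clim_near _ _ \oo _ (fun N => step t k (truncated N k.+1 t) (truncated N k.+2 t))).
    by exists k.+1 => // N /= kN; rewrite -truncated_step.
  apply: climM; last exact: clim_cst.
  by apply: climB; (apply: climM; [exact: clim_cst|exact: glim]).
exists rho, g; split=> // [k|k]; first by have [] := hg k.
have n0 : nrm (0 : C) <= rho by rewrite nrm0.
have [N _ hN] := g1 0 n0 1 ltr01.
have far j : (N <= j)%N -> g j 0 != 0.
  by move=> Nj; apply/eqP => gj; have := hN j Nj; rewrite /= gj sub0r nrmN nrm1 ltxx.
have [Nk|kN] := leqP N k; first exact (far k Nk).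
have := far N (leqnn N); rewrite -(subnKC (ltnW kN)).
elim: (N - k)%N => [|d IH]; first by rewrite addn0.
rewrite addnS => h; apply: IH; rewrite gstep//.
have -> y : step 0 (k + d) (g (k + d).+1 0) y
    = toC b / toC (be (k + d)%N) * g (k + d).+1 0.
  by rewrite /step; field; rewrite toC_eq0 gt_eqF.
apply: mulf_neq0 => //; apply: mulf_neq0; rewrite ?invr_eq0 toC_eq0 gt_eqF//.
Qed.
End JostConstruction.

(** * Uniqueness of the Jost solution *)

Section JostUniqueness.
Variable R : realType.
Local Notation C := (Cplx R).

(** A second-order recurrence has one solution with a prescribed behaviour
    [t ^+ k] at infinity: the Casoratian of two such solutions is constant and
    tends to zero because [|t| <= 1], hence they are proportional, with ratio
    tending to one. *)
Lemma jost_unique (al be : nat -> C) (b z t : C) (e f : nat -> C) :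
  (forall k, be k != 0) -> clim \oo be b -> 0 < nrm t <= 1 ->
  (forall k, - be k * e k + al k.+1 * e k.+1 - be k.+1 * e k.+2 = z * e k.+1) ->
  (forall k, - be k * f k + al k.+1 * f k.+1 - be k.+1 * f k.+2 = z * f k.+1) ->
  clim \oo (fun k => e k / t ^+ k) 1 -> clim \oo (fun k => f k / t ^+ k) 1 ->
  forall k, e k = f k.
Proof.
move=> be0 beb /andP[t0 t1] he hf e1 f1; rewrite nrm_gt0 in t0.
have t0k k : t ^+ k != 0 by rewrite expf_neq0.
pose w k := be k * (f k * e k.+1 - f k.+1 * e k).
have wS k : w k = w k.+1.
  have E : be k * e k = al k.+1 * e k.+1 - be k.+1 * e k.+2 - z * e k.+1.
    by rewrite -he; ring.
  have F : be k * f k = al k.+1 * f k.+1 - be k.+1 * f k.+2 - z * f k.+1.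
    by rewrite -hf; ring.
  rewrite /w; transitivity ((be k * f k) * e k.+1 - f k.+1 * (be k * e k)).
    by ring.
  by rewrite E F; ring.
have shift (g : nat -> C) (l : C) : clim \oo g l -> clim \oo (fun k => g k.+1) l.
  move=> gl d d0; have [n _ hn] := gl d d0; exists n => // k /= nk.
  by apply: hn; rewrite /= leqW.
have w0 k : w k = 0.
  have wk : w k = w 0%N by elim: k => // k <-.
  rewrite wk; apply: (@clim_unique _ _ \oo _ w).
    by move=> d d0; exists 0%N => // j _ /=; rewrite (_ : w j = w 0%N) ?subrr ?nrm0//; elim: j => // j <-.
  pose v k := be k * (f k / t ^+ k * (e k.+1 / t ^+ k.+1)
                      - f k.+1 / t ^+ k.+1 * (e k / t ^+ k)).
  have v0 : clim \oo v 0.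
    have -> : 0 = b * (1 * 1 - 1 * 1) by ring.
    apply: climM => //; apply: climB.
      by apply: climM => //; exact: (shift (fun k => e k / t ^+ k)).
    by apply: climM => //; exact: (shift (fun k => f k / t ^+ k)).
  move=> d d0; apply: filterS (v0 d d0) => j /=; rewrite !subr0.
  have -> : w j = t ^+ (j + j.+1) * v j.
    by rewrite /w /v exprD exprS; field; rewrite t0 t0k.
  apply: le_lt_trans; rewrite nrmM nrmX ler_piMl ?nrm_ge0//.
  by rewrite exprn_ile1 ?nrm_ge0.
have prop k : f k * e k.+1 = f k.+1 * e k.
  have /eqP := w0 k; rewrite /w mulf_eq0 (negbTE (be0 k)) /= subr_eq0.
  by move/eqP.
have [N _ hN] := e1 1 ltr01.
have eN k : (N <= k)%N -> e k != 0.
  move=> Nk; apply/eqP => ek; have := hN k Nk.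
  by rewrite /= ek mul0r sub0r nrmN nrm1 ltxx.
have ratio k : (N <= k)%N -> f k / e k = f N / e N.
  move=> Nk; rewrite -(subnKC Nk); elim: (k - N)%N => [|d IH]; first by rewrite addn0.
  rewrite -IH addnS; apply/eqP; rewrite eqr_div ?eN ?leqW ?leq_addr//.
  by rewrite prop.
have rat1 : f N / e N = 1.
  apply: (@clim_unique _ _ \oo _ (fun k => (f k / t ^+ k) / (e k / t ^+ k))).
    apply: (@clim_near _ _ \oo _ (fun=> f N / e N)); last exact: clim_cst.
    exists N => // k /= Nk; rewrite -(ratio k Nk); field.
    by rewrite eN// t0k.
  rewrite -[1]divr1; apply: climM => //; apply: climV => //; exact: oner_neq0.
have far k : (N <= k)%N -> e k = f k.
  move=> Nk; apply/esym/(divIf (eN k Nk)).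
  by rewrite ratio// rat1 divff ?eN.
have down d k : (N <= k + d)%N -> e k = f k.
  elim/ltn_ind: d k => -[|d] IH k; first by rewrite addn0; exact: far.
  move=> h; have e1k : e k.+1 = f k.+1 by apply: (IH d) => //; lia.
  have e2k : e k.+2 = f k.+2.
    case: d IH h => [|d] IH h; first by apply: far; lia.
    by apply: (IH d); lia.
  apply: (mulfI (be0 k)).
  have := he k; rewrite e1k e2k -(hf k) => /addIr/addIr.
  by rewrite !mulNr => /oppr_inj.
by move=> k; apply: (down N); rewrite leq_addl.
Qed.

Variables (A : countType) (m n : nat) (S : system R A m n).
Hypothesis hS : admissible S.

(** On the punctured disk the given Jost solution is identified with the
    constructed one by uniqueness; at the origin, where nothing is prescribed
    by the recurrence, by continuity. *)
Lemma jost_expansion (e : 'I_m -> nat -> C -> C) (c : 'I_m) :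
  jost_solution S e ->
  exists (rad : R) (g : nat -> C -> C), [/\ 1 < rad,
    forall k, poly_limit rad (g k), forall k, g k 0 != 0 &
    forall t k, nrm t <= 1 -> e c k t = t ^+ k * g k t].
Proof.
move=> he; have [eps eps0 /(_ c) decay] := coef_decay hS.
have be_gt0 := bcoef_gt0 hS c.
have [rad [g [rad1 gP gstep g1 g0]]] := rescaled_jost be_gt0 (b_ch_gt0 hS c) eps0 decay.
exists rad, g; split=> //.
have bb : clim \oo (fun k => toC (bcoef S c k)) (toC (b_ch S c)).
  move=> d d0; have /cvgrPdist_lt/(_ _ d0)[N _ hN] := cvg_series_cvg_0 decay.
  exists N.+1 => // -[//|k] /= Nk; rewrite -toCB nrm_toC.
  have := hN k Nk; rewrite /= sub0r normrN; apply: le_lt_trans.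
  rewrite normrM [X in _ <= _ * X]ger0_norm ?addr_ge0//.
  rewrite ger0_norm ?exprn_ge0 ?addr_ge0 ?(ltW eps0)//.
  rewrite -[leLHS]mul1r; apply: ler_pM => //; last by rewrite lerDr.
  by rewrite exprn_ege1// lerDl ltW.
have pos t k : 0 < nrm t <= 1 -> e c k t = t ^+ k * g k t.
  move=> t01; have /andP[t0 t1] := t01; rewrite nrm_gt0 in t0.
  have tC : 0 < `|t| <= 1 by rewrite norm_le1 t1 normr_gt0 t0.
  have trad : nrm t <= rad by apply: le_trans t1 _; exact: ltW.
  apply: (@jost_unique (fun k => toC (acoef S c k)) (fun k => toC (bcoef S c k))
    (toC (b_ch S c)) (W_ch S c t) t (fun k => e c k t) (fun k => t ^+ k * g k t)).
  - by move=> j; rewrite toC_eq0 gt_eqF.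
  - exact: bb.
  - exact: t01.
  - by move=> j; have := jost_eq he c tC; apply.
  - move=> j; rewrite (gstep t j trad) /step /W_ch /zhukovsky !toCB.
    rewrite !exprS; field; rewrite t0 toC_eq0 gt_eqF//; exact: be_gt0.
  - by have := jost_asymp he c tC; move/climP.
  - apply: (@clim_near _ _ \oo _ (fun k => g k t)); last exact: g1.
    by exists 0%N => // j _ /=; rewrite mulrC mulKf// expf_neq0.
move=> t k t1; have [t0|t0] := eqVneq t 0; last by apply: pos; rewrite nrm_gt0 t0.
have [V [oV cV /(_ k) hV]] := jost_holo he c.
have V0 : V 0 by apply: cV; rewrite /closed_disk /= normr0.
have ce : clim (nbhs (0 : C)) (e c k) (e c k 0).
  apply/climP; apply/differentiable_continuous/derivable1_diffP; exact: hV.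
pose F := (0 : C)^'.
have FF : ProperFilter F by exact: Proper_dnbhs_numFieldType.
have toF h l : clim (nbhs (0 : C)) h l -> clim F h l.
  by move=> hl d d0; rewrite /F /dnbhs /within /=; apply: filterS (hl d d0) => u hu _.
rewrite t0; apply: (@clim_unique _ _ F _ (e c k)); first exact: toF.
apply: (@clim_near _ _ F _ (fun t => t ^+ k * g k t)).
  rewrite /F /dnbhs /within /=; apply/nbhsCP; exists 1 => // u.
  by rewrite subr0 => u1 u0; rewrite pos// nrm_gt0 u0 ltW.
apply: toF; apply: climM; last by apply: pl_continuous (gP k); rewrite nrm0 (lt_trans ltr01).
by apply: climX; apply/climP; exact: cvg_id.
Qed.

End JostUniqueness.

(** * Continuous square roots *)

Section SegmentSign.
Variable R : realType.
Local Notation C := (Cplx R).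

Lemma nrm_sqr (z : C) : nrm z ^+ 2 = complex.Re z ^+ 2 + complex.Im z ^+ 2.
Proof. by apply: toC_inj; rewrite toCX -normE; exact/esym/add_Re2_Im2. Qed.

Lemma Re_lt1 (z : C) : nrm z <= 1 -> z != 1 -> complex.Re z < 1.
Proof.
move=> z1 zn1; rewrite ltNge; apply/negP => hz.
have h2 : nrm z ^+ 2 <= 1 by rewrite exprn_ile1 ?nrm_ge0.
rewrite nrm_sqr in h2; have rz : complex.Re z = 1 by nra.
have iz : complex.Im z = 0 by apply/eqP; rewrite -sqrf_eq0; apply/eqP; nra.
case/negP: zn1; apply/eqP; move: rz iz; clear; case: z => x y /= -> ->.
by [].
Qed.

Definition segment (x y : C) (t : R) : C := x + toC t * (y - x).

(** On a convex set a continuous choice of square root of a nonvanishing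
    function is determined up to one global sign, by the intermediate value
    theorem along segments. *)
Lemma sqrt_sign (D : set C) (f g : C -> C) :
  (forall x y t, D x -> D y -> 0 <= t <= 1 -> D (segment x y t)) ->
  (forall z, D z -> clim (within D (nbhs z)) f (f z)) ->
  (forall z, D z -> clim (within D (nbhs z)) g (g z)) ->
  (forall z, D z -> g z != 0) -> (forall z, D z -> f z ^+ 2 = g z ^+ 2) ->
  exists2 s : C, s ^+ 2 = 1 & forall z, D z -> f z = s * g z.
Proof.
move=> cD cf cg g0 fg.
have alt z : D z -> f z / g z = 1 \/ f z / g z = -1.
  move=> Dz; have /eqP : (f z / g z) ^+ 2 = 1.
    by rewrite expr_div_n fg// divff// expf_neq0// g0.
  by rewrite sqrf_eq1 => /orP[/eqP ->|/eqP ->]; [left|right].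
have same x y : D x -> D y -> f x / g x = -1 -> f y / g y = 1 -> False.
  move=> Dx Dy hx hy; pose phi t := complex.Re (f (segment x y t) / g (segment x y t)).
  have : exists2 t : R, t \in `[0, 1]%R & phi t = 0.
    apply: IVT => //.
      apply/subspace_continuousP => t /= t01.
      apply/cvgrPdist_lt => eps eps0; pose z := segment x y t.
      have Dz : D z by apply: cD => //; move: t01; rewrite in_itv.
      have wf : Filter (within D (nbhs z)) by exact: within_filter.
      have lim : clim (within D (nbhs z)) (fun z => f z / g z) (f z / g z).
        by apply: climM; [exact: cf|apply: climV; [exact: g0|exact: cg]].
      have /nbhsCP[d d0 hd] := lim eps eps0.
      have yx0 : 0 < nrm (y - x) + 1 by rewrite ltr_wpDl ?nrm_ge0.
      apply/nbhs_ballP; exists (d / (nrm (y - x) + 1)); first exact: divr_gt0.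
      move=> u /= tu u01; rewrite distrC.
      have Du : D (segment x y u) by apply: cD => //; move: u01; rewrite in_itv.
      have zu : nrm (segment x y u - z) < d.
        have -> : segment x y u - z = toC (u - t) * (y - x).
          by rewrite /z /segment toCB; ring.
        rewrite nrmM nrm_toC; move: tu; rewrite /ball /= distrC ltr_pdivlMr//.
        apply: le_lt_trans; rewrite ler_wpM2l//; lra.
      have := hd _ zu Du; apply: le_lt_trans; rewrite /phi.
      have -> : forall p q : C, complex.Re p - complex.Re q = complex.Re (p - q).
        by case=> ? ? [].
      exact: nrm_Re.
    rewrite /phi /segment toC0 toC1 mul0r addr0 mul1r addrC subrK hx hy /=.
    by rewrite ge_min le_max oppr_le0 !ler01 ?orbT.
  move=> [t]; rewrite in_itv => /= t01; rewrite /phi.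
  have [|->|->] := alt (segment x y t); first exact: cD.
    by move/eqP; rewrite oner_eq0.
  by move/eqP; rewrite /= oppr_eq0 oner_eq0.
have [ex|nex] := pselect (exists2 x, D x & f x / g x = -1).
  have [x Dx hx] := ex; exists (-1); first by rewrite sqrrN expr1n.
  move=> z Dz; have [h|h] := alt z Dz; first by have := same x z Dx Dz hx h.
  by rewrite -h divfK// g0.
exists 1; first by rewrite expr1n.
move=> z Dz; have [h|h] := alt z Dz; first by rewrite -h divfK// g0.
by case: nex; exists z.
Qed.

(** A square root of [z - w], continuous on the closed disk punctured at [w]
    when [w] lies on the unit circle: there [1 - z / w] has positive real
    part, so its root in the right half-plane can be taken. *)
Lemma uniformizer (w : C) : exists tau : C -> C,
  (forall z, tau z ^+ 2 = z - w) /\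
  (nrm w = 1 -> forall z, nrm z <= 1 -> z != w ->
     clim (within [set u | nrm u <= 1] (nbhs z)) tau (tau z)).
Proof.
pose u z : C := sqrtC (1 - z / w).
pose v z := if 0 <= complex.Re (u z) then u z else - u z.
have v2 z : v z ^+ 2 = 1 - z / w.
  by rewrite /v; case: ifP => _; rewrite ?sqrrN sqrtCK.
have v_ge0 z : 0 <= complex.Re (v z).
  rewrite /v; case: ifPn => //; rewrite -ltNge.
  by case: (u z) => x y /=; rewrite oppr_ge0; exact: ltW.
have [w1|w1] := eqVneq (nrm w) 1; last first.
  by exists (fun z => sqrtC (z - w)); split=> [z|/eqP]; rewrite ?sqrtCK// (negbTE w1).
have w0 : w != 0 by rewrite -nrm_gt0 w1.
exists (fun z => sqrtC (- w) * v z); split=> [z|_ z z1 zw].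
  by rewrite exprMn sqrtCK v2; field.
have v_gt0 : 0 < complex.Re (v z).
  rewrite lt_def v_ge0 andbT; apply/eqP => r0.
  have zw1 : nrm (z / w) <= 1 by rewrite nrmM nrmV w1 invr1 mulr1.
  have zwn : z / w != 1.
    by apply: contra zw => /eqP h; rewrite -[z](divfK w0) h mul1r.
  have := Re_lt1 zw1 zwn; have := v2 z; case: (v z) r0 => x y /= ->.
  rewrite expr2 => h; have : complex.Re (1 - z / w) = - (y * y).
    by rewrite -h /=; ring.
  by case: (z / w) => p q /=; nra.
set a := complex.Re _ in v_gt0.
have wf : Filter (within [set u | nrm u <= 1] (nbhs z)) by exact: within_filter.
apply: climM; first exact: clim_cst.
move=> eps eps0; apply/nbhsCP; exists (eps * a); first exact: mulr_gt0.
move=> y yz y1; rewrite -(ltr_pM2r v_gt0); apply: le_lt_trans yz.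
have -> : nrm (y - z) = nrm (v y - v z) * nrm (v y + v z).
  rewrite -nrmM -subr_sqr !v2 -[LHS]mulr1 -[X in _ * X]invr1 -w1 -nrmV -nrmM.
  by rewrite -nrmN; congr nrm; ring.
rewrite ler_wpM2l ?nrm_ge0//; apply: le_trans (nrm_Re _).
apply: le_trans (ler_norm _); rewrite /a; have := v_ge0 y.
by case: (v y) => p q; case: (v z) => p' q' /=; rewrite lerDr.
Qed.

End SegmentSign.

(** * Quotients of germs in a uniformizer *)

Section Meromorphic.
Variable R : realType.
Local Notation C := (Cplx R).
Variables (F : set_system C) (tau : C -> C).
Hypothesis FF : ProperFilter F.
Hypothesis tau0 : clim F tau 0.
Implicit Types f g : C -> C.

(** This class covers meromorphic functions, with [tau = z - w], as well as
    square-root branch points, with [tau ^+ 2 = z - w]. *)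
Definition puiseux f : Prop := exists N D : C -> C,
  [/\ analytic N, analytic D & F (fun z => D (tau z) != 0 /\ f z = N (tau z) / D (tau z))].

Lemma px_near f g : F (fun z => f z = g z) -> puiseux f -> puiseux g.
Proof.
move=> fg [N [D [hN hD h]]]; exists N, D; split=> //.
by apply: filterS2 fg h => z <-.
Qed.

Lemma px_analytic f : analytic f -> puiseux (f \o tau).
Proof.
move=> hf; exists f, (fun=> 1); split=> //; first exact: ana_cst.
by apply: filterE => z; rewrite divr1 oner_neq0.
Qed.

Lemma px_cst a : puiseux (fun=> a).
Proof. exact: (px_analytic (ana_cst a)). Qed.

Lemma pxD f g : puiseux f -> puiseux g -> puiseux (fun z => f z + g z).
Proof.
move=> [N [D [hN hD h]]] [N' [D' [hN' hD' h']]].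
exists (fun t => N t * D' t + N' t * D t), (fun t => D t * D' t); split.
- by apply: anaD; exact: anaM.
- exact: anaM.
apply: filterS2 h h' => z [D0 ->] [D0' ->]; split; first exact: mulf_neq0.
by rewrite addf_div.
Qed.

Lemma pxM f g : puiseux f -> puiseux g -> puiseux (fun z => f z * g z).
Proof.
move=> [N [D [hN hD h]]] [N' [D' [hN' hD' h']]].
exists (fun t => N t * N' t), (fun t => D t * D' t); split; try exact: anaM.
apply: filterS2 h h' => z [D0 ->] [D0' ->]; split; first exact: mulf_neq0.
by rewrite mulf_div.
Qed.

Lemma pxV f : F (fun z => f z != 0) -> puiseux f -> puiseux (fun z => (f z)^-1).
Proof.
move=> f0 [N [D [hN hD h]]]; exists D, N; split=> //.
apply: filterS2 f0 h => z fz [D0 E]; rewrite E invf_div; split=> //.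
by apply: contra fz => /eqP N0; rewrite E N0 mul0r.
Qed.

Lemma pxN f : puiseux f -> puiseux (fun z => - f z).
Proof.
move=> hf; apply: px_near (pxM (px_cst (-1)) hf).
by apply: filterE => z; rewrite mulN1r.
Qed.

Lemma pxB f g : puiseux f -> puiseux g -> puiseux (fun z => f z - g z).
Proof. by move=> hf hg; apply: pxD => //; exact: pxN. Qed.

Lemma px_sum (I : Type) (r : seq I) (P : pred I) (f : I -> C -> C) :
  (forall i, puiseux (f i)) -> puiseux (fun z => \sum_(i <- r | P i) f i z).
Proof.
move=> hf; elim: r => [|i r IH].
  by apply: px_near (px_cst 0); apply: filterE => z; rewrite big_nil.
have [Pi|Pi] := boolP (P i); last first.
  by apply: px_near IH; apply: filterE => z; rewrite big_cons (negbTE Pi).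
by apply: px_near (pxD (hf i) IH); apply: filterE => z; rewrite big_cons Pi.
Qed.

Lemma px_prod (I : Type) (r : seq I) (P : pred I) (f : I -> C -> C) :
  (forall i, puiseux (f i)) -> puiseux (fun z => \prod_(i <- r | P i) f i z).
Proof.
move=> hf; elim: r => [|i r IH].
  by apply: px_near (px_cst 1); apply: filterE => z; rewrite big_nil.
have [Pi|Pi] := boolP (P i); last first.
  by apply: px_near IH; apply: filterE => z; rewrite big_cons (negbTE Pi).
by apply: px_near (pxM (hf i) IH); apply: filterE => z; rewrite big_cons Pi.
Qed.

Definition mx_puiseux p q (A : C -> 'M[C]_(p, q)) : Prop :=
  forall i j, puiseux (fun z => A z i j).

Lemma mx_pxM p q s (A : C -> 'M[C]_(p, q)) (B : C -> 'M[C]_(q, s)) :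
  mx_puiseux A -> mx_puiseux B -> mx_puiseux (fun z => A z *m B z).
Proof.
move=> hA hB i j.
apply: px_near (px_sum _ _ (fun k => pxM (hA i k) (hB k j))).
by apply: filterE => z; rewrite mxE.
Qed.

Lemma mx_pxB p q (A B : C -> 'M[C]_(p, q)) :
  mx_puiseux A -> mx_puiseux B -> mx_puiseux (fun z => A z - B z).
Proof.
move=> hA hB i j; apply: px_near (pxB (hA i j) (hB i j)).
by apply: filterE => z; rewrite !mxE.
Qed.

Lemma px_det p (A : C -> 'M[C]_p) : mx_puiseux A -> puiseux (fun z => \det (A z)).
Proof.
move=> hA; apply: px_sum => s; apply: pxM (px_cst _) _.
by apply: px_prod => i; exact: hA.
Qed.

Lemma mx_pxV p (A : C -> 'M[C]_p) : F (fun z => A z \in unitmx) ->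
  mx_puiseux A -> mx_puiseux (fun z => invmx (A z)).
Proof.
move=> uA hA i j.
have hdet : puiseux (fun z => (\det (A z))^-1).
  by apply: pxV (px_det hA); apply: filterS uA => z; rewrite unitmxE unitfE.
have hcof : puiseux (fun z => cofactor (A z) j i).
  apply: pxM (px_cst _) _; apply: px_det => k l.
  by apply: px_near (hA _ _); apply: filterE => z; rewrite !mxE.
apply: px_near (pxM hdet hcof); apply: filterS uA => z uz.
by rewrite /invmx uz !mxE.
Qed.

Let leading f : analytic f -> F (fun z => f (tau z) = 0) \/
  exists K (d : C) (f1 : C -> C), [/\ d != 0, clim F f1 d &
    F (fun z => f (tau z) = tau z ^+ K * f1 z)].
Proof.
move=> hf; have [r r0 H] := ana_leading_term hf.
have near r' : 0 < r' -> F (fun z => nrm (tau z) < r').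
  by move=> r'0; apply: filterS (tau0 r'0) => z; rewrite subr0.
case: H => [h|[K [d [M [d0 h]]]]].
  by left; apply: filterS (near r r0) => z /ltW; exact: h.
right; exists K, d, (fun z => if tau z == 0 then d else f (tau z) / tau z ^+ K).
split=> //; last first.
  apply: filterS (near r r0) => z /ltW zr; case: eqVneq => [t0|t0]; last first.
    by rewrite mulrC divfK// expf_neq0.
  have := h _ zr; rewrite t0 nrm0 exprS mul0r mulr0 => h0.
  have /eqP : nrm (f 0 - d * 0 ^+ K) = 0 by apply/eqP; rewrite eq_le h0 nrm_ge0.
  by rewrite nrm_eq0 subr_eq0 mulrC => /eqP.
move=> e e0; have M1 : 0 < e / (`|M| + 1) by rewrite divr_gt0// ltr_wpDl.
apply: filterS2 (near r r0) (near _ M1) => z /ltW zr zM.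
case: eqVneq => [t0|t0]; first by rewrite subrr nrm0.
have tK : 0 < nrm (tau z) ^+ K by rewrite exprn_gt0// nrm_gt0.
have := h _ zr; rewrite exprS mulrA -ler_pdivrMr//.
have -> : f (tau z) / tau z ^+ K - d = (f (tau z) - d * tau z ^+ K) / tau z ^+ K.
  by rewrite mulrBl mulfK// expf_neq0.
rewrite nrmM nrmV nrmX => /le_lt_trans; apply.
move: zM; rewrite ltr_pdivlMr ?ltr_wpDl// mulrC; apply: le_lt_trans.
by rewrite ler_wpM2r ?nrm_ge0// (le_trans (ler_norm _))// lerDl.
Qed.

(** Numerator and denominator behave like monomials in [tau], so the two
    exponents decide between a finite and an infinite limit.  A denominator
    vanishing identically is excluded because the filter is proper. *)
Lemma puiseux_dichotomy f : puiseux f ->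
  (exists l, clim F f l) \/ forall M : R, F (fun z => M < nrm (f z)).
Proof.
move=> [N [D [hN hD h]]].
have [D0|[K [d [D1 [d0 hd hD1]]]]] := leading hD.
  have : F set0 by apply: filterS2 D0 h => z -> [] /eqP.
  by move=> /filter_ex[].
have [N0|[L [n [N1 [n0 hn hN1]]]]] := leading hN.
  left; exists 0; apply: (@clim_near _ _ F _ (fun=> 0)); last exact: clim_cst.
  by apply: filterS2 N0 h => z -> [_ ->]; rewrite mul0r.
have fact : F (fun z => [/\ tau z ^+ K * D1 z != 0 &
    f z = (tau z ^+ L * N1 z) / (tau z ^+ K * D1 z)]).
  by apply: filterS3 h hD1 hN1 => z [Dz ->] <- <-.
have [KL|LK] := leqP K L.
  left; exists (0 ^+ (L - K) * (n / d)).
  apply: (@clim_near _ _ F _ (fun z => tau z ^+ (L - K) * (N1 z / D1 z))).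
    apply: filterS fact => z [nz ->]; move: nz; rewrite mulf_eq0 negb_or => /andP[t0 D10].
    rewrite -{2}(subnK KL) exprD; move: (_ ^+ (L - K)) (_ ^+ K) t0 => x y y0.
    by field; rewrite y0 D10.
  by apply: climM; [exact: climX|apply: climM => //; exact: climV].
right=> M; have inv0 : clim F (fun z => tau z ^+ (K - L) * (D1 z / N1 z)) 0.
  have -> : 0 = 0 ^+ (K - L) * (d / n) :> C.
    by rewrite expr0n subn_eq0 leqNgt LK mul0r.
  by apply: climM; [exact: climX|apply: climM => //; exact: climV].
have M1 : 0 < (`|M| + 1)^-1 by rewrite invr_gt0 ltr_wpDl.
have n2 : 0 < nrm n by rewrite nrm_gt0.
apply: filterS3 (inv0 _ M1) fact (hn _ n2) => z; rewrite subr0 => small [nz ->] hz.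
have N10 : N1 z != 0 by apply/eqP => N0; move: hz; rewrite N0 sub0r nrmN ltxx.
move: nz; rewrite mulf_eq0 negb_or => /andP[tK D10].
have t0 : tau z != 0.
  by apply: contra tK => /eqP ->; rewrite expr0n gtn_eqF ?(leq_ltn_trans _ LK).
have E : tau z ^+ L * N1 z / (tau z ^+ K * D1 z)
    = (tau z ^+ (K - L) * (D1 z / N1 z))^-1.
  have tKL : tau z ^+ (K - L) != 0 by rewrite expf_neq0.
  have tL : tau z ^+ L != 0 by rewrite expf_neq0.
  rewrite -{1}(subnK (ltnW LK)) exprD; move: (_ ^+ (K - L)) (_ ^+ L) tKL tL.
  by move=> x y x0 y0; field; rewrite N10 D10 x0 y0.
rewrite E nrmV; apply: (@lt_trans _ _ (`|M| + 1)).
  by apply: le_lt_trans (ler_norm _) _; rewrite ltrDl.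
rewrite -[X in X < _]invrK ltf_pV2// posrE// nrm_gt0.
by rewrite !mulf_neq0 ?invr_eq0// expf_neq0.
Qed.

End Meromorphic.

(** * The spectral variables near a point of the closed disk *)

Section SpectralVariables.
Variable R : realType.
Local Notation C := (Cplx R).
Variables (A : countType) (m n : nat) (S : system R A m n).
Hypothesis hS : admissible S.
Variable theta : 'I_m -> C -> C.
Hypothesis htheta : spectral_map S theta.

Lemma disk_nrm : closed_disk = [set u : C | nrm u <= 1].
Proof. by apply/funext => u; rewrite /closed_disk /= norm_le1. Qed.

Lemma theta_lim c w : nrm w <= 1 ->
  clim (within [set u : C | nrm u <= 1] (nbhs w)) (theta c) (theta c w).
Proof.
move=> w1; have [_ _ /(_ c)] := htheta; rewrite disk_nrm.
by move/subspace_continuousP => /(_ w w1)/climP.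
Qed.

Definition punctured (w : C) : set_system C :=
  within [set z : C | nrm z <= 1 /\ z != w] (nbhs w).

Lemma near_inside (w : C) (d : R) : 0 < d -> 0 < nrm w <= 1 ->
  exists z : C, [/\ 0 < nrm z < 1, z != w & nrm (z - w) < d].
Proof.
move=> d0 /andP[w0 w1]; pose eta := Order.min (d / 2) 2^-1.
have eta0 : 0 < eta by rewrite lt_min divr_gt0// invr_gt0 ltr0n.
have eta1 : eta <= 2^-1 by rewrite ge_min lexx orbT.
have etad : eta <= d / 2 by rewrite ge_min lexx.
have e1 : 0 < 1 - eta by lra.
exists (toC (1 - eta) * w); split.
- by rewrite nrmM nrm_toC gtr0_norm// mulr_gt0//=; nra.
- rewrite -subr_eq0 -{2}(mul1r w) -mulrBl mulf_eq0 -nrm_eq0 -toC1 -toCB nrm_toC.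
  by rewrite normr_eq0 -(nrm_eq0 w) (gt_eqF w0) orbF lt_eqF//; lra.
rewrite -{2}(mul1r w) -mulrBl nrmM -toC1 -toCB nrm_toC.
by rewrite ltr0_norm; nra.
Qed.

Lemma punctured_proper w : 0 < nrm w <= 1 -> ProperFilter (punctured w).
Proof.
move=> w01; apply: Build_ProperFilter_ex => P /nbhsCP[d d0 hd].
have [z [/andP[_ z1] zw zd]] := near_inside d0 w01.
by exists z; apply: hd => //; split=> //; exact: ltW.
Qed.

(** The relation [W_ch \o theta = lambda] is a polynomial one, so it extends
    by continuity from the open disk to the circle. *)
Lemma theta_boundary c w : 0 < nrm w <= 1 ->
  0 < nrm (theta c w) <= 1 /\ W_ch S c (theta c w) = lambda S w.
Proof.
move=> w01; have /andP[w0 w1] := w01; rewrite nrm_gt0 in w0.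
pose I := within [set z : C | 0 < nrm z < 1] (nbhs w).
have IF : ProperFilter I.
  apply: Build_ProperFilter_ex => P /nbhsCP[d d0 hd].
  by have [z [z01 _ zd]] := near_inside d0 w01; exists z; exact: hd.
have idI : clim I id w.
  by move=> e e0; apply/nbhsCP; exists e.
have thI : clim I (theta c) (theta c w).
  move=> e e0; have /nbhsCP[d d0 hd] := theta_lim c w1 e0; apply/nbhsCP.
  by exists d => // z zd /andP[_ z1]; apply: hd => //; exact: ltW.
have inv z : 0 < nrm z < 1 -> 0 < nrm (theta c z) < 1 /\ W_ch S c (theta c z) = lambda S z.
  move=> z01; have [|h1 h2] := theta_inv htheta c (w := z).
    by rewrite norm_lt1 normr_gt0 -nrm_gt0.
  by move: h1; rewrite norm_lt1 normr_gt0 -nrm_gt0.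
have b0 : toC (b_ch S c) != 0 by rewrite toC_eq0 gt_eqF// b_ch_gt0.
pose rel z t : C := (toC (a_ch S c) * t - toC (b_ch S c) * (t ^+ 2 + 1)) * z
   - (toC (a_tot S) * z - toC (b_tot S) * (z ^+ 2 + 1)) * t.
have relE z t : z != 0 -> t != 0 ->
    rel z t = z * t * (W_ch S c t - lambda S z).
  by move=> z0 t0; rewrite /rel /W_ch /lambda /zhukovsky; field; rewrite z0.
have relw : rel w (theta c w) = 0.
  apply: (@clim_unique _ _ I _ (fun z => rel z (theta c z))).
    have cI (x : C) : clim I (fun=> x) x by exact: clim_cst.
    have quad (f : C -> C) (l : C) : clim I f l -> clim I (fun z => f z ^+ 2 + 1) (l ^+ 2 + 1).
      by move=> fl; apply: climD; [exact: climX|exact: cI].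
    apply: climB.
      apply: climM; last exact: idI.
      apply: climB; first by apply: climM; [exact: cI|exact: thI].
      by apply: climM; [exact: cI|exact: quad].
    apply: climM; last exact: thI.
    apply: climB; first by apply: climM; [exact: cI|exact: idI].
    by apply: climM; [exact: cI|exact: (quad id)].
  apply: (@clim_near _ _ I _ (fun=> 0)); last exact: clim_cst.
  apply/nbhsCP; exists 1 => // z _ z01; have [/andP[t0 _] h] := inv z z01.
  have /andP[z0 _] := z01; rewrite !nrm_gt0 in t0 z0.
  by rewrite relE// h subrr mulr0.
have t0 : theta c w != 0.
  apply/eqP => h; have : rel w 0 = - toC (b_ch S c) * w by rewrite /rel; ring.
  by rewrite -h relw => /esym/eqP; rewrite mulf_eq0 oppr_eq0 (negbTE b0) (negbTE w0).
split; last first.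
  move: relw; rewrite relE// => /eqP; rewrite !mulf_eq0 (negbTE w0) (negbTE t0) /=.
  by rewrite subr_eq0 => /eqP.
rewrite nrm_gt0 t0 /= leNgt; apply/negP => gt1.
have e0 : 0 < nrm (theta c w) - 1 by rewrite subr_gt0.
have : I (fun=> False).
  have := thI _ e0; apply: filterS2 _ (_ : I [set z | 0 < nrm z < 1]).
    move=> z z01; have [/andP[_ tz] _] := inv z z01.
    have := nrm_le_dist (theta c w) (theta c z); rewrite nrmBC => /= h1 h2; lra.
  by apply/nbhsCP; exists 1.
by move=> /filter_ex[].
Qed.

Lemma theta_neq0 c w : 0 < nrm w <= 1 -> theta c w != 0.
Proof. by move=> /(theta_boundary c)[/andP[]]; rewrite nrm_gt0. Qed.

Lemma theta_le1 c w : nrm w <= 1 -> nrm (theta c w) <= 1.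
Proof.
move=> w1; have [->|w0] := eqVneq w 0; first by rewrite (theta0 htheta) nrm0.
by have [|/andP[]] := @theta_boundary c w; rewrite // nrm_gt0 w0.
Qed.

Lemma b_tot_gt0 (c : 'I_m) : 0 < b_tot S.
Proof.
have := bands_union hS; have b0 := b_ch_gt0 hS c.
pose a := a_ch S c; pose b := b_ch S c => h.
have sub x : a - 2 * b <= x <= a + 2 * b ->
    a_tot S - 2 * b_tot S <= x <= a_tot S + 2 * b_tot S.
  move=> hx; suff : `[a_tot S - 2 * b_tot S, a_tot S + 2 * b_tot S]%classic x.
    by rewrite /= in_itv.
  by rewrite -h; exists c => //=; rewrite in_itv.
have := sub (a - 2 * b); have := sub (a + 2 * b).
by rewrite !lexx /= /b; lra.
Qed.

(** Near any point [w] of the punctured closed disk all the [theta c] are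
    holomorphic functions of one uniformizer [tau] with [tau ^+ 2 = z - w].
    Indeed [z * (theta^-1 - theta)] squares to a polynomial [q] in [z]; taking
    out of [q] the even power [(z - w) ^+ j = tau ^+ (2 * j)] leaves a
    holomorphic square root, and the choice of sign is locally constant. *)
Lemma theta_uniformized w : 0 < nrm w <= 1 -> exists tau : C -> C,
  [/\ forall z, tau z ^+ 2 = z - w, clim (punctured w) tau 0 &
    forall c, exists phi : C -> C, [/\ analytic phi, nrm (phi 0) <= 1 &
      punctured w (fun z => theta c z = phi (tau z))]].
Proof.
move=> w01; have /andP[w0 w1] := w01; rewrite nrm_gt0 in w0.
have PF := punctured_proper w01.
have [tau [tau2 tauc]] := uniformizer w; exists tau.
have tau0 : clim (punctured w) tau 0.
  move=> e e0; apply/nbhsCP; exists (e ^+ 2); first by rewrite exprn_gt0.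
  move=> z; rewrite -tau2 subr0 nrmX => h _.
  by rewrite -(@ltr_pXn2r _ 2)// ?nnegrE ?nrm_ge0// ltW.
split=> // c; have b0 : toC (b_ch S c) != 0 by rewrite toC_eq0 gt_eqF// b_ch_gt0.
have bt0 : toC (b_tot S) != 0 by rewrite toC_eq0 gt_eqF// (b_tot_gt0 c).
pose k1 := toC (a_ch S c - a_tot S) / toC (b_ch S c).
pose k2 := toC (b_tot S) / toC (b_ch S c).
pose zeta : {poly C} := k1 *: 'X + k2 *: ('X^2 + 1).
pose q : {poly C} := zeta ^+ 2 - 4 *: 'X^2.
have zetaE z : zeta.[z] = k1 * z + k2 * (z ^+ 2 + 1).
  by rewrite /zeta !hornerE.
have zetaT z : 0 < nrm z <= 1 -> zeta.[z] = z * (theta c z + (theta c z)^-1).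
  move=> z01; have t0 := theta_neq0 c z01; have [_] := theta_boundary c z01.
  have z0 : z != 0 by rewrite -nrm_gt0; case/andP: z01.
  rewrite zetaE /k1 /k2 /W_ch /lambda /zhukovsky => h.
  have -> : theta c z + (theta c z)^-1
     = (toC (a_ch S c) - (toC (a_tot S) - toC (b_tot S) * (z + z^-1))) / toC (b_ch S c).
    by rewrite -h; field; rewrite t0 b0.
  by rewrite toCB; field; rewrite b0 z0.
(* [f] is [z] times the square root of [zeta ^+ 2 - 4] selected by [theta],
   and [theta] is recovered from [f] as a root of a quadratic equation. *)
pose f z := z * ((theta c z)^-1 - theta c z).
have f2 z : 0 < nrm z <= 1 -> f z ^+ 2 = q.[z].
  move=> z01; rewrite /q hornerD hornerN hornerZ hornerXn horner_exp zetaT//.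
  by rewrite /f; field; exact: theta_neq0.
have q0 : q != 0.
  apply/eqP => qz; have : q.[0] = k2 ^+ 2.
    by rewrite /q hornerD hornerN hornerZ hornerXn horner_exp zetaE; ring.
  rewrite qz horner0 => /esym/eqP; rewrite expf_eq0 /= mulf_eq0 invr_eq0.
  by rewrite (negbTE b0) (negbTE bt0).
have [j [Q /implyP/(_ q0) Qw Eq]] := multiplicity_XsubC q w.
rewrite /root in Qw.
have qE z : q.[z] = Q.[z] * (z - w) ^+ j.
  by rewrite Eq hornerM horner_exp hornerXsubC.
(* A branch point has [theta ^+ 2 = 1], hence lies on the unit circle. *)
have jw : (0 < j)%N -> nrm w = 1.
  move=> j0; have : f w ^+ 2 = 0 by rewrite f2// qE subrr expr0n gtn_eqF// mulr0.
  move/eqP; rewrite expf_eq0 /= mulf_eq0 (negbTE w0) /= subr_eq0 => /eqP h.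
  apply/eqP; rewrite eq_le w1 leNgt /=; apply/negP => lt1.
  have [] := theta_inv htheta c (w := w).
    by rewrite norm_lt1 lt1 normr_gt0 w0.
  move=> /andP[t0]; rewrite norm_lt1 => tlt _; rewrite normr_gt0 in t0.
  have := congr1 (@nrm R) h; rewrite nrmV => h1.
  have : 1 < (nrm (theta c w))^-1 by rewrite invf_gt1// nrm_gt0.
  by rewrite h1; lra.
have [sg [sgA [r [r0 sgE]]]] : exists sg : C -> C, analytic sg /\
    exists r : R, 0 < r /\ forall t, nrm t <= r -> sg t ^+ 2 = Q.[w + t].
  have [||sg sgA [r r0 h]] := @ana_sqrt R (fun t => Q.[w + t]).
  - by apply: ana_horner; apply: anaD; [exact: ana_cst|exact: ana_id].
  - by rewrite addr0.
  by exists sg; split=> //; exists r.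
have [r1 r1_0 sgc] := ana_continuous sgA.
have [r2 r2_0 Q0] : exists2 r2 : R, 0 < r2 & forall z, nrm (z - w) < r2 -> Q.[z] != 0.
  have e0 : 0 < nrm Q.[w] by rewrite nrm_gt0.
  have [d d0 hd] := horner_continuousC Q w e0; exists d => // z /hd.
  by apply: contraTneq => ->; rewrite sub0r nrmN ltxx.
pose d := Order.min (Order.min r r1) (Order.min r2 (nrm w)).
have d0 : 0 < d by rewrite !lt_min r0 r1_0 r2_0 nrm_gt0 w0.
have dP z : nrm (z - w) < d ->
    [/\ nrm (z - w) <= r, nrm (z - w) < r1, nrm (z - w) < r2 & z != 0].
  rewrite !lt_min => /andP[/andP[h1 h2] /andP[h3 h4]]; split=> //; first exact: ltW.
  by apply: contraTneq h4 => ->; rewrite sub0r nrmN ltxx.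
(* The point [w] is removed only when it is a zero of [q]; it is then an
   extreme point of the disk, so that the set remains convex. *)
pose D := [set z : C | [/\ nrm z <= 1, nrm (z - w) < d & (0 < j)%N -> z != w]].
pose g z := tau z ^+ j * sg (z - w).
have Dcl (z : C) (P : set C) : within [set u : C | nrm u <= 1] (nbhs z) P -> within D (nbhs z) P.
  by rewrite /within /= => /nbhsCP[e e0 he]; apply/nbhsCP; exists e => // u ue [u1 _ _]; exact: he.
have [s s1 fE] : exists2 s : C, s ^+ 2 = 1 & forall z, D z -> f z = s * g z.
  apply: sqrt_sign.
  - move=> x y t [x1 xd xw] [y1 yd yw] /andP[t0 t1].
    have conv (u v : C) (e : R) : nrm u <= e -> nrm v <= e ->
        nrm (segment u v t) <= e.
      move=> ue ve; have -> : segment u v t = toC (1 - t) * u + toC t * v.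
        by rewrite /segment toCB toC1; ring.
      apply: le_trans (nrmD _ _) _; rewrite !nrmM !nrm_toC !ger0_norm ?subr_ge0//.
      nra.
    have segB : segment x y t - w = segment (x - w) (y - w) t.
      by rewrite /segment; ring.
    split; first exact: conv.
      rewrite segB; apply: (@le_lt_trans _ _ (Order.max (nrm (x - w)) (nrm (y - w)))).
        by apply: conv; rewrite le_max lexx ?orbT.
      by rewrite gt_max xd.
    move=> j0; have wn := jw j0; have {}xw := xw j0; have {}yw := yw j0.
    have lt (u : C) : nrm u <= 1 -> u != w -> complex.Re (u / w) < 1.
      move=> u1 uw; apply: Re_lt1; first by rewrite nrmM nrmV wn invr1 mulr1.
      by apply: contra uw => /eqP h; rewrite -[u](divfK w0) h mul1r.
    apply/eqP => h; have : complex.Re (segment (x / w) (y / w) t) = 1.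
      have -> : segment (x / w) (y / w) t = segment x y t / w.
        by rewrite /segment; ring.
      by rewrite h divff.
    have := lt x x1 xw; have := lt y y1 yw; rewrite /segment /toC.
    case: (x / w) => x' x''; case: (y / w) => y' y'' /=.
    rewrite mul0r subr0 => hy hx e1; have t1' : 0 <= 1 - t by rewrite subr_ge0.
    have ax : 0 <= (1 - t) * (1 - x') by rewrite mulr_ge0// subr_ge0 ltW.
    have [tp|tn] := ltP 0 t; last by have t_0 : t = 0 by [lra]; move: e1; rewrite t_0; lra.
    have : 0 < t * (1 - y') by rewrite mulr_gt0// subr_gt0.
    lra.
  - move=> z [z1 zd _]; have wf : Filter (within D (nbhs z)) by exact: within_filter.
    have z01 : 0 < nrm z <= 1 by rewrite nrm_gt0 z1; have [_ _ _ ->] := dP z zd.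
    have tc : clim (within D (nbhs z)) (theta c) (theta c z).
      by move=> e e0; apply: Dcl; exact: theta_lim.
    apply: climM; first by move=> e e0; apply/nbhsCP; exists e.
    by apply: climB => //; apply: climV => //; exact: theta_neq0.
  - move=> z [z1 zd zw]; have wf : Filter (within D (nbhs z)) by exact: within_filter.
    have [_ zr1 _ _] := dP z zd; apply: climM.
      have [j0|j0] := posnP j; first by rewrite j0; exact: clim_cst.
      apply: climX => e e0; apply: Dcl; apply: tauc => //; [exact: jw|exact: zw].
    move=> e e0; have /nbhsCP[e1 e1_0 he] := sgc _ zr1 e e0.
    apply/nbhsCP; exists e1 => // u uz _; apply: he.
    by rewrite opprB addrA subrK.
  - move=> z Dz; have [z1 zd zw] := Dz; have [zr _ zr2 z0] := dP z zd.
    have z01 : 0 < nrm z <= 1 by rewrite nrm_gt0 z0.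
    rewrite -sqrf_eq0 exprMn sgE// [w + _]addrC subrK -exprM mulnC exprM tau2.
    rewrite mulf_neq0 ?Q0//; have [->|j0] := posnP j; first exact: oner_neq0.
    by rewrite expf_neq0// subr_eq0 zw.
  - move=> z [z1 zd zw]; have [zr _ _ z0] := dP z zd.
    rewrite f2 ?nrm_gt0 ?z0// qE exprMn sgE// [w + _]addrC subrK -exprM mulnC exprM tau2.
    by rewrite mulrC.
have sgA2 : analytic (fun t => sg (t ^+ 2)).
  have [r3 r3_0 sgP] := sgA; apply: (ana_comp sgP (anaX 2 (@ana_id R))).
  by rewrite expr0n nrm0.
pose phi t := (zeta.[w + t ^+ 2] - s * (t ^+ j * sg (t ^+ 2))) / (2 * (w + t ^+ 2)).
have wA : analytic (fun t : C => w + t ^+ 2).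
  by apply: anaD (ana_cst _) _; apply: anaX; exact: ana_id.
have phiA : analytic phi.
  apply: anaM.
    apply: anaB; first exact: ana_horner.
    apply: anaM (ana_cst _) _; apply: anaM => //; apply: anaX; exact: ana_id.
  apply: ana_inv; first exact: anaM (ana_cst _) wA.
  by rewrite expr0n /= addr0 mulf_neq0// pnatr_eq0.
have phiE : punctured w (fun z => theta c z = phi (tau z)).
  apply/nbhsCP; exists d => // z zd [z1 zw].
  have Dz : D z by [].
  have [_ _ _ z0] := dP z zd; have z01 : 0 < nrm z <= 1 by rewrite nrm_gt0 z0.
  have t0 := theta_neq0 c z01.
  rewrite /phi tau2 [w + _]addrC subrK -/(g z) -fE// zetaT// /f.
  by field; rewrite z0 t0.
exists phi; split=> //.
have -> : phi 0 = theta c w; last by apply: theta_le1.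
apply: (@clim_unique _ _ (punctured w) _ (theta c)).
  apply: (@clim_near _ _ (punctured w) _ (phi \o tau)).
    by apply: filterS phiE => z.
  have [r3 r3_0 phic] := ana_continuous phiA; move=> e e0.
  have := phic 0; rewrite nrm0 => /(_ r3_0 e e0)/nbhsCP[e1 e1_0 he].
  by apply: filterS (tau0 e1 e1_0) => z; exact: he.
move=> e e0; have /nbhsCP[e1 e1_0 he] := theta_lim c w1 e0; apply/nbhsCP.
by exists e1 => // z zd [z1 _]; exact: he.
Qed.

End SpectralVariables.

(** * Limits and inverses of matrices *)

Section MatrixLimits.
Variable R : realType.
Local Notation C := (Cplx R).
Variables (T : Type) (F : set_system T) (FF : Filter F).

Definition mxclim p q (A : T -> 'M[C]_(p, q)) (A0 : 'M[C]_(p, q)) : Prop :=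
  forall i j, clim F (fun z => A z i j) (A0 i j).

Lemma clim_ext (f g : T -> C) l : f =1 g -> clim F f l -> clim F g l.
Proof. by move=> fg; rewrite (funext fg). Qed.

Lemma mxclim_cst p q (A : 'M[C]_(p, q)) : mxclim (fun=> A) A.
Proof. by move=> i j; exact: clim_cst. Qed.

Lemma mxclimM p q s (A : T -> 'M[C]_(p, q)) (B : T -> 'M[C]_(q, s)) A0 B0 :
  mxclim A A0 -> mxclim B B0 -> mxclim (fun z => A z *m B z) (A0 *m B0).
Proof.
move=> hA hB i j; rewrite mxE.
apply: (@clim_ext (fun z => \sum_k A z i k * B z k j)) => [z|]; first by rewrite mxE.
by apply: clim_sum => k _; exact: climM.
Qed.

Lemma mxclimB p q (A B : T -> 'M[C]_(p, q)) A0 B0 :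
  mxclim A A0 -> mxclim B B0 -> mxclim (fun z => A z - B z) (A0 - B0).
Proof.
move=> hA hB i j; rewrite !mxE.
apply: (@clim_ext (fun z => A z i j - B z i j)) => [z|]; first by rewrite !mxE.
exact: climB.
Qed.

Lemma mxclim_diag p (d : T -> 'I_p -> C) (d0 : 'I_p -> C) :
  (forall i, clim F (d^~ i) (d0 i)) ->
  mxclim (fun z => diag_mx (\row_i d z i)) (diag_mx (\row_i d0 i)).
Proof.
move=> hd i j; rewrite !mxE; have [<-|ij] := eqVneq i j.
  by apply: clim_ext (hd i) => z; rewrite !mxE eqxx mulr1n.
by apply: clim_ext (clim_cst _ 0) => z; rewrite !mxE (negbTE ij) mulr0n.
Qed.

Lemma clim_det p (A : T -> 'M[C]_p) A0 :
  mxclim A A0 -> clim F (fun z => \det (A z)) (\det A0).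
Proof.
move=> hA; apply: clim_sum => s _; apply: climM; first exact: clim_cst.
by apply: clim_prod => i _; exact: hA.
Qed.

Lemma clim_neq0 (f : T -> C) l : l != 0 -> clim F f l -> F (fun z => f z != 0).
Proof.
rewrite -nrm_gt0 => l0 fl; apply: filterS (fl _ l0) => z.
by apply: contraTneq => ->; rewrite sub0r nrmN ltxx.
Qed.

Lemma clim_unitmx p (A : T -> 'M[C]_p) A0 : A0 \in unitmx -> mxclim A A0 ->
  F (fun z => A z \in unitmx).
Proof.
rewrite unitmxE unitfE => u0 /clim_det hA.
by apply: filterS (clim_neq0 u0 hA) => z; rewrite unitmxE unitfE.
Qed.

Lemma mxclimV p (A : T -> 'M[C]_p) A0 : A0 \in unitmx -> mxclim A A0 ->
  mxclim (fun z => invmx (A z)) (invmx A0).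
Proof.
move=> u0 hA i j; have uA := clim_unitmx u0 hA.
have -> : invmx A0 i j = (\det A0)^-1 * cofactor A0 j i by rewrite /invmx u0 !mxE.
have d0 : \det A0 != 0 by move: u0; rewrite unitmxE unitfE.
apply: (@clim_near _ _ F _ (fun z => (\det (A z))^-1 * cofactor (A z) j i)).
  by apply: filterS uA => z uz; rewrite /invmx uz !mxE.
apply: climM; first by apply: climV => //; exact: clim_det.
apply: climM; first exact: clim_cst.
apply: clim_det => k l; rewrite !mxE.
by apply: clim_ext (hA _ _) => z; rewrite !mxE.
Qed.

Lemma clim_comp (f : T -> C) (g : C -> C) (a : C) :
  clim (nbhs a) g (g a) -> clim F f a -> clim F (g \o f) (g a).
Proof.
move=> hg hf e e0; have /nbhsCP[d d0 hd] := hg e e0.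
by apply: filterS (hf d d0) => t; exact: hd.
Qed.

End MatrixLimits.

Section DiagonalMatrices.
Variables (K : fieldType) (p : nat).
Implicit Types (d : 'I_p -> K) (A : 'M[K]_p).

Lemma diag_unitmx d : (diag_mx (\row_i d i) \in unitmx) = [forall i, d i != 0].
Proof.
rewrite unitmxE det_diag unitfE; under eq_bigr do rewrite mxE.
apply/prodf_neq0/forallP => [h i|h i _]; [exact: h|exact: h].
Qed.

Lemma invmx_diag d : (forall i, d i != 0) ->
  invmx (diag_mx (\row_i d i)) = diag_mx (\row_i (d i)^-1).
Proof.
move=> d0; have u : diag_mx (\row_i d i) \in unitmx.
  by rewrite diag_unitmx; apply/forallP.
rewrite -[LHS]mulmx1; apply: (canLR (mulKmx u)).
apply/matrixP => i j; rewrite mul_diag_mx !mxE.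
case: (i == j); last by rewrite !mulr0n mulr0.
by rewrite !mulr1n mulfV.
Qed.

Lemma mul_diag_coef A d i j : (A *m diag_mx (\row_i d i)) i j = A i j * d j.
Proof. by rewrite mul_mx_diag !mxE. Qed.

Lemma diag_mul_coef A d i j : (diag_mx (\row_i d i) *m A) i j = d i * A i j.
Proof. by rewrite mul_diag_mx !mxE. Qed.

(** The matrix [(E - Rm G)^-1 G^-1] is the inverse of [G E - G Rm G], which is
    symmetric together with [Rm]. *)
Lemma resolvent_sym (E G : 'I_p -> K) (Rm : 'M[K]_p) (i j : 'I_p) :
  let T := diag_mx (\row_i E i) - Rm *m diag_mx (\row_i G i) in
  Rm^T = Rm -> T \in unitmx -> (forall i, G i != 0) ->
  invmx T i j / G j = invmx T j i / G i.
Proof.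
move=> T symR uT G0; pose Gm := diag_mx (\row_i G i).
have uG : Gm \in unitmx by rewrite diag_unitmx; apply/forallP.
pose Q := invmx T *m invmx Gm.
have QE k l : Q k l = invmx T k l / G l.
  by rewrite /Q invmx_diag// mul_diag_coef.
rewrite -!QE -[in RHS](trmxK Q) [RHS]mxE; congr (_ _ i j).
have QI : Q = invmx (Gm *m T).
  have uGT : Gm *m T \in unitmx by rewrite unitmx_mul uG.
  rewrite -[Q](mulmxK uGT) (_ : Q *m _ = 1%:M) ?mul1mx//.
  by rewrite /Q -mulmxA (mulKmx uG) mulVmx.
have sym : (Gm *m T)^T = Gm *m T.
  rewrite /T !trmx_mul raddfB /= trmx_mul !tr_diag_mx symR mulmxBl mulmxBr.
  by rewrite diag_mx_comm !mulmxA.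
by rewrite QI trmx_inv sym.
Qed.

(** Since [G] and [E] commute, [(E - Rm G)^-1 G^-1 = G^-1 X] for
    [X = (E - G Rm)^-1]; expanding [X] once around [E^-1] expresses its
    off-diagonal entries through those of [Rm X]. *)
Lemma resolvent_off (E G : 'I_p -> K) (Rm : 'M[K]_p) (i j : 'I_p) :
  let Em := diag_mx (\row_i E i) in let Gm := diag_mx (\row_i G i) in
  let T := Em - Rm *m Gm in let Y := Em - Gm *m Rm in
  T \in unitmx -> Y \in unitmx -> (forall i, E i != 0) -> (forall i, G i != 0) ->
  i != j ->
  invmx T i j / G j = (Rm *m invmx Y) i j / E i
  /\ invmx Y i j = G i / E i * (Rm *m invmx Y) i j.
Proof.
move=> Em Gm T Y uT uY E0 G0 ij; set X := invmx Y.
have GT : Gm *m T = Y *m Gm.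
  by rewrite /T /Y mulmxBr mulmxBl diag_mxC mulmxA.
have GQ : Gm *m invmx T = X *m Gm.
  by rewrite -[RHS](mulmxK uT) -[X *m Gm *m T]mulmxA GT /X (mulKmx uY).
have XE : Em *m X = 1%:M + Gm *m (Rm *m X).
  by rewrite mulmxA -(mulmxV uY) -mulmxDl subrK.
have h1 := congr1 (fun M : 'M[K]_p => M i j) GQ.
rewrite diag_mul_coef mul_diag_coef in h1.
have h2 := congr1 (fun M : 'M[K]_p => M i j) XE.
rewrite diag_mul_coef mxE diag_mul_coef mxE (negbTE ij) mulr0n add0r in h2.
have h3 : X i j = G i / E i * (Rm *m X) i j.
  by apply: (mulfI (E0 i)); rewrite h2 mulrA mulrCA mulfV ?mulr1.
split=> //; apply: (mulfI (G0 i)); rewrite mulrA h1 mulfK// h3.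
by rewrite mulrA mulrAC.
Qed.

End DiagonalMatrices.

(** * Scattering coefficients at regular points *)

Section Scattering.
Variable R : realType.
Local Notation C := (Cplx R).
Variables (A : countType) (m n : nat) (S : system R A m n).
Hypothesis hS : admissible S.
Variable theta : 'I_m -> C -> C.
Hypothesis htheta : spectral_map S theta.
Variables (e p : 'I_m -> nat -> C -> C).
Hypothesis he : jost_solution S e.
Hypothesis hp : p_solution S p.

Local Notation L1 := (L1mx S).
Local Notation T := (Tmx S theta e).
Local Notation reg := (regular S theta e).
Local Notation near_reg := (near_regular S theta e).
Local Notation Ufor := (Uformula S theta e p).

Definition jost_at c k z : C := e c k (theta c z).

(** The factor of [e c k] in the off-diagonal entry [(c, d)] of [Uformula]. *)
Definition scat c d z : C := invmx (T z) c d
  * (toC (b_ch S d) / toC (bcoef S d 0) * ((theta d z)^-1 - theta d z) / jost_at d 1 z).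

Lemma bcoef_neq0 c k : toC (bcoef S c k) != 0.
Proof. by rewrite toC_eq0; exact/lt0r_neq0/(bcoef_gt0 hS). Qed.

Lemma regular_disk z : reg z -> 0 < nrm z <= 1.
Proof. by case; rewrite /closed_disk /= norm_le1 => z1 z0 _ _ _; rewrite nrm_gt0 z0. Qed.

Lemma regular_jost1 c z : reg z -> jost_at c 1 z != 0.
Proof. by case=> _ _ _ _; rewrite diag_unitmx => /forallP/(_ c). Qed.

Lemma Uformula_coef k z c d : reg z ->
  Ufor k z c d = (- (p c k z *+ (c == d)) + jost_at c k z * invmx (T z) c d)
  * (toC (b_ch S d) / toC (bcoef S d 0) * ((theta d z)^-1 - theta d z) / jost_at d 1 z).
Proof.
move=> rz; rewrite /Uformula /Bmx /B0mx /Dmx.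
rewrite (invmx_diag (d := fun c => toC (bcoef S c 0))); last by move=> i; exact: bcoef_neq0.
rewrite (invmx_diag (d := fun c => jost_at c 1 z)); last by move=> i; exact: regular_jost1.
by rewrite !mul_diag_coef mxE diag_mul_coef !mxE !mulrA.
Qed.

Lemma Uformula_off k z c d : reg z -> c != d ->
  Ufor k z c d = jost_at c k z * scat c d z.
Proof.
by move=> rz cd; rewrite Uformula_coef// (negbTE cd) mulr0n oppr0 add0r /scat [RHS]mulrA.
Qed.

Lemma L1_sym : L1^T = L1.
Proof. by apply/matrixP => i j; rewrite !mxE (coupling_sym hS). Qed.

Lemma Rmx_sym z : (Rmx S z)^T = Rmx S z.
Proof.
apply/matrixP => i j; rewrite !mxE -[in RHS]L1_sym -(tr_scalar_mx _ z).
by rewrite -raddfB /= -trmx_inv mxE tr_scalar_mx.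
Qed.

Lemma T_resolvent z : T z = diag_mx (\row_c jost_at c 0 z)
  - Rmx S (lambda S z) *m diag_mx (\row_c (toC (bcoef S c 0) * jost_at c 1 z)).
Proof.
rewrite /Tmx /B0mx -mulmxA; congr (_ - _ *m _).
apply/matrixP => i j; rewrite diag_mul_coef !mxE; case: eqVneq => [->|].
  by rewrite !mulr1n.
by rewrite !mulr0n mulr0.
Qed.

(** The symmetry of the scattering coefficients comes from that of the
    resolvent of the finite matrix [L1]. *)
Lemma scat_symmetric c d z : reg z ->
  toC (b_ch S c) * ((theta c z)^-1 - theta c z) * scat c d z
  = toC (b_ch S d) * ((theta d z)^-1 - theta d z) * scat d c z.
Proof.
move=> rz; have [_ _ _ uT _] := rz; rewrite T_resolvent in uT.
have G0 i : toC (bcoef S i 0) * jost_at i 1 z != 0.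
  by rewrite mulf_neq0 ?bcoef_neq0 ?regular_jost1.
have := resolvent_sym c d (Rmx_sym _) uT G0; rewrite -T_resolvent /scat => h.
transitivity (toC (b_ch S c) * ((theta c z)^-1 - theta c z)
  * (toC (b_ch S d) * ((theta d z)^-1 - theta d z))
  * (invmx (T z) c d / (toC (bcoef S d 0) * jost_at d 1 z))).
  rewrite invfM; ring.
by rewrite h invfM; ring.
Qed.

Lemma jost_continuous c k t : nrm t <= 1 -> clim (nbhs t) (e c k) (e c k t).
Proof.
move=> t1; have [V [oV cV /(_ k) hV]] := jost_holo he c.
have Vt : V t by apply: cV; rewrite /closed_disk /= norm_le1.
by apply/climP; apply/differentiable_continuous/derivable1_diffP; exact: hV.
Qed.

(** These limits are taken along several filters at [w], all of them finer
    than the trace of the neighbourhoods of [w] on the closed disk. *)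
Section AtPoint.
Variables (w : C) (F : set_system C).
Hypotheses (FF : Filter F) (w1 : nrm w <= 1).
Hypothesis Fw : forall P, within [set u : C | nrm u <= 1] (nbhs w) P -> F P.

Lemma id_lim : clim F id w.
Proof. by move=> r r0; apply: Fw; apply/nbhsCP; exists r. Qed.

Lemma theta_limF c : clim F (theta c) (theta c w).
Proof. by move=> r r0; apply: Fw; exact: (theta_lim htheta c w1 r0). Qed.

Lemma jost_lim c k : clim F (jost_at c k) (jost_at c k w).
Proof.
have := clim_comp FF (jost_continuous c k (theta_le1 hS htheta c w1)) (theta_limF c).
exact.
Qed.

Hypothesis w0 : w != 0.

Lemma lambda_lim : clim F (lambda S) (lambda S w).
Proof.
apply: climB; first exact: clim_cst.
apply: climM; first exact: clim_cst.
by apply: climD; [exact: id_lim|apply: climV => //; exact: id_lim].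
Qed.

Lemma flux_lim c :
  clim F (fun z => (theta c z)^-1 - theta c z) ((theta c w)^-1 - theta c w).
Proof.
have t0 : theta c w != 0 by apply: (theta_neq0 hS htheta); rewrite nrm_gt0 w0.
by apply: climB; [apply: climV => //|]; exact: theta_limF.
Qed.

Lemma L1_lim : mxclim F (fun z => L1 - (lambda S z)%:M) (L1 - (lambda S w)%:M).
Proof.
apply: mxclimB; first exact: mxclim_cst.
move=> i j; rewrite !mxE.
apply: (clim_ext (f := fun z => lambda S z *+ (i == j))) => [z|]; first by rewrite !mxE.
by case: (i == j); [rewrite mulr1n; exact: lambda_lim|exact: clim_cst].
Qed.

Hypothesis rw : reg w.

Lemma T_lim : mxclim F T (T w).
Proof.
have [_ _ uL _ _] := rw.
apply: mxclimB; first by apply: mxclim_diag => i; exact: jost_lim.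
apply: mxclimM; last by apply: mxclim_diag => i; exact: jost_lim.
apply: mxclimM; last exact: mxclim_cst.
move=> i j; rewrite mxE.
apply: (clim_ext (f := fun z => invmx (L1 - (lambda S z)%:M) (attach S i) (attach S j))).
  by move=> z; rewrite mxE.
by apply: mxclimV => //; exact: L1_lim.
Qed.

Lemma weight_lim d :
  clim F (fun z => toC (b_ch S d) / toC (bcoef S d 0)
    * ((theta d z)^-1 - theta d z) / jost_at d 1 z)
  (toC (b_ch S d) / toC (bcoef S d 0) * ((theta d w)^-1 - theta d w) / jost_at d 1 w).
Proof.
apply: climM; last by apply: climV; [exact: regular_jost1|exact: jost_lim].
by apply: climM; [exact: clim_cst|exact: flux_lim].
Qed.

Lemma scat_lim c d : clim F (scat c d) (scat c d w).
Proof.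
have [_ _ _ uT _] := rw.
by apply: climM; [apply: mxclimV => //; exact: T_lim|exact: weight_lim].
Qed.

Lemma p_lim c k : clim F (p c k) (p c k w).
Proof.
have near : F (fun z => 0 < nrm z <= 1).
  apply: Fw; apply/nbhsCP; exists (nrm w); rewrite ?nrm_gt0// => z zw z1; rewrite z1 andbT.
  by rewrite nrm_gt0; apply: contraTneq zw => ->; rewrite sub0r nrmN ltxx.
have tonorm (z : C) : 0 < nrm z <= 1 -> 0 < `|z| <= 1.
  by rewrite norm_le1 normr_gt0 nrm_gt0.
have wn : 0 < `|w| <= 1 by apply: tonorm; rewrite nrm_gt0 w0.
have recur z j : 0 < `|z| <= 1 -> p c j.+2 z = (- toC (bcoef S c j) * p c j z
    + (toC (acoef S c j.+1) - lambda S z) * p c j.+1 z) / toC (bcoef S c j.+1).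
  move=> zn; have := p_eq hp c zn j => h.
  apply: (mulIf (bcoef_neq0 c j.+1)); rewrite divfK ?bcoef_neq0// mulrBl -h; ring.
suff : clim F (p c k) (p c k w) /\ clim F (p c k.+1) (p c k.+1 w) by case.
elim: k => [|k [IH1 IH2]].
  split.
    rewrite (p_init0 hp c wn).
    apply: (@clim_near _ _ F _ (fun=> 1)); last exact: clim_cst.
    by apply: filterS near => z zn; rewrite (p_init0 hp c (tonorm _ zn)).
  rewrite (p_init1 hp c wn).
  apply: (@clim_near _ _ F _ (fun=> 0)); last exact: clim_cst.
  by apply: filterS near => z zn; rewrite (p_init1 hp c (tonorm _ zn)).
split=> //; rewrite (recur w)//.
apply: (@clim_near _ _ F _ (fun z => (- toC (bcoef S c k) * p c k z
    + (toC (acoef S c k.+1) - lambda S z) * p c k.+1 z) / toC (bcoef S c k.+1))).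
  by apply: filterS near => z zn; rewrite recur//; exact: tonorm.
apply: climM; last exact: clim_cst.
apply: climD; first by apply: climM; [exact: clim_cst|exact: IH1].
by apply: climM; [apply: climB; [exact: clim_cst|exact: lambda_lim]|exact: IH2].
Qed.

Lemma near_is_regular : F reg.
Proof.
have [_ _ uL uT uE] := rw.
have near : F (fun z => nrm z <= 1) by apply: Fw; apply/nbhsCP; exists 1.
have near0 : F (fun z => z != 0) by exact: (clim_neq0 FF w0 id_lim).
have nearL := clim_unitmx FF uL L1_lim.
have nearT := clim_unitmx FF uT T_lim.
have nearE : F (fun z => Emx theta e 1 z \in unitmx).
  by apply: (clim_unitmx FF uE); apply: mxclim_diag => i; exact: jost_lim.
apply: filterS3 (filterI near near0) nearL (filterI nearT nearE) => z [z1 z0] uL' [uT' uE'].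
by split=> //; rewrite /closed_disk /= norm_le1.
Qed.

Lemma Uformula_lim k c d : clim F (fun z => Ufor k z c d) (Ufor k w c d).
Proof.
have [_ _ _ uT _] := rw; rewrite Uformula_coef//.
apply: (@clim_near _ _ F _ (fun z => (- (p c k z *+ (c == d))
  + jost_at c k z * invmx (T z) c d) * (toC (b_ch S d) / toC (bcoef S d 0)
    * ((theta d z)^-1 - theta d z) / jost_at d 1 z))).
  by apply: filterS near_is_regular => z rz; rewrite Uformula_coef.
apply: climM; last exact: weight_lim; apply: climD.
  apply: climN; case: (c == d); last exact: clim_cst.
  by apply: (clim_ext (f := p c k)); [move=> z; rewrite mulr1n|rewrite mulr1n; exact: p_lim].
by apply: climM; [exact: jost_lim|apply: mxclimV => //; exact: T_lim].
Qed.

End AtPoint.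

Lemma near_reg_disk w P : within [set u : C | nrm u <= 1] (nbhs w) P -> near_reg w P.
Proof.
rewrite /near_regular /within /= => h; apply: filterS h => z h rz; apply: h.
by have /andP[] := regular_disk rz.
Qed.

End Scattering.

(** * Behaviour at the origin *)

(** A constant, so that rewriting the number [0] in a limit leaves the filter
    alone. *)
Definition near_origin (R : realType) : set_system (Cplx R) := (0 : Cplx R)^'.

Section NearZero.
Variable R : realType.
Local Notation C := (Cplx R).
Variables (A : countType) (m n : nat) (S : system R A m n).
Hypothesis hS : admissible S.
Variable theta : 'I_m -> C -> C.
Hypothesis htheta : spectral_map S theta.
Variables (e : 'I_m -> nat -> C -> C).
Hypothesis he : jost_solution S e.
Variables (c d : 'I_m).
Hypothesis cd : c != d.

Local Notation L1 := (L1mx S).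
Local Notation T := (Tmx S theta e).
Local Notation reg := (regular S theta e).
Local Notation jost := (jost_at theta e).
Local Notation F := (@near_origin R).

Let FF : ProperFilter F. Proof. exact: Proper_dnbhs_numFieldType. Qed.

Let Fwithin (P : set C) : within [set u : C | nrm u <= 1] (nbhs 0) P -> F P.
Proof.
move=> /nbhsCP[r r0 hr]; apply/nbhsCP; exists (Order.min r 1).
  by rewrite lt_min r0 ltr01.
by move=> z; rewrite lt_min subr0 => /andP[zr z1] _; apply: hr; rewrite ?subr0//= ltW.
Qed.

Let near_punctured : F (fun z => 0 < nrm z <= 1).
Proof.
apply/nbhsCP; exists 1 => // z; rewrite subr0 => z1 z0.
by rewrite nrm_gt0 z0 ltW.
Qed.

Let n0 : nrm (0 : C) <= 1. Proof. by rewrite nrm0. Qed.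

Let idF : clim F id 0. Proof. exact: (id_lim Fwithin). Qed.

Let thetaF i : clim F (theta i) 0.
Proof. by have := theta_limF htheta n0 Fwithin i; rewrite (theta0 htheta). Qed.

Let E0 i : C := e i 0%N 0.

Let E0_neq0 i : E0 i != 0.
Proof.
have [rad [g [rad1 gP g0 eE]]] := jost_expansion hS i he.
by rewrite /E0 eE// expr0 mul1r.
Qed.

Let jost0F i : clim F (jost i 0) (E0 i).
Proof.
have := jost_lim hS htheta he FF n0 Fwithin i 0.
by rewrite /jost_at (theta0 htheta).
Qed.

Let jost1F i : clim F (jost i 1) 0.
Proof.
have [rad [g [rad1 gP g0 eE]]] := jost_expansion hS i he.
have := jost_lim hS htheta he FF n0 Fwithin i 1.
by rewrite /jost_at (theta0 htheta) eE// expr1 mul0r.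
Qed.

Let jost1_neq0 i : F (fun z => jost i 1 z != 0).
Proof.
have [rad [g [rad1 gP g0 eE]]] := jost_expansion hS i he.
have gF : clim F (g 1%N \o theta i) (g 1%N 0).
  apply: (clim_comp FF _ (thetaF i)).
  by apply: pl_continuous (gP 1%N); rewrite nrm0 (lt_trans ltr01).
apply: filterS2 near_punctured (clim_neq0 FF (g0 1%N) gF) => z z01 gz.
have /andP[z0 z1] := z01.
rewrite /jost_at eE ?(theta_le1 hS htheta)// expr1 mulf_neq0//.
exact: (theta_neq0 hS htheta).
Qed.

Let mu (z : C) : C := (lambda S z)^-1.

Let btot0 : toC (b_tot S) != 0.
Proof. by rewrite toC_eq0; exact/lt0r_neq0/(b_tot_gt0 hS c). Qed.

Let bch0 i : toC (b_ch S i) != 0.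
Proof. by rewrite toC_eq0; exact/lt0r_neq0/(b_ch_gt0 hS). Qed.

(** Clears the simple pole that [lambda] has at the origin, as a function of
    [z] and as a function of every [theta c]. *)
Let pole (a b t : C) : t != 0 ->
  t * (a - b * (t + t^-1)) = a * t - b * (t ^+ 2 + 1).
Proof. by move=> t0; field. Qed.

Let poleF (a b : C) (f : C -> C) : clim F f 0 ->
  clim F (fun z => a * f z - b * (f z ^+ 2 + 1)) (- b).
Proof.
move=> f0; have -> : - b = a * 0 - b * (0 ^+ 2 + 1) by ring.
apply: climB; first by apply: climM => //; exact: clim_cst.
apply: climM; first exact: clim_cst.
by apply: climD; [exact: climX|exact: clim_cst].
Qed.

Let zlambdaF : clim F (fun z => z * lambda S z) (- toC (b_tot S)).
Proof.
apply: (clim_near FF _ (poleF (toC (a_tot S)) (toC (b_tot S)) idF)).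
apply: filterS near_punctured => z /andP[z0 _].
by rewrite /lambda /zhukovsky pole// -nrm_gt0.
Qed.

Let thetalambdaF i : clim F (fun z => theta i z * lambda S z) (- toC (b_ch S i)).
Proof.
apply: (clim_near FF _ (poleF (toC (a_ch S i)) (toC (b_ch S i)) (thetaF i))).
apply: filterS near_punctured => z z01.
have [_ <-] := theta_boundary hS htheta i z01.
by rewrite /W_ch /zhukovsky pole//; exact: (theta_neq0 hS htheta).
Qed.

Let lambda_neq0 : F (fun z => lambda S z != 0).
Proof.
have nb : - toC (b_tot S) != 0 by rewrite oppr_eq0.
apply: filterS (clim_neq0 FF nb zlambdaF) => z.
by apply: contraNneq => ->; rewrite mulr0.
Qed.

Let muF : clim F mu 0.
Proof.
have nb : - toC (b_tot S) != 0 by rewrite oppr_eq0.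
have h := climM FF idF (climV FF nb zlambdaF); rewrite mul0r in h.
apply: (clim_near FF _ h); apply: filterS near_punctured => z /andP[z0 _].
by rewrite nrm_gt0 in z0; rewrite /mu invfM mulrA mulfV// mul1r.
Qed.

Let mutheta i : clim F (fun z => mu z / theta i z) (- (toC (b_ch S i))^-1).
Proof.
have nb : - toC (b_ch S i) != 0 by rewrite oppr_eq0.
have h := climV FF nb (thetalambdaF i); rewrite invrN in h.
apply: (clim_near FF _ h).
by apply: filterE => z; rewrite /mu invfM mulrC.
Qed.

Let N (z : C) := 1%:M - mu z *: L1.

Let NF : mxclim F N 1%:M.
Proof.
have -> : 1%:M = 1%:M - 0 *: L1 by rewrite scale0r subr0.
apply: mxclimB; first exact: mxclim_cst.
move=> i j; rewrite mxE; apply: (clim_ext (f := fun z => mu z * L1 i j)).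
  by move=> z; rewrite [in RHS]mxE.
by apply: climM => //; exact: clim_cst.
Qed.

Let Nunit : F (fun z => N z \in unitmx).
Proof. exact: (clim_unitmx FF (unitmx1 _ _) NF). Qed.

Let NVF : mxclim F (fun z => invmx (N z)) 1%:M.
Proof. by rewrite -[in X in mxclim _ _ X](invmx1 C n); exact: (mxclimV FF (unitmx1 _ _) NF). Qed.

Let L1N z : lambda S z != 0 -> L1 - (lambda S z)%:M = - lambda S z *: N z.
Proof.
move=> l0; rewrite /N scalerBr scalerA /mu mulNr mulfV// scaleN1r opprK addrC.
by rewrite scaleNr scale_scalar_mx mulr1.
Qed.

Let L1unit : F (fun z => L1 - (lambda S z)%:M \in unitmx).
Proof.
apply: filterS2 lambda_neq0 Nunit => z l0 uN; rewrite (L1N l0) unitmxZ ?unitfE ?oppr_eq0 ?l0//; exact: uN.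
Qed.

Let RE : F (fun z => forall i j,
  Rmx S (lambda S z) i j = - mu z * invmx (N z) (attach S i) (attach S j)).
Proof.
apply: filterS2 lambda_neq0 Nunit => z l0 uN i j.
by rewrite mxE L1N// invmxZ ?unitmxZ ?unitfE ?oppr_eq0// mxE /mu invrN.
Qed.

Let attach_neq i j : i != j -> attach S i != attach S j.
Proof.
apply: contra => /eqP h; apply/eqP; apply: (attach_distinct hS).
by rewrite -!(core_attach hS) h.
Qed.

Let R_F i j : clim F (fun z => Rmx S (lambda S z) i j / mu z) (- (i == j)%:R).
Proof.
apply: (clim_near FF (f := fun z => - invmx (N z) (attach S i) (attach S j))).
  apply: filterS2 lambda_neq0 RE => z l0 ->.
  have m0 : mu z != 0 by rewrite invr_eq0.
  by move: (invmx _ _ _) => y; field.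
apply: climN; have := NVF (attach S i) (attach S j); rewrite mxE.
have -> // : (attach S i == attach S j) = (i == j).
by apply/idP/idP => [|/eqP ->//]; apply: contraTT => /attach_neq.
Qed.

Let R_off i j : i != j -> clim F (fun z => Rmx S (lambda S z) i j / mu z ^+ 2)
  (- L1 (attach S i) (attach S j)).
Proof.
move=> ij; apply: (clim_near FF
    (f := fun z => - (L1 *m invmx (N z)) (attach S i) (attach S j))).
  apply: filterS3 lambda_neq0 RE Nunit => z l0 -> uN.
  have m0 : mu z != 0 by rewrite invr_eq0.
  have E : invmx (N z) = 1%:M + mu z *: (L1 *m invmx (N z)).
    rewrite -{1}[invmx _]mul1mx -{1}(subrK (mu z *: L1) 1%:M) mulmxDl.
    by rewrite mulmxV// scalemxAl.
  have -> : invmx (N z) (attach S i) (attach S j)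
      = mu z * (L1 *m invmx (N z)) (attach S i) (attach S j).
    rewrite {1}E mxE [X in X + _]mxE (negbTE (attach_neq ij)) add0r.
    by rewrite [LHS]mxE.
  by move: (_ (attach S i) _) => y; field.
apply: climN; have := mxclimM FF (mxclim_cst FF L1) NVF (attach S i) (attach S j).
by rewrite mulmx1.
Qed.

Let Rlim : mxclim F (fun z => Rmx S (lambda S z)) 0.
Proof.
move=> i j; have -> : (0 : 'M[C]_m) i j = 0 by rewrite mxE.
have h := climM FF (R_F i j) muF; rewrite mulr0 in h; apply: (clim_near FF _ h).
by apply: filterS lambda_neq0 => z l0; rewrite divfK// invr_eq0.
Qed.

Let G i z : C := toC (bcoef S i 0) * jost i 1 z.

Let GF i : clim F (G i) 0.
Proof.
have h := climM FF (clim_cst FF (toC (bcoef S i 0))) (jost1F i).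
by rewrite mulr0 in h.
Qed.

Let Ed z := diag_mx (\row_i jost i 0 z).
Let Gd z := diag_mx (\row_i G i z).
Let Ed0 := diag_mx (\row_i E0 i).

Let EdF : mxclim F Ed Ed0.
Proof. by apply: mxclim_diag => i; exact: jost0F. Qed.

Let GdF : mxclim F Gd 0.
Proof.
have -> : 0 = diag_mx (\row_(i < m) (0 : C)).
  by apply/matrixP => i j; rewrite !mxE mul0rn.
by apply: mxclim_diag => i; exact: GF.
Qed.

Let Ed0unit : Ed0 \in unitmx.
Proof. by rewrite diag_unitmx; apply/forallP => i; exact: E0_neq0. Qed.

Let Ed0E : Ed0 = Ed0 - (0 : 'M[C]_m) *m (0 : 'M[C]_m).
Proof. by rewrite mulmx0 subr0. Qed.

Let Tunit : F (fun z => T z \in unitmx).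
Proof.
apply: (clim_unitmx FF Ed0unit); rewrite Ed0E.
move=> i j; apply: (clim_ext (f := fun z => (Ed z - Rmx S (lambda S z) *m Gd z) i j)).
  by move=> z; rewrite (T_resolvent S theta e).
by apply: mxclimB => //; exact: mxclimM.
Qed.

Lemma regular_near0 : F reg.
Proof.
have nE : F (fun z => Emx theta e 1 z \in unitmx).
  have all : F (fun z => forall i, jost i 1 z != 0).
    exact: (@filter_forall _ _ (fun i z => jost i 1 z != 0) F FF jost1_neq0).
  by apply: filterS all => z h; rewrite diag_unitmx; apply/forallP.
apply: filterS3 near_punctured L1unit (filterI Tunit nE) => z /andP[z0 z1] uL [uT uE].
by split=> //; [rewrite /closed_disk /= norm_le1|rewrite -nrm_gt0].
Qed.

Let X z := invmx (Ed z - Gd z *m Rmx S (lambda S z)).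

Let Xu : F (fun z => Ed z - Gd z *m Rmx S (lambda S z) \in unitmx).
Proof.
apply: (clim_unitmx FF Ed0unit); rewrite Ed0E.
by apply: mxclimB => //; exact: mxclimM.
Qed.

Let XF i j : clim F (fun z => X z i j) ((i == j)%:R / E0 j).
Proof.
have h : mxclim F X (invmx Ed0).
  apply: (mxclimV FF Ed0unit); rewrite Ed0E.
  by apply: mxclimB => //; exact: mxclimM.
have := h i j; rewrite invmx_diag; last exact: E0_neq0.
rewrite !mxE; case: eqVneq => [->|_]; first by rewrite mulr1n mul1r.
by rewrite mulr0n mul0r.
Qed.

(** In this form the resolvent entries, which off the diagonal are of second
    order in [mu = lambda^-1], are factored out. *)
Let QE : F (fun z => forall i j, i != j ->
  invmx (T z) i j / G j z = (Rmx S (lambda S z) *m X z) i j / jost i 0 z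
  /\ X z i j = G i z / jost i 0 z * (Rmx S (lambda S z) *m X z) i j).
Proof.
have nE : F (fun z => forall i, jost i 0 z != 0).
  apply: (@filter_forall _ _ (fun i z => jost i 0 z != 0) F FF) => i.
  exact: (clim_neq0 FF (E0_neq0 i) (jost0F i)).
apply: filterS3 regular_near0 Xu nE => z rz uX E0z i j ij.
have [_ _ _ uT _] := rz; rewrite T_resolvent in uT *.
have G0 k : G k z != 0 by rewrite mulf_neq0 ?(bcoef_neq0 hS) ?(regular_jost1 _ rz).
exact (@resolvent_off C m (fun i => jost i 0 z) (fun i => G i z) _ i j uT uX E0z G0 ij).
Qed.

Let RX_small i j : i != j ->
  clim F (fun z => (Rmx S (lambda S z) *m X z) i j / mu z) 0.
Proof.
move=> ij; have -> : 0 = \sum_k - (i == k)%:R * ((k == j)%:R / E0 j) :> C.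
  rewrite big1// => k _; case: (eqVneq i k) => [<-|_].
    by rewrite (negbTE ij) mul0r mulr0.
  by rewrite mulr0n oppr0 mul0r.
apply: (clim_ext (f := fun z => \sum_k Rmx S (lambda S z) i k / mu z * X z k j)).
  by move=> z; rewrite mxE mulr_suml; apply: eq_bigr => k _; rewrite mulrAC.
by apply: clim_sum => k _; apply: climM; [exact: R_F|exact: XF].
Qed.

Let X_small i j : i != j -> clim F (fun z => X z i j / mu z) 0.
Proof.
move=> ij; have -> : 0 = 0 / E0 i * 0 :> C by rewrite mulr0.
apply: (clim_near FF (f := fun z => G i z / jost i 0 z
    * ((Rmx S (lambda S z) *m X z) i j / mu z))).
  by apply: filterS QE => z /(_ i j ij)[_ E]; rewrite [in RHS]E mulrA.
by apply: climM; [apply: climM; [exact: GF|exact: climV]|exact: RX_small].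
Qed.

Let RX_lim : clim F (fun z => (Rmx S (lambda S z) *m X z) c d / mu z ^+ 2)
  (- L1 (attach S c) (attach S d) / E0 d).
Proof.
pose a k : C := if c == k then 0
  else - L1 (attach S c) (attach S k) * ((k == d)%:R / E0 d).
have -> : - L1 (attach S c) (attach S d) / E0 d = \sum_k a k.
  rewrite (bigD1 d)//= big1 ?addr0; first by rewrite /a (negbTE cd) eqxx mul1r.
  by move=> k kd; rewrite /a (negbTE kd) mul0r mulr0; case: ifP.
apply: (clim_ext (f := fun z => \sum_k Rmx S (lambda S z) c k * X z k d / mu z ^+ 2)).
  by move=> z; rewrite mxE mulr_suml.
apply: clim_sum => k _; rewrite /a; case: (eqVneq c k) => [<-|ck].
  have -> : 0 = - (c == c)%:R * 0 :> C by rewrite mulr0.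
  apply: (clim_ext (f := fun z => Rmx S (lambda S z) c c / mu z * (X z c d / mu z))).
    by move=> z; rewrite mulf_div expr2.
  by apply: climM; [exact: R_F|exact: X_small].
apply: (clim_ext (f := fun z => Rmx S (lambda S z) c k / mu z ^+ 2 * X z k d)).
  by move=> z; rewrite mulrAC.
by apply: climM; [exact: R_off|exact: XF].
Qed.

Let theta_neq0F i : F (fun z => theta i z != 0).
Proof. by apply: filterS near_punctured => z; exact: (theta_neq0 hS htheta). Qed.

Let one_sub i : clim F (fun z => 1 - theta i z ^+ 2) 1.
Proof.
have -> : 1 = 1 - 0 ^+ 2 :> C by rewrite expr0n subr0.
by apply: climB; [rewrite expr0n subr0; exact: clim_cst|exact: climX].
Qed.

Let fluxF i : clim F (fun z => ((theta i z)^-1 - theta i z) * mu z)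
  (- (toC (b_ch S i))^-1).
Proof.
rewrite -[X in clim _ _ X]mulr1.
apply: (clim_near FF _ (climM FF (mutheta i) (one_sub i))).
by apply: filterS (theta_neq0F i) => z t0; field.
Qed.

(** The orders in [mu] cancel: the off-diagonal resolvent entry contributes
    [mu ^+ 2], and each factor [theta^-1 - theta] contributes [mu^-1]. *)
Lemma flux_scat_near0 : clim F (fun z =>
    toC (b_ch S c) * ((theta c z)^-1 - theta c z) * scat S theta e c d z)
  (- L1 (attach S c) (attach S d) / E0 d / E0 c).
Proof.
have -> : - L1 (attach S c) (attach S d) / E0 d / E0 c
  = toC (b_ch S c) * toC (b_ch S d) * (- (toC (b_ch S c))^-1 * - (toC (b_ch S d))^-1)
    * (- L1 (attach S c) (attach S d) / E0 d / E0 c).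
  by field; rewrite !E0_neq0 !bch0.
apply: (clim_near FF (f := fun z => toC (b_ch S c) * toC (b_ch S d)
    * (((theta c z)^-1 - theta c z) * mu z * (((theta d z)^-1 - theta d z) * mu z))
    * ((Rmx S (lambda S z) *m X z) c d / mu z ^+ 2 / jost c 0 z))).
  apply: filterS2 QE lambda_neq0 => z /(_ c d cd)[E _] l0.
  have m0 : mu z != 0 by rewrite invr_eq0.
  have -> : scat S theta e c d z = toC (b_ch S d) * ((theta d z)^-1 - theta d z)
      * (invmx (T z) c d / G d z).
    by rewrite /scat /G [in RHS]invfM; ring.
  rewrite E; move: (_ c d) => x.
  rewrite (_ : x / mu z ^+ 2 = x / mu z / mu z); last by rewrite expr2 invfM mulrA.
  move: ((theta c z)^-1 - _) ((theta d z)^-1 - _) ((jost c 0 z)^-1) => u v y.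
  by field.
apply: climM; last by apply: climM; [exact: RX_lim|exact: climV].
apply: climM; first exact: clim_cst.
by apply: climM; exact: fluxF.
Qed.

Lemma scat_near0 : clim F (scat S theta e c d) 0.
Proof.
set l := - L1 (attach S c) (attach S d) / E0 d / E0 c.
have -> : 0 = l * (0 / (toC (b_ch S c) * 1)) by rewrite mul0r mulr0.
have o1 : F (fun z => 1 - theta c z ^+ 2 != 0).
  exact: (clim_neq0 FF (oner_neq0 _) (one_sub c)).
apply: (clim_near FF _ (climM FF flux_scat_near0
  (climM FF (thetaF c) (climV FF _ (climM FF (clim_cst FF (toC (b_ch S c))) (one_sub c)))))).
  apply: filterS2 (theta_neq0F c) o1 => z t0 h.
  have -> : (theta c z)^-1 - theta c z = (1 - theta c z ^+ 2) / theta c z by field.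
  by field; rewrite t0 bch0 h.
by rewrite mulr1.
Qed.

End NearZero.

(** * Extension to the non-regular points *)

Section Extension.
Variable R : realType.
Local Notation C := (Cplx R).
Variables (A : countType) (m n : nat) (S : system R A m n).
Hypothesis hS : admissible S.
Variable theta : 'I_m -> C -> C.
Hypothesis htheta : spectral_map S theta.
Variables (e p : 'I_m -> nat -> C -> C).
Hypothesis he : jost_solution S e.
Hypothesis hp : p_solution S p.

Local Notation L1 := (L1mx S).
Local Notation reg := (regular S theta e).
Local Notation near_reg := (near_regular S theta e).
Local Notation jost := (jost_at theta e).
Local Notation scat := (scat S theta e).
Local Notation poles := (Omega S theta e p).

Let near_reg_filter w : Filter (near_reg w).
Proof. exact: within_filter. Qed.

Lemma regular_self w P : reg w -> near_reg w P -> P w.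
Proof. by move=> rw /nbhs_singleton; exact. Qed.

Lemma near_reg_regular w : near_reg w reg.
Proof. by rewrite /near_regular /within /=; apply: filterE. Qed.

Lemma near_reg_proper_regular w : reg w -> ProperFilter (near_reg w).
Proof. by move=> rw; apply: Build_ProperFilter_ex => P /(regular_self rw); exists w. Qed.

(** Where there is no regular point nearby, every limit is vacuous and the
    point counts as a pole; hence outside the poles regular points accumulate. *)
Lemma near_reg_proper (c : 'I_m) w :
  closed_disk w -> w != 0 -> ~ poles w -> ProperFilter (near_reg w).
Proof.
move=> w1 w0 np; apply: Build_ProperFilter => h; apply: np; split=> //.
exists 0%N, c, c => P _; rewrite /nbhs /=.
by apply: filterS h => z [].
Qed.

Lemma pole_of_unbounded w c d k : closed_disk w -> w != 0 ->
  (forall M : R, near_reg w (fun z => M < nrm (Uformula S theta e p k z c d))) ->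
  poles w.
Proof.
move=> w1 w0 h; split=> //; exists k, c, d => P [M [Mr hM]].
have [x Mx] : exists x : R, M = toC x by exact/complex_realP.
apply: filterS (h x) => z /= hz; apply: hM.
by rewrite Mx normE toC_lt.
Qed.

(** A regular point has all entries of [Uformula] continuous, the diagonal
    ones with [p] included, so none of them is unbounded there. *)
Lemma regular_not_pole w : reg w -> ~ poles w.
Proof.
move=> rw [_ w0 [k [c [d hpole]]]].
have PF := near_reg_proper_regular rw.
have /andP[_ w1] := regular_disk rw.
have lim := Uformula_lim hS htheta he hp PF w1 (@near_reg_disk _ _ _ _ _ _ _ w) w0 rw k c d.
pose M := nrm (Uformula S theta e p k w c d) + 1.
have big : near_reg w (fun z => M < nrm (Uformula S theta e p k z c d)).
  have : nbhs (+oo : set_system C) (fun x => toC M < x).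
    exists (toC M); split=> //; apply/complex_realP; by exists M.
  move/hpole; rewrite /nbhs /= => h; apply: filterS h => z /=.
  by rewrite normE toC_lt.
have [z [/= h1 h2]] := filter_meet PF big (lim 1 ltr01).
have := nrm_le_dist (Uformula S theta e p k z c d) (Uformula S theta e p k w c d).
move: h1 h2; rewrite /M; move: (nrm (_ - _)) (nrm _) (nrm _) => x y z'; lra.
Qed.

(** For [theta c w != 0] because of the asymptotics [t ^+ k] at infinity; for
    [theta c w = 0] because [e c 0] does not vanish at the origin. *)
Lemma jost_neq0 c w : nrm w <= 1 -> exists k, jost c k w != 0.
Proof.
move=> w1; have [rad [g [rad1 gP g0 eE]]] := jost_expansion hS c he.
have t1 := theta_le1 hS htheta c w1.
have [t0|t0] := eqVneq (theta c w) 0.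
  by exists 0%N; rewrite /jost_at eE// t0 expr0 mul1r.
have tn : 0 < `|theta c w| <= 1 by rewrite norm_le1 normr_gt0 t0.
have /climP/(_ 1 ltr01)[N _ hN] := jost_asymp he c tn.
exists N; apply/eqP => h; have := hN N (leqnn N).
by rewrite /= -/(jost c N w) h mul0r sub0r nrmN nrm1 ltxx.
Qed.

(** At a non-regular point all the entries entering [scat] are quotients of
    germs in the common uniformizer, so [scat] has a limit, finite or not. *)
Lemma scat_dichotomy w c d : 0 < nrm w <= 1 -> ~ reg w -> ProperFilter (near_reg w) ->
  (exists l, clim (near_reg w) (scat c d) l) \/
  forall M : R, near_reg w (fun z => M < nrm (scat c d z)).
Proof.
move=> w01 nrw PF; have [tau [tau2 tau0 thetaE]] := theta_uniformized hS htheta w01.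
have finer (P : set C) : punctured w P -> near_reg w P.
  rewrite /punctured /near_regular /within /= => /nbhsCP[r r0 hr].
  apply/nbhsCP; exists r; first exact: r0.
  move=> z zr rz; apply: hr; first exact: zr.
  have /andP[_ z1] := regular_disk rz; split; first exact: z1.
  by apply/eqP => zw; apply: nrw; rewrite -zw.
have tau0' : clim (near_reg w) tau 0 by move=> r r0; apply: finer; exact: tau0.
have all (P : set C) : (forall z, reg z -> P z) -> near_reg w P.
  by move=> h; rewrite /near_regular /within /=; apply: filterE.
have idP : puiseux (near_reg w) tau id.
  have wA : analytic (fun t : C => w + t ^+ 2).
    by apply: anaD (ana_cst _) _; apply: anaX; exact: ana_id.
  apply: px_near (px_analytic _ _ wA); apply: filterE => z /=.
  by rewrite tau2 addrC subrK.
have nz : near_reg w (fun z => z != 0) by apply: all => z [].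
have jostP i k : puiseux (near_reg w) tau (jost i k).
  have [phi [phiA phi0 phiE]] := thetaE i.
  have [rad [g [rad1 gP g0 eE]]] := jost_expansion hS i he.
  have gA : analytic (fun t => phi t ^+ k * g k (phi t)).
    apply: anaM; first exact: anaX.
    by apply: ana_comp (gP k) phiA _; exact: le_lt_trans rad1.
  apply: px_near (px_analytic _ _ gA).
  apply: filterS2 (finer _ phiE) (all (fun z => nrm z <= 1) _) => [z E z1|z rz].
    by rewrite /jost_at /= -E eE// (theta_le1 hS htheta).
  by have /andP[] := regular_disk rz.
have thetaP i : puiseux (near_reg w) tau (theta i).
  have [phi [phiA _ phiE]] := thetaE i.
  apply: px_near (px_analytic _ _ phiA).
  by apply: filterS (finer _ phiE) => z ->.
have lambdaP : puiseux (near_reg w) tau (lambda S).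
  apply: pxB; first exact: px_cst.
  apply: pxM; first exact: px_cst.
  by apply: pxD => //; exact: pxV.
have diagP (f : 'I_m -> C -> C) : (forall i, puiseux (near_reg w) tau (f i)) ->
    mx_puiseux (near_reg w) tau (fun z => diag_mx (\row_i f i z)).
  move=> hf i j; have [<-|ij] := eqVneq i j.
    by apply: px_near (hf i); apply: filterE => z; rewrite !mxE eqxx mulr1n.
  by apply: px_near (px_cst _ _ 0); apply: filterE => z; rewrite !mxE (negbTE ij) mulr0n.
have cstP q r (M : 'M[C]_(q, r)) : mx_puiseux (near_reg w) tau (fun=> M).
  by move=> i j; exact: px_cst.
have L1P : mx_puiseux (near_reg w) tau (fun z => L1 - (lambda S z)%:M).
  apply: mx_pxB => // i j; have [<-|ij] := eqVneq i j.
    by apply: px_near lambdaP; apply: filterE => z; rewrite !mxE eqxx mulr1n.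
  by apply: px_near (px_cst _ _ 0); apply: filterE => z; rewrite !mxE (negbTE ij) mulr0n.
have RP : mx_puiseux (near_reg w) tau (fun z => Rmx S (lambda S z)).
  have L1V : mx_puiseux (near_reg w) tau (fun z => invmx (L1 - (lambda S z)%:M)).
    by apply: mx_pxV L1P; apply: all => z [].
  move=> i j; apply: px_near (L1V (attach S i) (attach S j)).
  by apply: filterE => z; rewrite mxE.
have TP : mx_puiseux (near_reg w) tau (Tmx S theta e).
  apply: mx_pxB; first by apply: diagP => i; exact: jostP.
  apply: mx_pxM; last by apply: diagP => i; exact: jostP.
  exact: mx_pxM.
have invTP : mx_puiseux (near_reg w) tau (fun z => invmx (Tmx S theta e z)).
  by apply: mx_pxV TP; apply: all => z [].
apply: (puiseux_dichotomy PF tau0'); apply: pxM; first exact: invTP.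
apply: pxM; last first.
  by apply: pxV => //; apply: all => z rz; exact: (regular_jost1 d rz).
apply: pxM; first exact: px_cst.
apply: pxB => //; apply: pxV => //.
by apply: all => z /regular_disk z01; exact: (theta_neq0 hS htheta d z01).
Qed.

Section Coefficient.
Variables (s : 'I_m -> 'I_m -> C -> C).
Hypothesis hs : scattering_coef S theta e p s.
Variables (c d : 'I_m).
Hypothesis cd : c != d.

(** Once [scat] has a limit at a point which is not a pole, this limit is the
    scattering coefficient: divide by a nonzero value of the Jost solution. *)
Lemma scattering_value w l : (closed_disk `\` poles) w -> ProperFilter (near_reg w) ->
  clim (near_reg w) (scat c d) l -> s c d w = l.
Proof.
move=> [w1 nw] PF hl; have := w1; rewrite /closed_disk /= norm_le1 => w1'.
have [k jk] := jost_neq0 c w1'.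
apply: (mulIf jk); rewrite -(hs cd (conj w1 nw) k) /U.
case: asboolP => [rw|nrw].
  rewrite (Uformula_off hS p k rw cd) mulrC; congr (_ * _).
  have /andP[w0 _] := regular_disk rw; rewrite nrm_gt0 in w0.
  apply: (@clim_unique _ _ (near_reg w) _ _ _ _ _ hl).
  exact: (scat_lim hS htheta he _ w1' (@near_reg_disk _ _ _ _ _ _ _ w) w0 rw).
have : clim (near_reg w) (fun z => Uformula S theta e p k z c d) (l * jost c k w).
  apply: (@clim_near _ _ (near_reg w) _ (fun z => scat c d z * jost c k z)).
    rewrite /near_regular /within /=; apply: filterE => z rz.
    by rewrite (Uformula_off hS p k rz cd) mulrC.
  apply: climM => //.
  exact: (jost_lim hS htheta he _ w1' (@near_reg_disk _ _ _ _ _ _ _ w)).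
by move/climP/(cvg_lim (@norm_hausdorff _ _)).
Qed.

Lemma near_origin_reg P : near_origin P -> near_reg 0 P.
Proof.
rewrite /near_origin /dnbhs /near_regular /within /= => h.
by apply: filterS h => z h [_ z0 _ _ _]; exact: h.
Qed.

Lemma near_reg0_proper : ProperFilter (near_reg 0).
Proof.
apply: Build_ProperFilter_ex => P hP.
have FF : ProperFilter (@near_origin R) by exact: Proper_dnbhs_numFieldType.
have reg0 := regular_near0 hS htheta he c.
have : near_origin (fun z => reg z -> P z).
  move: hP => /nbhsCP[r r0 hr]; apply/nbhsCP.
  by exists r => // z zr _ rz; exact: hr.
move=> h; have [z [rz hz]] := filter_meet FF reg0 h.
by exists z; exact: hz.
Qed.

Lemma scattering_limit w : (closed_disk `\` poles) w ->
  ProperFilter (near_reg w) /\ clim (near_reg w) (scat c d) (s c d w).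
Proof.
move=> Aw; have [w1 nw] := Aw; have := w1; rewrite /closed_disk /= norm_le1 => w1'.
have [w0|w0] := eqVneq w 0.
  have PF := near_reg0_proper; rewrite w0 in Aw *; split=> //.
  have h : clim (near_reg 0) (scat c d) 0.
    by move=> r r0; apply: near_origin_reg; exact: (scat_near0 hS htheta he cd r0).
  by rewrite (scattering_value Aw PF h).
have PF := near_reg_proper c w1 w0 nw; split=> //.
suff [l hl] : exists l, clim (near_reg w) (scat c d) l.
  by rewrite (scattering_value Aw PF hl).
have [rw|nrw] := pselect (reg w).
  exists (scat c d w).
  exact: (scat_lim hS htheta he _ w1' (@near_reg_disk _ _ _ _ _ _ _ w) w0 rw).
have w01 : 0 < nrm w <= 1 by rewrite nrm_gt0 w0.
have [//|inf] := scat_dichotomy c d w01 nrw PF.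
have [k jk] := jost_neq0 c w1'.
exfalso; apply: nw; apply: (@pole_of_unbounded w c d k) => // M.
have jl := jost_lim hS htheta he (near_reg_filter w) w1' (@near_reg_disk _ _ _ _ _ _ _ w) c k.
have j2 : 0 < nrm (jost c k w) / 2 by rewrite divr_gt0// nrm_gt0.
have rr := near_reg_regular w.
apply: filterS3 (inf (2 * `|M| / nrm (jost c k w))) (jl _ j2) rr => z h1 h2 rz.
have jn : 0 < nrm (jost c k w) by rewrite nrm_gt0.
rewrite (Uformula_off hS p k rz cd) nrmM; move: h1; rewrite (ltr_pdivrMr _ _ jn) => h1.
have h3 : nrm (jost c k w) / 2 < nrm (jost c k z).
  have := nrm_le_dist (jost c k w) (jost c k z); rewrite nrmBC; lra.
have s0 := nrm_ge0 (scat c d z).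
apply: le_lt_trans (ler_norm M) _; apply: (@lt_le_trans _ _ (nrm (scat c d z) * (nrm (jost c k w) / 2))).
  lra.
by rewrite mulrC; apply: ler_wpM2r; [exact: s0|exact: ltW h3].
Qed.

(** A function extended by its limits along a dense set is continuous. *)
Lemma scattering_continuous : {within closed_disk `\` poles, continuous (s c d)}.
Proof.
apply/subspace_continuousP => w Aw; apply/climP => eps eps0.
have [PF hw] := scattering_limit Aw.
have eps2 : 0 < eps / 2 by rewrite divr_gt0.
have := hw _ eps2; rewrite /near_regular /within /= => /nbhsCP[r r0 hr].
apply/nbhsCP; exists r => // z zw Az; have [PFz hz] := scattering_limit Az.
have close : near_reg z (fun y => nrm (y - w) < r).
  rewrite /near_regular /within /=; apply/nbhsCP; exists (r - nrm (z - w)).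
    by rewrite subr_gt0.
  by move=> y yz _; have := nrm_triB y z w; lra.
have rr := near_reg_regular z.
have [y [[h1 h2] h3]] := filter_meet PFz (filterI close (hz _ eps2)) rr.
have := hr y h1 h3; have := nrm_triB (s c d z) (scat c d y) (s c d w).
by rewrite (nrmBC (s c d z) (scat c d y)); move: h2 => /=; lra.
Qed.

End Coefficient.

Lemma reciprocity (s : 'I_m -> 'I_m -> C -> C) (c d : 'I_m) w :
  scattering_coef S theta e p s -> c != d -> (closed_disk `\` poles) w -> w != 0 ->
  toC (b_ch S c) * ((theta c w)^-1 - theta c w) * s c d w
  = toC (b_ch S d) * ((theta d w)^-1 - theta d w) * s d c w.
Proof.
move=> hs cd Aw w0; have [PF hcd] := scattering_limit hs cd Aw.
have [_ hdc] : ProperFilter (near_reg w) /\ clim (near_reg w) (scat d c) (s d c w).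
  by apply: scattering_limit => //; rewrite eq_sym.
have [w1 _] := Aw; rewrite /closed_disk /= norm_le1 in w1.
have fl i := flux_lim hS htheta PF w1 (@near_reg_disk _ _ _ _ _ _ _ w) w0 i.
have flux_scat (i j : 'I_m) (l : C) : clim (near_reg w) (scat i j) l ->
    clim (near_reg w) (fun z =>
      toC (b_ch S i) * ((theta i z)^-1 - theta i z) * scat i j z)
    (toC (b_ch S i) * ((theta i w)^-1 - theta i w) * l).
  by move=> hl; apply: climM => //; apply: climM; [exact: clim_cst|exact: fl].
apply: (@clim_unique _ _ _ PF _ _ _ (flux_scat c d _ hcd)).
apply: (clim_near (near_reg_filter w) _ (flux_scat d c _ hdc)).
rewrite /near_regular /within /=; apply: filterE => z rz.
by rewrite (scat_symmetric hS).
Qed.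

Lemma reciprocity_origin (s : 'I_m -> 'I_m -> C -> C) (c d : 'I_m) :
  scattering_coef S theta e p s -> c != d -> exists l : C,
  clim (@near_origin R) (fun w => toC (b_ch S c) * ((theta c w)^-1 - theta c w) * s c d w) l.
Proof.
move=> hs cd; eexists.
have FF : ProperFilter (@near_origin R) by exact: Proper_dnbhs_numFieldType.
apply: (clim_near FF _ (flux_scat_near0 hS htheta he cd)).
apply: filterS (regular_near0 hS htheta he c) => z rz; congr (_ * _).
have [z1 z0 _ _ _] := rz; have nz := regular_not_pole rz.
have [PF hz] := scattering_limit hs cd (conj z1 nz).
rewrite /closed_disk /= norm_le1 in z1.
apply: (@clim_unique _ _ _ PF _ _ _ _ hz).
exact: (scat_lim hS htheta he _ z1 (@near_reg_disk _ _ _ _ _ _ _ z) z0 rz).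
Qed.

End Extension.

Theorem lemma7p1 (R : realType) (A : countType) (m n : nat)
    (S : system R A m n) (hS : admissible S)
    (theta : 'I_m -> Cplx R -> Cplx R) (htheta : spectral_map S theta)
    (e : 'I_m -> nat -> Cplx R -> Cplx R) (he : jost_solution S e)
    (p : 'I_m -> nat -> Cplx R -> Cplx R) (hp : p_solution S p)
    (s : 'I_m -> 'I_m -> Cplx R -> Cplx R)
    (hs : scattering_coef S theta e p s)
    (sigma gamma : 'I_m) (hsg : sigma != gamma) :
  let lhs (w : Cplx R) : Cplx R :=
    toC (b_ch S gamma) * ((theta gamma w)^-1 - theta gamma w)
      * s gamma sigma w in
  let rhs (w : Cplx R) : Cplx R :=
    toC (b_ch S sigma) * ((theta sigma w)^-1 - theta sigma w)
      * s sigma gamma w in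
  [/\ forall w, (closed_disk `\` Omega S theta e p) w -> w != 0 ->
        lhs w = rhs w,
      exists l : Cplx R, lhs w @[w --> 0^'] --> l /\ rhs w @[w --> 0^'] --> l,
      {within closed_disk `\` Omega S theta e p, continuous (s gamma sigma)}
    & {within closed_disk `\` Omega S theta e p, continuous (s sigma gamma)}].
Proof.
have hgs : gamma != sigma by rewrite eq_sym.
move=> lhs rhs; have rec w := reciprocity hS htheta he hs hgs (w := w).
split=> //; last 2 first.
- exact: (scattering_continuous hS htheta he hs hgs).
- exact: (scattering_continuous hS htheta he hs hsg).
have [l hl] := reciprocity_origin hS htheta he hp hs hgs.
have FF : ProperFilter (@near_origin R) by exact: Proper_dnbhs_numFieldType.
exists l; split; first exact/climP.
apply/climP; apply: (clim_near FF _ hl).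
apply: filterS (regular_near0 hS htheta he gamma) => z rz.
have [z1 z0 _ _ _] := rz.
by apply: rec => //; split=> //; exact: (regular_not_pole hS htheta he hp rz).
Qed.
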